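(* Let $n\ge1$. For the $n$-sphere of radius $R$ with the subspace metric the magnitude is given asymptotically by $$\bigl|S^n_{\mathrm{sub},R}\bigr|=\frac{\mathrm{vol}(S^n_R)}{n!\,\omega_n}\biggl(1+\frac{(n+1)n(n-2)}{8}R^{-2}+O(R^{-4})\biggr)\quad\text{as }R\to\infty.$$ For the $n$-sphere of radius $R$ with the intrinsic metric the magnitude is given asymptotically by $$\bigl|S^n_R\bigr|=\frac{\mathrm{vol}(S^n_R)}{n!\,\omega_n}\biggl(1+\frac{(n+1)n(n-1)}{6}R^{-2}+O(R^{-4})\biggr)\quad\text{as }R\to\infty.$$
   Context: $S^n_{\mathrm{sub},R}$ denotes the sphere of radius $R$ in $\mathbb{R}^{n+1}$ with the subspace metric, i.e. the restriction of the Euclidean distance of $\mathbb{R}^{n+1}$. $S^n_R$ denotes the same sphere with its intrinsic metric: the distance between two points is the infimum of the lengths of the paths in the sphere joining them. $\mathrm{vol}(S^n_R)$ is the $n$-dimensional volume of the sphere of radius $R$, and $\omega_n$ is the volume of the unit $n$-ball. A weight measure on a metric space $(X,d)$ is a finite signed Borel measure $\nu$ on $X$ such that $\int_{x\in X}e^{-d(x,y)}\,d\nu(x)=1$ for all $y\in X$. If a weight measure $\nu$ exists on $X$, the magnitude of $X$ is defined to be its total mass $|X|:=\nu(X)$ (which does not depend on the choice of weight measure). *)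

(* Defs.v *)
From HB Require Import structures.
From mathcomp Require Import all_boot all_order all_algebra.
From mathcomp Require Import ring lra.
From mathcomp Require Import all_classical all_reals all_analysis.

Set Implicit Arguments.
Unset Strict Implicit.
Unset Printing Implicit Defensive.

Import Order.TTheory GRing.Theory Num.Theory.
Import numFieldNormedType.Exports.

Local Open Scope classical_set_scope.
Local Open Scope ring_scope.

(* Required by the Landau notation [f =O_F g] at [F = +oo]. *)
Canonical pinfty_nbhs_filterType (R : numFieldType) :=
  @FilterType R (pinfty_nbhs R) _.

(** * Weight measures and magnitude of a metric space [(T, d)] *)

Definition metric_open (R : realType) (T : Type) (d : T -> T -> R) :
    set (set T) :=
  [set U | forall x, U x -> exists2 e, 0 < e & forall y, d x y < e -> U y].

(* [g_sigma_algebraType (metric_open d)] is [T] with its Borel sigma-algebra.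
   Values of a [charge] are finite, so this is a finite signed measure. *)
Notation borel_charge R d :=
  (charge (g_sigma_algebraType (metric_open d)) R).

(* Integration against a signed measure through its Jordan decomposition; the
   value does not depend on which Hahn decomposition is picked. *)
Definition charge_integral (R : realType) (disp : measure_display)
    (T : measurableType disp) (nu : {charge set T -> \bar R}) (f : T -> \bar R) :
    \bar R :=
  let H := projT2 (cid (projT2 (cid (Hahn_decomposition nu)))) in
  (\int[jordan_pos H]_x f x - \int[jordan_neg H]_x f x)%E.

Definition is_weight_measure (R : realType) (T : pointedType) (d : T -> T -> R)
    (nu : borel_charge R d) : Prop :=
  forall y : T, charge_integral nu (fun x => (expR (- d x y))%:E) = 1%E.

(* The total mass of a weight measure; junk value 0 if there is none. *)
Definition magnitude (R : realType) (T : pointedType) (d : T -> T -> R) : R :=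
  xget 0 [set m | exists2 nu : borel_charge R d,
    is_weight_measure nu & nu setT = m%:E].

(** * Euclidean space, spheres and their two metrics *)

Definition sqnorm (R : realType) (n : nat) (x : 'rV[R]_n) : R :=
  \sum_(i < n) x ord0 i ^+ 2.

(* The library norm on ['rV_n] is the sup norm, whence this definition. *)
Definition edist (R : realType) (n : nat) (x y : 'rV[R]_n) : R :=
  Num.sqrt (sqnorm (x - y)).

(* An equation in [r ^+ 2] makes the sphere inhabited for every [r], as required
   by [pointedType]; only [0 < r] is of interest. *)
Definition on_sphere (R : realType) (n : nat) (r : R) (x : 'rV[R]_n.+1) : bool :=
  sqnorm x == r ^+ 2.

Definition sphere (R : realType) (n : nat) (r : R) : Type :=
  {x : 'rV[R]_n.+1 | on_sphere r x}.

Definition sphere_pole (R : realType) (n : nat) (r : R) : 'rV[R]_n.+1 :=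
  \row_(i < n.+1) (if i == ord0 then r else 0).

Fact on_sphere_pole (R : realType) (n : nat) (r : R) :
  on_sphere r (sphere_pole n r).
Proof.
rewrite /on_sphere /sqnorm /sphere_pole big_ord_recl mxE eqxx big1 ?addr0// => i _.
by rewrite mxE expr0n.
Qed.

HB.instance Definition _ (R : realType) (n : nat) (r : R) :=
  Choice.copy (sphere n r) {x : 'rV[R]_n.+1 | on_sphere r x}.
HB.instance Definition _ (R : realType) (n : nat) (r : R) :=
  isPointed.Build (sphere n r) (exist (on_sphere r) _ (on_sphere_pole n r)).

Definition subspace_dist (R : realType) (n : nat) (r : R) (x y : sphere n r) : R :=
  edist (sval x) (sval y).

(* Same encoding of partitions and of their nodes as in [variation]. *)
Definition polygonal_length (R : realType) (n : nat) (a b : R)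
    (g : R -> 'rV[R]_n) (s : seq R) : R :=
  let F := g \o nth b (a :: s) in \sum_(0 <= k < size s) edist (F k) (F k.+1).

Definition path_length (R : realType) (n : nat) (a b : R) (g : R -> 'rV[R]_n) :
    \bar R :=
  ereal_sup [set (polygonal_length a b g s)%:E | s in itv_partition a b].

Definition sphere_paths (R : realType) (n : nat) (r : R) (x y : sphere n r) :
    set (R -> 'rV[R]_n.+1) :=
  [set g : R -> 'rV[R]_n.+1 | [/\ {within `[0, 1], continuous g},
               forall t : R, t \in `[0, 1] -> on_sphere r (g t),
               g 0 = sval x & g 1 = sval y]].

Definition intrinsic_dist (R : realType) (n : nat) (r : R) (x y : sphere n r) : R :=
  fine (ereal_inf [set path_length 0 1 g | g in sphere_paths x y]).

(** * Lebesgue measure on [R^n], as an iterated product measure *)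

Notation Rtuple n R := (n.-tuple (measurableTypeR R)).

Fact sigma_finite_product_measure (d1 d2 : measure_display)
    (T1 : measurableType d1) (T2 : measurableType d2) (R : realType)
    (m1 : {sigma_finite_measure set T1 -> \bar R})
    (m2 : {sigma_finite_measure set T2 -> \bar R}) :
  sigma_finite setT (m1 \x m2)%E.
Proof.
have /sigma_finiteP[F [TF ndF Foo]] := sigma_finiteT m1.
have /sigma_finiteP[G [TG ndG Goo]] := sigma_finiteT m2.
exists (fun k => F k `*` G k).
  rewrite -setXTT TF TG predeqE => -[x y]; split.
    move=> [/= [i _ Fix] [k _ Gky]]; exists (maxn i k) => //; split.
    - by move: x Fix; exact/subsetPset/ndF/leq_maxl.
    - by move: y Gky; exact/subsetPset/ndG/leq_maxr.
  by move=> [i _ []/= ? ?]; split; exists i.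
move=> k; have [? ?] := Foo k; have [? ?] := Goo k.
split; first exact: measurableX.
by rewrite product_measure1E// lte_mul_pinfty// ge0_fin_numE.
Qed.

Section cons_measure.
Context (R : realType) (n : nat).
Variable m : {sigma_finite_measure set (Rtuple n R) -> \bar R}.

Definition tuple_of_pair (p : measurableTypeR R * Rtuple n R) : Rtuple n.+1 R :=
  [tuple of p.1 :: p.2].

Definition pair_of_tuple (t : Rtuple n.+1 R) : measurableTypeR R * Rtuple n R :=
  (thead t, [tuple of behead t]).

Fact tuple_of_pairK : cancel tuple_of_pair pair_of_tuple.
Proof.
move=> [x t]; rewrite /pair_of_tuple /tuple_of_pair theadE.
by congr pair; exact: val_inj.
Qed.

Fact pair_of_tupleK : cancel pair_of_tuple tuple_of_pair.
Proof. by move=> t; rewrite /tuple_of_pair/= -tuple_eta. Qed.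

Fact measurable_tuple_of_pair : measurable_fun setT tuple_of_pair.
Proof. exact: measurable_cons. Qed.

Fact measurable_pair_of_tuple : measurable_fun setT pair_of_tuple.
Proof.
apply: measurable_fun_pair => /=; last exact: measurable_behead.
exact: (measurable_tnth ord0).
Qed.

Definition cons_measure : set (Rtuple n.+1 R) -> \bar R :=
  pushforward (lebesgue_measure \x m)%E tuple_of_pair.

Let cons_measure0 : cons_measure set0 = 0%E.
Proof. by rewrite /cons_measure /pushforward preimage_set0 measure0. Qed.

Let cons_measure_ge0 A : (0 <= cons_measure A)%E.
Proof. by rewrite /cons_measure /pushforward; exact: measure_ge0. Qed.

Let cons_measure_semi_sigma_additive : semi_sigma_additive cons_measure.
Proof.
move=> F mF tF mUF; rewrite /cons_measure /pushforward preimage_bigcup.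
have mt := measurable_tuple_of_pair.
apply: measure_semi_sigma_additive.
- by move=> k; rewrite -[X in measurable X]setTI; exact: mt.
- apply/trivIsetP => /= i j _ _ ij; rewrite -preimage_setI.
  by move/trivIsetP : tF => /(_ _ _ _ _ ij) ->//; rewrite preimage_set0.
- by rewrite -preimage_bigcup -[X in measurable X]setTI; exact: mt.
Qed.

HB.instance Definition _ := isMeasure.Build _ _ _ cons_measure
  cons_measure0 cons_measure_ge0 cons_measure_semi_sigma_additive.

Let cons_measure_sigma_finite : sigma_finite setT cons_measure.
Proof.
have [F TF Foo] := sigma_finite_product_measure (@lebesgue_measure R) m.
exists (fun k => pair_of_tuple @^-1` F k).
  by rewrite -preimage_bigcup -TF preimage_setT.
move=> k; have [mF Fk] := Foo k; split.
  by rewrite -[X in measurable X]setTI; exact: measurable_pair_of_tuple.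
rewrite /cons_measure /pushforward -comp_preimage.
by rewrite (_ : _ \o _ = id) ?preimage_id//; apply/funext => p; exact: tuple_of_pairK.
Qed.

HB.instance Definition _ := Measure_isSigmaFinite.Build _ _ _ cons_measure
  cons_measure_sigma_finite.

End cons_measure.

Fixpoint lebesgue_tuple (R : realType) (n : nat) :
    {sigma_finite_measure set (Rtuple n R) -> \bar R} :=
  match n with
  | 0 => dirac [tuple]
  | n'.+1 => cons_measure (lebesgue_tuple R n')
  end.

Definition row_of_tuple (R : realType) (n : nat) (t : Rtuple n R) : 'rV[R]_n :=
  \row_(i < n) tnth t i.

Definition unit_ball_volume (R : realType) (n : nat) : R :=
  fine (lebesgue_tuple R n [set t | sqnorm (row_of_tuple t) <= 1]).

(** * The [n]-dimensional volume of the sphere *)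

(* The Riemannian volume of the image of an injective immersion [phi], i.e. the
   integral of the square root of the Gram determinant of its partial
   derivatives. Those are the rows of ['J phi u]. *)
Definition param_volume (R : realType) (n m : nat) (phi : 'rV[R]_n -> 'rV[R]_m) :
    \bar R :=
  \int[lebesgue_tuple R n]_t
    (Num.sqrt (\det ('J phi (row_of_tuple t) *m ('J phi (row_of_tuple t))^T)))%:E.

(* Inverse stereographic projection from [sphere_pole n r]. *)
Definition stereographic (R : realType) (n : nat) (r : R) (u : 'rV[R]_n) :
    'rV[R]_n.+1 :=
  (r / (sqnorm u + 1)) *: row_mx (sqnorm u - 1)%:M (2 *: u) :> 'rV[R]_(1 + n).

Section stereographic_chart.
Context (R : realType) (n : nat).
Implicit Types (u v : 'rV[R]_n) (r : R).

Let sqnorm_ge0 m (u : 'rV[R]_m) : 0 <= sqnorm u.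
Proof. by apply: sumr_ge0 => i _; exact: sqr_ge0. Qed.

Let sqnorm_eq0 m (u : 'rV[R]_m) : sqnorm u = 0 -> u = 0.
Proof.
move=> /eqP; rewrite psumr_eq0; last by move=> i _; exact: sqr_ge0.
move=> /allP u0; apply/rowP => i; rewrite mxE.
by have := u0 i (mem_index_enum _); rewrite sqrf_eq0 => /eqP.
Qed.

Let sqnormZ m a (u : 'rV[R]_m) : sqnorm (a *: u) = a ^+ 2 * sqnorm u.
Proof. by rewrite mulr_sumr; apply: eq_bigr => i _; rewrite mxE exprMn. Qed.

Let sqnorm_row_mx a u :
  sqnorm (row_mx a%:M u : 'rV[R]_(1 + n)) = a ^+ 2 + sqnorm u.
Proof.
rewrite /sqnorm big_split_ord/= big_ord1 row_mxEl mxE eqxx mulr1n.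
by congr (_ + _); apply: eq_bigr => i _; rewrite row_mxEr.
Qed.

Let stereographicE r u : stereographic r u =
  row_mx (r / (sqnorm u + 1) * (sqnorm u - 1))%:M
         (r / (sqnorm u + 1) * 2 *: u) :> 'rV[R]_(1 + n).
Proof. by rewrite /stereographic scale_row_mx scalerA scale_scalar_mx. Qed.

Let poleE r : sphere_pole n r = row_mx r%:M 0 :> 'rV[R]_(1 + n).
Proof.
apply/rowP => i; rewrite !mxE; case: (@splitP 1 n i) => j ij.
  by rewrite mxE !ord1 eqxx mulr1n ifT//; apply/eqP/val_inj; rewrite /= ij ord1.
by rewrite mxE ifF//; apply/eqP => /(congr1 val); rewrite /= ij.
Qed.

Lemma stereographic_inj r : 0 < r -> injective (@stereographic R n r).
Proof.
move=> r0 u v; rewrite !stereographicE => /(@eq_row_mx _ 1 1) [].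
move=> /(congr1 (fun M : 'M[R]_1 => M 0 0)); rewrite !mxE eqxx !mulr1n => suv.
have su := sqnorm_ge0 u; have sv := sqnorm_ge0 v.
have su1 : sqnorm u + 1 != 0 by apply: lt0r_neq0; lra.
have sv1 : sqnorm v + 1 != 0 by apply: lt0r_neq0; lra.
have : r * (sqnorm u - 1) * (sqnorm v + 1) = r * (sqnorm v - 1) * (sqnorm u + 1).
  have -> : r * (sqnorm u - 1) * (sqnorm v + 1) =
    r / (sqnorm u + 1) * (sqnorm u - 1) * (sqnorm v + 1) * (sqnorm u + 1).
    by field.
  by rewrite suv; field.
move=> e; have {e} : r * (sqnorm u - sqnorm v) = 0 by lra.
move/eqP; rewrite mulf_eq0 gt_eqF//= subr_eq0 => /eqP <-.
move=> /scalerI; apply; rewrite mulf_neq0 ?pnatr_eq0// mulf_neq0 ?invr_eq0//.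
by rewrite gt_eqF.
Qed.

Lemma range_stereographic r : 0 < r ->
  range (@stereographic R n r) = [set x | on_sphere r x] `\ sphere_pole n r.
Proof.
move=> r0; apply/seteqP; split=> [_ [u _ <-]|x /= [/eqP sx xp]].
  have su := sqnorm_ge0 u.
  have su1 : sqnorm u + 1 != 0 by apply: lt0r_neq0; lra.
  split=> /=.
    apply/eqP; rewrite stereographicE sqnorm_row_mx sqnormZ; field.
    by rewrite su1.
  rewrite stereographicE poleE => /(@eq_row_mx _ 1 1) [].
  move=> /(congr1 (fun M : 'M[R]_1 => M 0 0)); rewrite !mxE eqxx !mulr1n => e _.
  have : r * (sqnorm u - 1) = r * (sqnorm u + 1) by rewrite -[in RHS]e; field.
  by move=> ?; lra.
have xE : x = row_mx (x ord0 ord0)%:M (rsubmx (x : 'rV_(1 + n))) :> 'rV[R]_(1 + n).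
  rewrite -[LHS](@hsubmxK _ 1 1 n); congr row_mx.
  rewrite [LHS]mx11_scalar mxE; congr ((x _ _)%:M); exact: val_inj.
move: (x ord0 ord0) (rsubmx _) xE => a b xE.
move: sx xp; rewrite {}xE poleE sqnorm_row_mx => sx xp.
have ar : a != r.
  apply/eqP => ar; apply: xp; rewrite ar (_ : b = 0)//; apply: sqnorm_eq0.
  by move: sx; rewrite ar; lra.
have ra : r - a != 0 by rewrite subr_eq0 eq_sym.
have sE : sqnorm ((r - a)^-1 *: b) = (r + a) / (r - a).
  have -> : (r + a) / (r - a) = (r - a)^-1 ^+ 2 * (r ^+ 2 - a ^+ 2) by field.
  by rewrite sqnormZ -sx; congr (_ * _); ring.
exists ((r - a)^-1 *: b) => //; rewrite stereographicE sE scalerA.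
have r2 : r + a + (r - a) != 0 by rewrite addrACA subrr addr0 gt_eqF ?addr_gt0.
have -> : r / ((r + a) / (r - a) + 1) * ((r + a) / (r - a) - 1) = a.
  by field; rewrite ?ra ?r2.
have -> : r / ((r + a) / (r - a) + 1) * 2 * (r - a)^-1 = 1.
  by field; rewrite ?ra ?r2.
by rewrite scale1r.
Qed.

End stereographic_chart.

(* The stereographic chart misses a single point of the sphere, which does not
   contribute to the [n]-dimensional volume since [n >= 1]. *)
Definition sphere_volume (R : realType) (n : nat) (r : R) : R :=
  fine (param_volume (@stereographic R n r)).

(* Main.v *)
From HB Require Import structures.
Require Import Defs.
From mathcomp Require Import all_boot all_order all_algebra.
From mathcomp Require Import ring lra.
From mathcomp Require Import all_classical all_reals all_analysis measurable_realfun.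

(** Write [n = m + 1]. For both metrics the distance depends on the angle [t]
    between two points only: it is [r * delta t], with [delta t = 2 sin (t / 2)]
    for the chord and [delta t = t] for the arc. The kernel
    [x |-> exp (- d x y)] thus has the same integral for every [y] against a
    rotation-invariant measure, so that a multiple of such a measure is a
    weight measure. Every weight measure has the same mass: integrating the
    kernel against two of them in both orders gives both masses. Hence the
    magnitude is [S / L r] with
<<
      S = int_0^pi (sin t)^m dt,    L r = int_0^pi exp (- r delta t) (sin t)^m dt.
>>
    On the other hand the volume of the sphere is [n w r^n S], where [w] is the
    volume of the unit [n]-ball. The magnitude divided by the leading term
    [vol / (n! w)] is therefore [m! / (r^n L r)], and the theorem amounts to an
    expansion of [L r]. If [delta t = t - k t^3 + O(t^5)] the integrand is
<<
      exp (- r t) (t^m - m/6 t^(m+2) + k r t^(m+3))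
>>
    up to terms in which every factor [t] beyond the leading ones is worth one
    power of [1/r] after integration, and the gamma integrals
    [int_0^oo t^j exp (- r t) dt = j! / r^(j+1)] give
<<
      r^n L r / m! = 1 - (m+1) (m+2) (m/6 - k (m+3)) r^-2 + O(r^-4).
>>
    The chord has [k = 1/24] and the arc has [k = 0]; inverting yields the two
    coefficients.

    The rotation-invariant measure is the image under radial projection of
    Lebesgue measure on the unit ball of [R^(n+1)]. Invariance is needed for
    functions of [<y, t>] and [|t|] only ([integral_tdot_rotation]); it is
    proved by induction on the dimension, from the case of the plane where a
    rotation is a product of one-variable affine substitutions. Such integrals
    are then reduced to one variable by polar coordinates ([integral_zonal]),
    the constant in front of [S] and [L r] being the same. All changes of
    variables are obtained by comparing measures of intervals
    ([integral_pushforward_density]). The volume of the sphere is computed in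
    the stereographic chart, which is conformal ([gram_stereographic]).

    That the intrinsic distance is the arc length of a great circle
    ([intrinsic_distE]) follows from the triangle inequality for angles, along
    subdivisions so fine that chords are almost as long as their arcs. *)

Set Implicit Arguments.
Unset Strict Implicit.
Unset Printing Implicit Defensive.

Import Order.TTheory GRing.Theory Num.Theory.
Import numFieldNormedType.Exports.

Local Open Scope classical_set_scope.
Local Open Scope ring_scope.

(** * Densities and images of measures *)

Section density.
Context d (T : measurableType d) (R : realType).
Variables (mu : {measure set T -> \bar R}) (h : T -> R).
Hypotheses (mh : measurable_fun setT h) (h0 : forall x, 0 <= h x).
Local Open Scope ereal_scope.

(** The hypotheses on [h] are arguments, so that the measure structure can be
    inferred from the term alone. *)
Definition with_density of measurable_fun setT h & (forall x, (0 <= h x)%R) :=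
  fun A : set T => \int[mu]_(x in A) (h x)%:E.

Local Notation nu := (with_density mh h0).

Let nu0 : nu set0 = 0.
Proof. by rewrite /with_density integral_set0. Qed.

Let nu_ge0 A : 0 <= nu A.
Proof. by apply: integral_ge0 => x _; rewrite lee_fin. Qed.

Let nu_sigma : semi_sigma_additive nu.
Proof.
apply: semi_sigma_additive_nng_induced; first exact/measurable_EFinP.
by move=> x; rewrite lee_fin.
Qed.

HB.instance Definition _ := isMeasure.Build _ _ _ nu nu0 nu_ge0 nu_sigma.

Import HBNNSimple.

(** By monotone convergence it suffices to consider simple functions, hence
    indicators, for which this is the definition of the density. *)
Lemma integral_with_density (f : T -> \bar R) :
  measurable_fun setT f -> (forall x, 0 <= f x) ->
  \int[nu]_x f x = \int[mu]_x (f x * (h x)%:E).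
Proof.
move=> mf f0; pose k := nnsfun_approx measurableT mf.
have mE : measurable_fun setT (fun x => (h x)%:E) by exact/measurable_EFinP.
have -> : \int[nu]_x f x =
    lim (\int[nu]_x (EFin \o k n) x @[n --> \oo]).
  have fE x : f x = lim ((EFin \o k n) x @[n --> \oo]).
    by apply/esym/cvg_lim => //; exact: cvg_nnsfun_approx.
  under eq_integral do rewrite fE.
  apply: monotone_convergence => //.
  - by move=> n; exact/measurable_EFinP.
  - by move=> n x _ //=; rewrite lee_fin.
  - by move=> x _ a b ab; rewrite lee_fin; exact/lefP/nd_nnsfun_approx.
have -> : \int[mu]_x (f x * (h x)%:E) =
    lim (\int[mu]_x ((k n x)%:E * (h x)%:E) @[n --> \oo]).
  have fE x : f x * (h x)%:E = lim (((k n x)%:E * (h x)%:E) @[n --> \oo]).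
    by apply/esym/cvg_lim => //; apply: cvgeZr => //; exact: cvg_nnsfun_approx.
  under eq_integral do rewrite fE.
  apply: monotone_convergence => //.
  - by move=> n; apply/emeasurable_funM => //; exact/measurable_EFinP.
  - by move=> n x _ /=; rewrite mule_ge0 ?lee_fin.
  - by move=> x _ a b ab/=; rewrite lee_wpmul2r ?lee_fin//; exact/lefP/nd_nnsfun_approx.
suff suf n : \int[nu]_x (EFin \o k n) x =
    \int[mu]_x ((k n x)%:E * (h x)%:E).
  by under eq_fun do rewrite suf.
transitivity (\int[nu]_x
   (\sum_(y \in range (k n)) (y * \1_(k n @^-1` [set y]) x)%:E)).
  by apply: eq_integral => t tE; rewrite /= fimfunE -fsumEFin.
have indich m r : measurable_fun setT (fun x => (r * \1_(k m @^-1` [set r]) x)%:E).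
  by apply/measurable_EFinP; exact: measurable_funM.
rewrite ge0_integral_fsum//; last by move=> m y Ey; exact: nnfun_muleindic_ge0.
transitivity (\int[mu]_x (\sum_(y \in range (k n))
    (y * \1_(k n @^-1` [set y]) x)%:E * (h x)%:E)); last first.
  apply: eq_integral => x _.
  rewrite -ge0_mule_fsuml => [|y]; last exact: nnfun_muleindic_ge0.
  by rewrite fsumEFin // -(fimfunE _ x).
rewrite ge0_integral_fsum//; last 2 first.
  - by move=> y; exact: emeasurable_funM.
  - by move=> m y Ey; rewrite mule_ge0 ?lee_fin// -lee_fin nnfun_muleindic_ge0.
apply: eq_fsbigr => r rhn.
have r0 : (0 <= r)%R by move: rhn; rewrite inE => -[t _ <-].
under eq_integral do rewrite EFinM.
rewrite integralZl_indic_nnsfun => //.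
under [RHS]eq_integral do rewrite EFinM -muleA.
rewrite ge0_integralZl//.
- rewrite integral_indic// setIT; congr (_ * _).
  rewrite /= /with_density integral_mkcond; apply: eq_integral => x xE.
  by rewrite epatch_indic muleC.
- by apply: emeasurable_funM => //; exact/measurable_EFinP.
- by move=> t Et; rewrite mule_ge0 ?lee_fin.
Qed.

End density.

Lemma bigcup_ocitv_setT (R : realType) :
  \bigcup_k `]- k%:R : R, k%:R]%classic = setT.
Proof.
rewrite -subTset => /= x _ /=.
exists (Num.bound `|x|) => //=; have := archi_boundP (normr_ge0 x).
by rewrite in_itv/= ltr_norml => /andP[-> /ltW].
Qed.

(** Measures on the line that are finite and equal on all half-open intervals
    coincide. A change of variables therefore only requires to know the measure
    of the preimage of an interval, not a Jacobian. *)
Lemma integral_pushforward_density d (X : measurableType d) (R : realType)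
    (m : {measure set X -> \bar R}) (D : set X) (phi : X -> measurableTypeR R)
    (h : R -> R) (f : R -> \bar R) :
  measurable D -> measurable_fun setT phi ->
  measurable_fun setT h -> (forall x, 0 <= h x) ->
  (forall a b, a < b -> exists2 c : R, m (D `&` phi @^-1` `]a, b]) = c%:E &
     (\int[@lebesgue_measure R]_(x in `]a, b]) (h x)%:E)%E = c%:E) ->
  measurable_fun setT f -> (forall x, (0 <= f x)%E) ->
  (\int[m]_(x in D) f (phi x) =
   \int[@lebesgue_measure R]_x (f x * (h x)%:E))%E.
Proof.
move=> mD mphi mh h0 mE mf f0.
transitivity (\int[with_density (@lebesgue_measure R) mh h0]_x f x)%E; last first.
  exact: integral_with_density.
have mfphi : measurable_fun setT (fun x => f (phi x)) by exact: measurableT_comp.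
have -> : (\int[m]_(x in D) f (phi x) = \int[mrestr m mD]_x f (phi x))%E.
  rewrite [RHS](@ge0_negligible_integral _ _ _ (mrestr m mD) setT (~` D))//=.
    rewrite setTD setCK; apply: eq_measure_integral => A mA AD.
    by rewrite /= /mrestr setIidl.
  - exact: measurableC.
  - by rewrite /= /mrestr setICl measure0.
transitivity (\int[pushforward (mrestr m mD) phi]_y f y)%E.
  by rewrite ge0_integral_pushforward.
apply: eq_measure_integral => A mA _.
apply: (@measure_unique _ R (measurableTypeR R) (@ocitv R)
    (fun k => `]- k%:R : R, k%:R]%classic) erefl _ _ _
    (pushforward (mrestr m mD) phi) (with_density (@lebesgue_measure R) mh h0)) => //.
- exact: ocitvI.
- by move=> i; exact: is_ocitv.
- exact: bigcup_ocitv_setT.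
- move=> _ [[a b] _ <-] /=.
  rewrite /= /pushforward /mrestr setIC /with_density.
  have [ab|ba] := ltP a b; first by have [c -> ->] := mE _ _ ab.
  by rewrite set_itv_ge ?bnd_simp ?ba -?leNgt// preimage_set0 setI0 measure0 integral_set0.
- move=> k; rewrite /= /pushforward /mrestr setIC.
  have [->|k0] := eqVneq k 0%N.
    by rewrite set_itv_ge ?preimage_set0 ?setI0 ?measure0// bnd_simp oppr0 ltxx.
  have [|c -> _] := mE (- k%:R) k%:R; last exact: ltry.
  by rewrite gtrN// ltr0n lt0n.
Qed.

(** * Substitutions on the real line *)

Lemma ge0_integralMl d (T : measurableType d) (R : realType)
    (m : {measure set T -> \bar R}) (D : set T) (k : R) (f : T -> R) :
  measurable D -> measurable_fun D f -> (forall x, D x -> 0 <= f x) -> 0 <= k ->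
  (\int[m]_(x in D) (k * f x)%R%:E = k%:E * \int[m]_(x in D) (f x)%:E)%E.
Proof.
move=> mD mf f0 k0; under eq_integral do rewrite EFinM.
by rewrite ge0_integralZl_EFin//; exact/measurable_EFinP.
Qed.

Section calculus.
Context {R : realType}.
Implicit Types (a b : R) (f F : R -> R).
Local Notation mu := (@lebesgue_measure R).

Lemma integral_is_derive f F a b : a <= b -> continuous f ->
  (forall x : R, is_derive x (1 : R) F (f x)) ->
  (\int[mu]_(x in `]a, b]) (f x)%:E = (F b - F a)%:E)%E.
Proof.
move=> ab cf dF.
have cF : continuous F.
  move=> x; apply/differentiable_continuous/derivable1_diffP.
  exact: (@ex_derive _ _ _ _ _ _ _ (dF x)).
rewrite integral_itv_obnd_cbnd; last first.
  apply/measurable_EFinP/measurable_funTS; exact: continuous_measurable_fun.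
move: ab; rewrite le_eqVlt => /predU1P[<-|ab].
  by rewrite set_itv1 integral_set1 subrr.
rewrite (@continuous_FTC2 _ _ F)// ?EFinB//.
- exact/continuous_subspaceT.
- split.
  + by move=> x _; exact: (@ex_derive _ _ _ _ _ _ _ (dF x)).
  + exact/cvg_at_right_filter/cF.
  + exact/cvg_at_left_filter/cF.
- by move=> x _; rewrite derive1E; exact: derive_val.
Qed.

Lemma is_derive_exprn n (x : R) :
  is_derive x (1 : R) (fun y => y ^+ n) (n%:R * x ^+ n.-1).
Proof.
rewrite (_ : (fun y : R => y ^+ n) = id ^+ n); last first.
  by apply/funext => y; rewrite exprfctE.
by apply: (is_derive_eq (is_deriveX n (is_derive_id x (1 : R)))); exact: mulr1.
Qed.

Lemma measurable_inv : measurable_fun [set: R] (@GRing.inv R).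
Proof.
have oU : open [set x : R | x != 0] by [].
rewrite (_ : setT = [set 0] `|` [set x : R | x != 0]); last first.
  by apply/esym/seteqP; split=> // x _ /=; have [->|x0] := eqVneq x 0; [left|right].
apply/measurable_funU => //; first exact: open_measurable.
split; first exact: measurable_fun_set1.
by apply: open_continuous_measurable_fun => //; apply/in_setP => x /= x0; exact: inv_continuous.
Qed.

Lemma measurable_sqrt : measurable_fun [set: R] (@Num.sqrt R).
Proof. by apply: continuous_measurable_fun; exact: sqrt_continuous. Qed.

Lemma measurable_tan : measurable_fun [set: R] (@tan R).
Proof.
apply: measurable_funM.
  by apply: continuous_measurable_fun; exact: continuous_sin.
apply: measurableT_comp; first exact: measurable_inv.
by apply: continuous_measurable_fun; exact: continuous_cos.
Qed.

End calculus.
Arguments measurable_inv {R}.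
Arguments measurable_sqrt {R}.
Arguments measurable_tan {R}.

Section substitution.
Context {R : realType}.
Implicit Types (a b : R) (f : R -> \bar R).
Local Notation mu := (@lebesgue_measure R).

Lemma ge0_integral_affine f a b : a != 0 -> measurable_fun setT f ->
  (forall x, (0 <= f x)%E) ->
  (\int[mu]_x f (a * x + b)%R = (`|a|^-1)%:E * \int[mu]_x f x)%E.
Proof.
move=> a0 mf f0.
have mphi : measurable_fun [set: R] (fun x : R => a * x + b).
  by apply: measurable_funD => //; exact: measurable_funM.
rewrite (@integral_pushforward_density _ _ _ mu setT (fun x => a * x + b)
  (cst `|a|^-1))//.
- under eq_integral do rewrite /cst muleC.
  by rewrite ge0_integralZl// lee_fin invr_ge0.
- by move=> x; rewrite invr_ge0.
move=> u v uv; rewrite setTI.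
exists (`|a|^-1 * (v - u)); last first.
  rewrite -[LHS]/(\int[mu]_(x in `]u, v]) cst (`|a|^-1)%:E x)%E.
  by rewrite integral_cst//= lebesgue_measure_itv /= lte_fin uv.
case: (ltgtP a 0) a0 => // a0 _.
- rewrite (_ : _ @^-1` _ = `[(v - b) / a, (u - b) / a[%classic).
    rewrite [LHS]lebesgue_measure_itv /= lte_fin ltr_ndivrMr// mulfVK ?lt_eqF//.
    rewrite ltrD2r uv -EFinB; congr EFin.
    by rewrite ltr0_norm// invrN; field; rewrite lt_eqF.
  apply/seteqP; split=> x /=; rewrite !in_itv/= ler_ndivrMr// ltr_ndivlMr//;
    by rewrite mulrC lerBrDr ltrBlDr andbC.
- rewrite (_ : _ @^-1` _ = `](u - b) / a, (v - b) / a]%classic).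
    rewrite [LHS]lebesgue_measure_itv /= lte_fin ltr_pdivlMr// mulfVK ?gt_eqF//.
    rewrite ltrD2r uv -EFinB; congr EFin.
    by rewrite gtr0_norm//; field; rewrite gt_eqF.
  apply/seteqP; split=> x /=; rewrite !in_itv/= ltr_pdivrMr// ler_pdivlMr//;
    by rewrite mulrC lerBrDr ltrBlDr.
Qed.

Lemma ge0_integral_tan f : measurable_fun setT f -> (forall x, (0 <= f x)%E) ->
  (\int[mu]_(x in `](- (pi / 2))%R, (pi / 2)%R[) f (tan x) =
   \int[mu]_x (f x * ((1 + x ^+ 2)^-1)%R%:E))%E.
Proof.
move=> mf f0.
have h0 x : 0 <= (1 + x ^+ 2 : R)^-1 by rewrite invr_ge0 addr_ge0 ?sqr_ge0.
have ch : continuous (fun x : R => (1 + x ^+ 2)^-1) by exact: continuous_oneDsqrV.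
rewrite (@integral_pushforward_density _ _ _ mu `]- (pi / 2), pi / 2[%classic
  tan (fun x => (1 + x ^+ 2)^-1))//.
- exact: measurable_tan.
- exact: continuous_measurable_fun.
move=> u v uv.
exists (atan v - atan u); last first.
  by apply: integral_is_derive => //; exact: ltW.
rewrite (_ : _ `&` _ = `]atan u, atan v]%classic).
  by rewrite [LHS]lebesgue_measure_itv /= lte_fin (lt_atan uv) -EFinB.
apply/seteqP; split => x /=; rewrite !in_itv/=.
- move=> [xpi /andP[ux xv]]; rewrite -(@tanK _ x) ?in_itv//.
  by rewrite lt_atan//= le_atan.
- move=> /andP[ux xv].
  have xpi : - (pi / 2) < x < pi / 2.
    by rewrite (lt_trans (atan_gtNpi2 u) ux) (le_lt_trans xv)// atan_ltpi2.
  split=> //; rewrite -(atanK u) -(atanK v) ltr_tan ?in_itv//= ?atan_gtNpi2 ?atan_ltpi2//.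
  rewrite ux /= leNgt ltr_tan ?in_itv//= ?atan_gtNpi2 ?atan_ltpi2//.
  by rewrite -leNgt.
Qed.

End substitution.

(** * Rotation invariance of Lebesgue measure *)

Section planar_rotation.
Context {R : realType}.
Implicit Types (a b : R) (K : R -> R -> \bar R).
Local Notation mu := (@lebesgue_measure R).
Local Notation RR := (measurableTypeR R).

Lemma measurable_fun2 K d (T : measurableType d) (f g : T -> R) :
  measurable_fun setT (fun p : RR * RR => K p.1 p.2) ->
  measurable_fun setT f -> measurable_fun setT g ->
  measurable_fun setT (fun x => K (f x) (g x)).
Proof.
move=> mK mf mg.
exact: (measurableT_comp mK (measurable_fun_pair mf mg)).
Qed.

(** A rotation of the plane is a product of two shears composed with dilations:
    [x] is first replaced with [c x + s u] at fixed [u], then [u] is rescaled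
    and translated at fixed [x]. Tonelli exchanges the variables in between. *)
Lemma ge0_integral_rotation K a b : 0 <= b ->
  measurable_fun setT (fun p : RR * RR => K p.1 p.2) ->
  (forall x y, (0 <= K x y)%E) ->
  (\int[mu]_x \int[mu]_u K (a * x + b * u)%R (x ^+ 2 + u ^+ 2)%R =
   \int[mu]_x \int[mu]_u
     K (Num.sqrt (a ^+ 2 + b ^+ 2) * x)%R (x ^+ 2 + u ^+ 2)%R)%E.
Proof.
move=> b0 mK K0.
have mR1 : measurable_fun setT (fst : RR * RR -> R) by exact: measurable_fst.
have mR2 : measurable_fun setT (snd : RR * RR -> R) by exact: measurable_snd.
have mlin (k l : R) : measurable_fun setT (fun p : RR * RR => k * p.1 + l * p.2).
  by apply: measurable_funD; apply: measurable_funM.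
have msq : measurable_fun setT (fun p : RR * RR => p.1 ^+ 2 + p.2 ^+ 2).
  by apply: measurable_funD; apply: measurable_funX.
have [->|a0] := eqVneq a 0.
  rewrite (@fubini_tonelli _ _ _ _ _ mu mu
    (fun p => K (0 * p.1 + b * p.2) (p.1 ^+ 2 + p.2 ^+ 2))); last 2 first.
  - exact: measurable_fun2.
  - by move=> p; exact: K0.
  apply: eq_integral => x _; apply: eq_integral => u _ /=.
  by rewrite mul0r add0r expr0n add0r sqrtr_sqr ger0_norm// addrC.
set r := Num.sqrt _.
have r2 : r ^+ 2 = a ^+ 2 + b ^+ 2 by rewrite sqr_sqrtr// addr_ge0 ?sqr_ge0.
have r0 : r != 0.
  have : r ^+ 2 != 0 by rewrite r2 gt_eqF// ltr_wpDr ?sqr_ge0// exprn_even_gt0.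
  by apply: contra_neq => ->; rewrite expr0n.
(* [(c, s)] is the unit direction of [(a, b)], and [Q] is the integrand in terms
   of [c x + s u] and [u]. *)
pose c := a / r; pose s := b / r.
have c0 : c != 0 by rewrite mulf_neq0// invr_eq0.
have cs : c ^+ 2 + s ^+ 2 = 1.
  by rewrite /c /s !expr_div_n -mulrDl -r2 divff// expf_neq0.
pose Q x u := K (r * x) (((x - s * u) / c) ^+ 2 + u ^+ 2).
have mQ : measurable_fun setT (fun p : RR * RR => Q p.1 p.2).
  apply: (@measurable_fun2 K _ _ (fun p => r * p.1)
    (fun p => ((p.1 - s * p.2) / c) ^+ 2 + p.2 ^+ 2)) => //.
    exact: measurable_funM.
  apply: measurable_funD; last exact: measurable_funX.
  apply: measurable_funX; apply: measurable_funM => //.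
  by apply: measurable_funB => //; exact: measurable_funM.
transitivity (\int[mu]_u \int[mu]_x (fun x => Q x u) (c * x + s * u)%R)%E.
  rewrite (@fubini_tonelli _ _ _ _ _ mu mu
    (fun p => K (a * p.1 + b * p.2) (p.1 ^+ 2 + p.2 ^+ 2))); last 2 first.
  - exact: measurable_fun2.
  - by move=> p; exact: K0.
  apply: eq_integral => u _; apply: eq_integral => x _ /=; rewrite /Q.
  congr (K _ (_ + _)); first by rewrite /c /s; field.
  by congr (_ ^+ 2); field.
transitivity (\int[mu]_u \int[mu]_x ((`|c|^-1)%:E * Q x u))%E.
  apply: eq_integral => u _.
  have mQu : measurable_fun [set: R] (fun x => Q x u).
    exact: (@measurable_fun2 Q _ _ id (cst u)).
  rewrite (@ge0_integral_affine _ (fun x => Q x u))//; last by move=> x; exact: K0.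
  by rewrite ge0_integralZl// => x _; exact: K0.
rewrite -(@fubini_tonelli _ _ _ _ _ mu mu (fun p => (`|c|^-1)%:E * Q p.1 p.2)%E)/=.
- apply: eq_integral => x _.
  have mQx : measurable_fun [set: R] (fun u => Q x u).
    exact: (@measurable_fun2 Q _ _ (cst x) id).
  rewrite ge0_integralZl//; last by move=> u _; exact: K0.
  pose k v := K (r * x) (x ^+ 2 + v ^+ 2).
  have mk : measurable_fun [set: R] k.
    apply: (@measurable_fun2 K _ RR (cst (r * x)) (fun v => x ^+ 2 + v ^+ 2)) => //.
    by apply: measurable_funD => //; exact: measurable_funX.
  have -> : (\int[mu]_u Q x u = \int[mu]_u k (c^-1 * u + - (s / c * x))%R)%E.
    apply: eq_integral => u _; rewrite /Q /k; congr (K _ _).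
    have -> : ((x - s * u) / c) ^+ 2 + u ^+ 2 =
        (x ^+ 2 - s * u * x *+ 2 + (c ^+ 2 + s ^+ 2) * u ^+ 2) / c ^+ 2 by field.
    have -> : x ^+ 2 + (c^-1 * u + - (s / c * x)) ^+ 2 =
        ((c ^+ 2 + s ^+ 2) * x ^+ 2 - s * u * x *+ 2 + u ^+ 2) / c ^+ 2 by field.
    by rewrite cs !mul1r.
  rewrite ge0_integral_affine ?invr_eq0//; last by move=> u; exact: K0.
  by rewrite muleA -EFinM normrV ?unitfE// invrK mulVf ?normr_eq0// mul1e.
- apply: emeasurable_funM => //; exact: measurable_cst.
- by move=> p; apply: mule_ge0; [rewrite lee_fin invr_ge0|exact: K0].
Qed.

End planar_rotation.

Section tuple_integral.
Context {R : realType}.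
Local Notation mu := (@lebesgue_measure R).
Local Notation RR := (measurableTypeR R).
Local Notation leb n := (lebesgue_tuple R n).

Lemma integral_lebesgue_tuple0 (f : Rtuple 0 R -> \bar R) :
  (\int[leb 0]_t f t = f [tuple])%E.
Proof.
rewrite (eq_integral (cst (f [tuple]))); last by move=> t _; rewrite [t]tuple0.
by rewrite integral_cst//= diracT mule1.
Qed.

Lemma ge0_integral_lebesgue_tuple n (f : Rtuple n.+1 R -> \bar R) :
  measurable_fun setT f -> (forall t, (0 <= f t)%E) ->
  (\int[leb n.+1]_t f t = \int[mu]_x \int[leb n]_t f (tuple_of_pair (x, t)))%E.
Proof.
move=> mf f0.
rewrite -(@fubini_tonelli1 _ _ _ _ _ mu (leb n) (f \o @tuple_of_pair R n))//.
- transitivity (\int[pushforward (mu \x leb n) (@tuple_of_pair R n)]_t f t)%E => //.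
  by rewrite ge0_integral_pushforward//; exact: measurable_tuple_of_pair.
- by apply: measurableT_comp => //; exact: measurable_tuple_of_pair.
- by move=> p; exact: f0.
Qed.

Definition tdot n (s t : Rtuple n R) : R := \sum_(i < n) tnth s i * tnth t i.

Lemma tdot_cons n x y (s t : Rtuple n R) :
  tdot (tuple_of_pair (x, s)) (tuple_of_pair (y, t)) = x * y + tdot s t.
Proof.
rewrite /tdot big_ord_recl /= !tnth0; congr (_ + _).
by apply: eq_bigr => i _; rewrite !tnthS.
Qed.

Lemma tdot_ge0 n (t : Rtuple n R) : 0 <= tdot t t.
Proof. by apply: sumr_ge0 => i _; rewrite -expr2 sqr_ge0. Qed.

Lemma sqnorm_row_of_tuple n (t : Rtuple n R) : sqnorm (row_of_tuple t) = tdot t t.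
Proof. by apply: eq_bigr => i _; rewrite mxE expr2. Qed.

Lemma measurable_tdotr n (s : Rtuple n R) : measurable_fun setT (tdot s).
Proof.
apply: measurable_sum => i; apply: measurable_funM => //.
exact: measurable_tnth.
Qed.

Lemma measurable_tdot n : measurable_fun setT (fun t : Rtuple n R => tdot t t).
Proof.
by apply: measurable_sum => i; apply: measurable_funM; exact: measurable_tnth.
Qed.

Lemma measurable_thead n : measurable_fun setT (fun t : Rtuple n.+1 R => thead t).
Proof. exact: measurable_tnth. Qed.

(** Induction on the dimension: the induction hypothesis turns the last
    coordinates of [y] onto an axis, and what remains is a rotation in the plane
    of the first two coordinates. Functions of [<y, t>] and [|t|^2] are stable
    under this reduction. *)
Lemma integral_tdot_rotation n (y : Rtuple n.+1 R) (H : R -> R -> \bar R) :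
  measurable_fun setT (fun p : RR * RR => H p.1 p.2) ->
  (forall a b, (0 <= H a b)%E) ->
  (\int[leb n.+1]_t H (tdot y t) (tdot t t) =
   \int[leb n.+1]_t H (Num.sqrt (tdot y y) * thead t)%R (tdot t t))%E.
Proof.
have tdotE m (z : Rtuple m.+1 R) x t :
    tdot z (tuple_of_pair (x, t)) = thead z * x + tdot (pair_of_tuple z).2 t.
  by rewrite -{1}(pair_of_tupleK z) tdot_cons.
have tdot2 m (z : Rtuple m.+1 R) :
    tdot z z = thead z ^+ 2 + tdot (pair_of_tuple z).2 (pair_of_tuple z).2.
  by rewrite -{1 2}(pair_of_tupleK z) tdot_cons expr2.
have mL m (z : Rtuple m R) (K : R -> R -> \bar R) :
    measurable_fun setT (fun p : RR * RR => K p.1 p.2) ->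
    measurable_fun setT (fun t => K (tdot z t) (tdot t t)).
  by move=> mK; apply: measurable_fun2 => //; [exact: measurable_tdotr|exact: measurable_tdot].
have mRH m c (K : R -> R -> \bar R) :
    measurable_fun setT (fun p : RR * RR => K p.1 p.2) ->
    measurable_fun setT (fun t : Rtuple m.+1 R => K (c * thead t) (tdot t t)).
  move=> mK; apply: measurable_fun2 => //; last exact: measurable_tdot.
  by apply: measurable_funM => //; exact: measurable_thead.
elim: n y H => [|n IH] y H mH H0.
  have tdot0 (s t : Rtuple 0 R) : tdot s t = 0 by rewrite /tdot big_ord0.
  rewrite !ge0_integral_lebesgue_tuple; [|exact: mRH|by move=> t; exact: H0|exact: mL|by move=> t; exact: H0].
  transitivity (\int[mu]_x H (thead y * x)%R (x ^+ 2)%R)%E.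
    apply: eq_integral => x _; rewrite integral_lebesgue_tuple0.
    by rewrite tdotE tdot2 !tdot0 !addr0 theadE.
  transitivity (\int[mu]_x H (`|thead y| * x)%R (x ^+ 2)%R)%E; last first.
    apply: eq_integral => x _; rewrite integral_lebesgue_tuple0.
    by rewrite !tdot2 !tdot0 !addr0 theadE sqrtr_sqr.
  have [y0|y0] := leP 0 (thead y); first by rewrite ger0_norm.
  have mG : measurable_fun [set: R] (fun x : R => H (thead y * x) (x ^+ 2)).
    apply: (@measurable_fun2 R H _ RR (fun x => thead y * x) (fun x => x ^+ 2)) => //.
    exact: measurable_funM.
  have N1 : -1 != 0 :> R by rewrite oppr_eq0 oner_eq0.
  have /= := ge0_integral_affine 0 N1 mG (fun x => H0 _ _).
  rewrite normrN1 invr1 mul1e => <-.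
  by apply: eq_integral => x _; rewrite addr0 mulN1r sqrrN mulrN ltr0_norm// mulNr.
pose z := (pair_of_tuple y).2.
pose s := Num.sqrt (tdot z z).
(* the integral over all coordinates but the first two *)
pose K p q := (\int[leb n]_w H p (q + tdot w w)%R)%E.
have K0 p q : (0 <= K p q)%E by apply: integral_ge0 => w _; exact: H0.
have mK : measurable_fun setT (fun p : RR * RR => K p.1 p.2).
  apply: (@measurable_fun_fubini_tonelli_F _ _ _ _ _ (leb n)
    (fun p : (RR * RR) * Rtuple n R => H p.1.1 (p.1.2 + tdot p.2 p.2)%R)) => //.
  apply: (@measurable_fun2 R H _ _ (fun p : (RR * RR) * Rtuple n R => p.1.1)
    (fun p => p.1.2 + tdot p.2 p.2)) => //.
    exact: (measurableT_comp measurable_fst measurable_fst).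
  apply: measurable_funD; first exact: (measurableT_comp measurable_snd measurable_fst).
  exact: (measurableT_comp (@measurable_tdot n) measurable_snd).
transitivity (\int[mu]_x \int[mu]_u K (thead y * x + s * u)%R (x ^+ 2 + u ^+ 2)%R)%E.
  rewrite ge0_integral_lebesgue_tuple//; last exact: mL.
  apply: eq_integral => x _.
  pose H' a b := H (thead y * x + a) (x ^+ 2 + b).
  have mH' : measurable_fun setT (fun p : RR * RR => H' p.1 p.2).
    apply: (@measurable_fun2 R H _ _ (fun p : RR * RR => thead y * x + p.1)
      (fun p => x ^+ 2 + p.2)) => //; exact: measurable_funD.
  have H'0 a b : (0 <= H' a b)%E by exact: H0.
  transitivity (\int[leb n.+1]_t H' (tdot z t) (tdot t t))%E.
    by apply: eq_integral => t _; rewrite tdotE tdot2 theadE -/z; congr (H _ (_ + tdot _ _)); exact: val_inj.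
  rewrite (IH z H')//.
  rewrite ge0_integral_lebesgue_tuple; last 2 first.
  - exact: (mRH _ (Num.sqrt (tdot z z)) H' mH').
  - by move=> t; exact: H'0.
  apply: eq_integral => u _; apply: eq_integral => w _.
  by rewrite /H' tdot_cons theadE addrA expr2.
rewrite ge0_integral_rotation ?sqrtr_ge0//.
rewrite ge0_integral_lebesgue_tuple//; last exact: mRH.
apply: eq_integral => x _.
rewrite ge0_integral_lebesgue_tuple; last 2 first.
- have mx : measurable_fun setT (fun t : Rtuple n.+1 R => tuple_of_pair (x, t)).
    apply: measurableT_comp; first exact: measurable_tuple_of_pair.
    exact: (measurable_fun_pair (measurable_cst _) (@measurable_id _ _ _)).
  exact: (measurableT_comp (mRH _ (Num.sqrt (tdot y y)) H mH) mx).
- by move=> t; exact: H0.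
apply: eq_integral => u _; apply: eq_integral => w _.
rewrite [in RHS]tdot2 /= !tdot_cons theadE addrA -!expr2 sqr_sqrtr ?tdot_ge0//.
Qed.

End tuple_integral.

(** * Volumes of balls and integrals of radial functions *)

Section radial.
Context {R : realType}.
Local Notation mu := (@lebesgue_measure R).
Local Notation RR := (measurableTypeR R).
Local Notation leb n := (lebesgue_tuple R n).

(** The coordinates are rescaled one after the other. *)
Lemma ge0_integral_scale_sq n (c : R) (H : R -> \bar R) : 0 < c ->
  measurable_fun setT H -> (forall x, (0 <= H x)%E) ->
  (\int[leb n]_t H (c ^+ 2 * tdot t t)%R =
   (c ^- n)%:E * \int[leb n]_t H (tdot t t))%E.
Proof.
move=> c0; have cn0 k : (0 <= (c ^- k)%:E)%E by rewrite lee_fin invr_ge0 exprn_ge0 ?ltW.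
elim: n H => [|n IH] H mH H0.
  by rewrite !integral_lebesgue_tuple0 /tdot !big_ord0 mulr0 expr0 invr1 mul1e.
have mtd m k : measurable_fun setT (fun t : Rtuple m R => k * tdot t t).
  by apply: measurable_funM => //; exact: measurable_tdot.
rewrite !ge0_integral_lebesgue_tuple//; last 2 first.
- by apply: measurableT_comp => //; exact: measurable_tdot.
- by apply: (measurableT_comp mH (mtd _ _)).
pose G x := (\int[leb n]_t H (x ^+ 2 + tdot t t)%R)%E.
have G0 x : (0 <= G x)%E by exact: integral_ge0.
have mG : measurable_fun [set: R] G.
  apply: (@measurable_fun_fubini_tonelli_F _ _ _ _ _ (leb n)
    (fun p : RR * Rtuple n R => H (p.1 ^+ 2 + tdot p.2 p.2)%R)) => //.
  apply: measurableT_comp => //; apply: measurable_funD.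
    exact: measurable_funX.
  exact: (measurableT_comp (@measurable_tdot R n) measurable_snd).
transitivity (\int[mu]_x ((c ^- n)%:E * G (c * x + 0)%R))%E.
  apply: eq_integral => x _.
  rewrite /G addr0 -(IH (fun y => H ((c * x) ^+ 2 + y)))//.
    by apply: eq_integral => t _; rewrite tdot_cons exprMn -expr2 mulrDr.
  by apply: measurableT_comp => //; exact: measurable_funD.
have mGc : measurable_fun [set: R] (fun x : R => G (c * x + 0)).
  apply: (measurableT_comp mG).
  by apply: measurable_funD => //; exact: measurable_funM.
rewrite (ge0_integralZl mu measurableT mGc (fun x _ => G0 _) (cn0 n)).
rewrite (ge0_integral_affine 0 (lt0r_neq0 c0) mG G0) muleA -EFinM gtr0_norm// exprSr invfM.
by congr (_ * _)%E; apply: eq_integral => x _; rewrite /G; apply: eq_integral => t _; rewrite tdot_cons expr2.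
Qed.

Definition tball n (s : R) : set (Rtuple n R) := [set t | tdot t t <= s].

Lemma measurable_tball n s : measurable (@tball n s).
Proof.
rewrite /tball (_ : [set t | _] = setT `&` (fun t : Rtuple n R => tdot t t) @^-1` `]-oo, s]).
  by apply: measurable_tdot.
by rewrite setTI; apply/seteqP; split => t /=; rewrite in_itv.
Qed.

Lemma tballE n s : (leb n (@tball n s) =
   \int[leb n]_t (\1_(`]-oo, s]%classic : set R) (tdot t t))%:E)%E.
Proof.
have := integral_indic (leb n) measurableT (@measurable_tball n s).
rewrite setIT => <-; apply: eq_integral => t _; rewrite !indicE; congr ((nat_of_bool _)%:R%:E).
Qed.

Let mind s : measurable_fun setT (fun x : R => (\1_(`]-oo, s]%classic : set R) x)%:E : \bar R).
Proof. by apply/measurable_EFinP; exact: measurable_indic. Qed.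

Lemma tball_scale n (c s : R) : 0 < c ->
  leb n (@tball n (c ^+ 2 * s)) = ((c ^+ n)%:E * leb n (@tball n s))%E.
Proof.
move=> c0; have c2 : 0 < c ^+ 2 by rewrite exprn_gt0.
rewrite !tballE.
have -> : (\int[leb n]_t (\1_(`]-oo, s]%classic : set R) (tdot t t))%:E =
    \int[leb n]_t (\1_(`]-oo, (c ^+ 2 * s)]%classic : set R) (c ^+ 2 * tdot t t)%R)%:E)%E.
  apply: eq_integral => t _; rewrite !indicE; congr ((nat_of_bool _)%:R%:E).
  by apply/idP/idP; rewrite !inE /= !in_itv /= ler_pM2l.
rewrite (@ge0_integral_scale_sq n c (fun x => (\1_(`]-oo, (c ^+ 2 * s)]%classic : set R) x)%:E))//.
by rewrite muleA -EFinM divff ?mul1e// expf_neq0 ?gt_eqF.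
Qed.

(** The ball is contained in the product of a segment and a ball of lower
    dimension. *)
Lemma tball_fin n : (leb n (@tball n 1) < +oo)%E.
Proof.
elim: n => [|n IH].
  by rewrite tballE integral_lebesgue_tuple0 ltry.
have mB : measurable `[(-1)%R : R, 1] by [].
rewrite tballE ge0_integral_lebesgue_tuple//; last exact: (measurableT_comp (mind 1) (@measurable_tdot R n.+1)).
have mf : measurable_fun setT (fun p : RR * Rtuple n R =>
    (\1_(`]-oo, 1]%classic : set R) (tdot (tuple_of_pair p) (tuple_of_pair p)))%:E : \bar R).
  exact: (measurableT_comp (measurableT_comp (mind 1) (@measurable_tdot R n.+1))
    (@measurable_tuple_of_pair R n)).
apply: (@le_lt_trans _ _ (\int[mu]_x ((\1_`[(-1)%R : R, 1] x)%:E * leb n (@tball n 1)))%E).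
  apply: ge0_le_integral => //.
  - by move=> x _; exact: integral_ge0.
  - exact: (@measurable_fun_fubini_tonelli_F _ _ _ _ _ (leb n) _ mf).
  - by apply: emeasurable_funM; [apply/measurable_EFinP; exact: measurable_indic|exact: measurable_cst].
  - move=> x _; rewrite tballE -ge0_integralZl//; last first.
      exact: (measurableT_comp (mind 1) (@measurable_tdot R n)).
    apply: ge0_le_integral => //.
    + exact: (measurableT_comp mf (measurable_fun_pair (measurable_cst x) (@measurable_id _ _ _))).
    + apply: emeasurable_funM; first exact: measurable_cst.
      exact: (measurableT_comp (mind 1) (@measurable_tdot R n)).
    + move=> t _; rewrite -EFinM lee_fin !indicE /= tdot_cons -expr2.
      have t0 := tdot_ge0 t; have x0 := sqr_ge0 x.
      case: (boolP (_ \in _)) => //= [|_]; last by rewrite mulr_ge0.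
      rewrite inE /= in_itv /= => xt1.
      rewrite !mem_set ?mulr1//= in_itv/=.
        by rewrite (le_trans _ xt1)// lerDr.
      rewrite -ler_norml -(@expr_le1 _ 2)// real_normK ?num_real//.
      by rewrite (le_trans _ xt1)// lerDl.
rewrite ge0_integralZr//; last by apply/measurable_EFinP; exact: measurable_indic.
rewrite integral_indic// setIT [X in (X * _)%E]lebesgue_measure_itv /= lte_fin.
rewrite ifT; last by lra.
by rewrite lte_mul_pinfty// ?lee_fin -?EFinB ?ltry// lee_fin; lra.
Qed.

Lemma lebesgue_tupleT_neq0 n : leb n setT != 0%E.
Proof.
elim: n => [|n IH]; first by rewrite /= diracT onee_neq0.
have -> : (leb n.+1 setT = \int[leb n.+1]_t cst 1 t)%E.
  by rewrite integral_cst// mul1e.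
rewrite ge0_integral_lebesgue_tuple//.
under eq_integral do rewrite integral_cst//= mul1e.
have -> : (\int[mu]_x (leb n setT) = leb n setT * mu setT)%E by exact: integral_cst.
have -> : mu setT = +oo%E :> \bar R by rewrite -set_itvNyy [LHS]lebesgue_measure_itv.
by rewrite mule_eq0 negb_or IH.
Qed.

(** Otherwise the whole space, a countable union of dilated balls, would be
    negligible. *)
Lemma tball_neq0 n : leb n (@tball n 1) != 0%E.
Proof.
apply: contra (lebesgue_tupleT_neq0 n) => /eqP b0.
have -> : setT = \bigcup_k @tball n (k.+1%:R ^+ 2 * 1).
  apply/esym/seteqP; split=> // t _.
  exists (Num.bound (tdot t t)) => //=; rewrite /tball /= mulr1.
  have := archi_boundP (tdot_ge0 t) => /ltW /le_trans; apply.
  by rewrite -natrX ler_nat (leq_trans (leqnSn _))// -mulnn leq_pmulr.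
apply/eqP/measure_negligible.
  by apply: bigcup_measurable => k _; exact: measurable_tball.
apply: negligible_bigcup => k.
exists (@tball n (k.+1%:R ^+ 2 * 1)); split => //; first exact: measurable_tball.
by apply: etrans (tball_scale _ _ _) _ => //; rewrite b0 mule0.
Qed.

Definition ball_volume n : R := fine (leb n (@tball n 1)).

Lemma ball_volumeE n : leb n (@tball n 1) = (ball_volume n)%:E.
Proof. by rewrite fineK// ge0_fin_numE// tball_fin. Qed.

Lemma ball_volume_gt0 n : 0 < ball_volume n.
Proof.
rewrite lt_neqAle fine_ge0// andbT eq_sym.
by have := tball_neq0 n; rewrite ball_volumeE eqe.
Qed.

Lemma unit_ball_volumeE n : unit_ball_volume R n = ball_volume n.
Proof.
rewrite /unit_ball_volume /ball_volume; congr (fine (leb n _)).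
by apply/seteqP; split=> t /=; rewrite sqnorm_row_of_tuple.
Qed.

Lemma tball_sqr n (r : R) : (0 < n)%N -> 0 <= r ->
  leb n (@tball n (r ^+ 2)) = (r ^+ n * ball_volume n)%:E.
Proof.
move=> n0; rewrite le_eqVlt => /predU1P[<-|r0].
  rewrite [in RHS]expr0n gtn_eqF// mul0r expr0n /=; apply/eqP.
  have b0 : (leb n (@tball n 0) < +oo)%E.
    apply: le_lt_trans (tball_fin n); apply: le_measure; rewrite ?inE.
    - exact: measurable_tball.
    - exact: measurable_tball.
    - by move=> t /= /le_trans; apply.
  (* A ball of radius [0] has volume [0] since it is its own dilate by [2]. *)
  have := @tball_scale n 2 0 (ltr0n _ 2); rewrite mulr0.
  move: b0; rewrite -ge0_fin_numE// => /fineK <-; rewrite -EFinM => -[] /eqP.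
  rewrite -subr_eq0 -{1}[fine _]mul1r -mulrBl mulf_eq0 => /orP[|/eqP->//].
  by rewrite subr_eq0 -natrX (eqr_nat R 1) eq_sym -(expn0 2) eqn_exp2l// gtn_eqF.
by rewrite -[r ^+ 2]mulr1 tball_scale// ball_volumeE.
Qed.

Lemma measurable_tnorm n : measurable_fun setT (fun t : Rtuple n R => Num.sqrt (tdot t t)).
Proof. exact: (measurableT_comp measurable_sqrt (@measurable_tdot R n)). Qed.

(** The law of [|t|] is determined by the volumes of balls: [r^(n+1) w] is the
    primitive of the density [(n+1) w r^n]. *)
Lemma ge0_integral_radial n (g : R -> \bar R) :
  measurable_fun setT g -> (forall x, (0 <= g x)%E) ->
  (\int[leb n.+1]_t g (Num.sqrt (tdot t t)) =
   (n.+1%:R * ball_volume n.+1)%:E *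
     \int[mu]_(x in `]0%R, +oo[) (g x * (x ^+ n)%:E))%E.
Proof.
move=> mg g0.
set w := ball_volume n.+1.
have w0 : 0 < w by exact: ball_volume_gt0.
pose k (x : R) := n.+1%:R * w * x ^+ n.
pose i0 := \1_(`]0%R, +oo[%classic : set R) : R -> R.
pose h (x : R) := k x * i0 x.
have mi0 : measurable_fun setT i0 by exact: measurable_indic.
have mh : measurable_fun setT h.
  by apply: measurable_funM => //; apply: measurable_funM.
have h0 x : 0 <= h x.
  rewrite /h /i0 indicE; case: (boolP (x \in _)) => [|_]; last by rewrite mulr0.
  by rewrite inE /= in_itv/= andbT mulr1 => x0; rewrite /k !mulr_ge0 ?exprn_ge0// ltW.
have -> : (\int[leb n.+1]_t g (Num.sqrt (tdot t t)) = \int[mu]_x (g x * (h x)%:E))%E.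
  apply: (@integral_pushforward_density _ _ _ (leb n.+1) setT
    (fun t => Num.sqrt (tdot t t))) => //; first exact: measurable_tnorm.
  move=> a b ab; rewrite setTI.
  (* The norm has no mass on the negative half line. *)
  pose a' := Num.max a 0; pose b' := Num.max b 0.
  exists (b' ^+ n.+1 * w - a' ^+ n.+1 * w).
    have [b0|b0] := ltP b 0.
      rewrite /a' /b' !max_r ?(ltW b0)// ?(ltW (lt_trans ab b0))// subrr.
      rewrite (_ : _ @^-1` _ = set0) ?measure0//.
      rewrite -subset0 => t /=; rewrite in_itv/= => /andP[_ tb].
      by have := sqrtr_ge0 (tdot t t); rewrite leNgt (le_lt_trans tb b0).
    have -> : b' = b by rewrite /b' max_l.
    have sqb t : (Num.sqrt (tdot t t : R) <= b) = (tdot t t <= b ^+ 2).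
      by rewrite -{1}(ger0_norm b0) -sqrtr_sqr ler_sqrt// sqr_ge0.
    have [a0|a0] := ltP a 0.
      rewrite /a' max_r ?(ltW a0)// expr0n /= mul0r subr0 -tball_sqr//.
      congr (leb _ _); apply/seteqP; split => t /=; rewrite in_itv/= sqb.
        by move=> /andP[].
      by move=> ->; rewrite (lt_le_trans a0)// sqrtr_ge0.
    have -> : a' = a by rewrite /a' max_l.
    have sqa t : (Num.sqrt (tdot t t : R) <= a) = (tdot t t <= a ^+ 2).
      by rewrite -{1}(ger0_norm a0) -sqrtr_sqr ler_sqrt// sqr_ge0.
    rewrite (_ : _ @^-1` _ = @tball n.+1 (b ^+ 2) `\` @tball n.+1 (a ^+ 2)); last first.
      apply/seteqP; split => t /=; rewrite in_itv/= sqb ltNge sqa.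
        by move=> /andP[/negP].
      by move=> [-> /negP ->].
    rewrite EFinB -!tball_sqr//; apply: etrans (measureD _ _ _) _.
    - exact: measurable_tball.
    - exact: measurable_tball.
    - by apply: le_lt_trans (ltry (b ^+ n.+1 * w)); rewrite -tball_sqr.
    rewrite setIidr//= => t /= /le_trans; apply.
    by rewrite ler_sqr ?nnegrE//; exact: ltW.
  transitivity (\int[mu]_(x in `]a', b']) (k x)%:E)%E.
    rewrite integral_mkcond [RHS]integral_mkcond; apply: eq_integral => x _.
    rewrite !patchE !mem_setE !in_itv /= gt_max le_max /h /i0 indicE mem_setE in_itv/= andbT.
    have [x0|x0] := ltP 0 x; last by rewrite andbF mulr0; case: ifP.
    by rewrite andbT mulr1 orbF.
  apply: (@integral_is_derive _ k (fun x => x ^+ n.+1 * w)).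
  - by rewrite ge_max le_max (ltW ab) le_max lexx orbT.
  - move=> x; apply: cvgM; first exact: cvg_cst.
    exact: exprn_continuous.
  - move=> x.
    have H : is_derive x (1 : R) (fun x => x ^+ n.+1 * w) _ :=
      is_deriveM (is_derive_exprn n.+1 x) (is_derive_cst w x (1 : R)).
    apply: (is_derive_eq H).
    by rewrite /k scaler0 add0r [LHS]mulrA [w * _]mulrC.
rewrite -ge0_integralZl//.
- rewrite [RHS]integral_mkcond; apply: eq_integral => x _.
  rewrite patchE /h /i0 indicE /k.
  case: (x \in _); last by rewrite mulr0 mule0.
  by rewrite mulr1 [in RHS]muleCA -EFinM.
- apply: emeasurable_funM.
    exact: measurable_funTS.
  by apply/measurable_EFinP/measurable_funTS/measurable_funX.
- move=> x /=; rewrite in_itv /= andbT => x0.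
  by rewrite mule_ge0// lee_fin exprn_ge0 ?ltW.
- by rewrite lee_fin mulr_ge0// ltW.
Qed.

End radial.

(** * Integrals of zonal functions *)

Section polar.
Context {R : realType}.
Local Notation mu := (@lebesgue_measure R).
Local Notation RR := (measurableTypeR R).
Local Notation leb n := (lebesgue_tuple R n).

Let i0 : R -> R := \1_(`]0%R, +oo[%classic : set R).

Let i0E (x : R) : i0 x = (0 < x)%R%:R.
Proof. by rewrite /i0 indicE mem_setE in_itv /= andbT. Qed.

Let mi0 : measurable_fun setT i0.
Proof. exact: measurable_indic. Qed.

Let i0_sqrt q x : 0 < q -> i0 (q * x) = i0 x.
Proof. by move=> q0; rewrite !i0E pmulr_rgt0. Qed.

Lemma integral_gt0_indic (f : R -> R) :
  (\int[mu]_(x in `]0%R, +oo[) (f x)%:E = \int[mu]_x (i0 x * f x)%R%:E)%E.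
Proof.
rewrite integral_mkcond; apply: eq_integral => x _.
by rewrite patchE /i0 indicE; case: (x \in _); rewrite ?mul1r ?mul0r.
Qed.

(** The line parametrizes a half circle by [v = tan s], and [t = pi/2 - s] is the
    angle to the axis. *)
Lemma integral_tan_half_circle (G : R -> R) m :
  measurable_fun setT G -> (forall x, 0 <= G x) ->
  (\int[mu]_v (G (v / Num.sqrt (1 + v ^+ 2)) * Num.sqrt (1 + v ^+ 2) ^- m.+2)%R%:E =
   \int[mu]_(t in `]0%R, pi[) (G (cos t) * sin t ^+ m)%R%:E)%E.
Proof.
move=> mG G0.
have q0 v : 0 < 1 + v ^+ 2 :> R by rewrite ltr_wpDr ?sqr_ge0.
have s0 v : 0 < Num.sqrt (1 + v ^+ 2 : R) by rewrite sqrtr_gt0.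
have mq : measurable_fun setT (fun v : R => Num.sqrt (1 + v ^+ 2)).
  by apply: (measurableT_comp measurable_sqrt); apply: measurable_funD => //; exact: measurable_funX.
have mqV : measurable_fun setT (fun v : R => (Num.sqrt (1 + v ^+ 2))^-1).
  exact: (measurableT_comp measurable_inv mq).
pose F (v : R) := G (v / Num.sqrt (1 + v ^+ 2)) * (Num.sqrt (1 + v ^+ 2))^-1 ^+ m.
have mF : measurable_fun setT (fun v => (F v)%:E).
  apply/measurable_EFinP; apply: measurable_funM.
    by apply: measurableT_comp => //; exact: measurable_funM.
  exact: measurable_funX.
have F0 v : (0 <= (F v)%:E)%E.
  by rewrite lee_fin mulr_ge0 ?exprn_ge0// invr_ge0 ltW.
transitivity (\int[mu]_v ((F v)%:E * ((1 + v ^+ 2)^-1)%R%:E))%E.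
  apply: eq_integral => v _; rewrite -EFinM /F -mulrA; congr ((_ * _)%:E).
  have -> : 1 + v ^+ 2 = Num.sqrt (1 + v ^+ 2) ^+ 2 by rewrite sqr_sqrtr// ltW.
  rewrite sqrtr_sqr ger0_norm ?sqrtr_ge0// -(addn2 m) exprD invfM.
  by rewrite exprVn.
rewrite -ge0_integral_tan//.
pose H t := G (sin t) * cos t ^+ m.
transitivity (\int[mu]_t (\1_(`]- (pi / 2), pi / 2[%classic : set R) t * H t)%R%:E)%E.
  rewrite integral_mkcond; apply: eq_integral => t _.
  rewrite patchE indicE; case: (boolP (t \in _)) => [|_]; last by rewrite mul0r.
  rewrite inE /= in_itv/= => tpi; rewrite mul1r /F /H.
  have c0 : 0 < cos t by exact: cos_gt0_pihalf.
  have -> : Num.sqrt (1 + tan t ^+ 2) = (cos t)^-1.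
    by rewrite -cos2_tan2 ?gt_eqF// -exprVn sqrtr_sqr gtr0_norm// invr_gt0.
  by rewrite invrK /tan mulfVK ?gt_eqF.
rewrite [RHS]integral_mkcond.
pose K t := ((\1_(`]0, pi[%classic : set R) t * (G (cos t) * sin t ^+ m))%:E).
transitivity (\int[mu]_t K t)%E; last first.
  by apply: eq_integral => t _; rewrite patchE /K indicE; case: (t \in _); rewrite ?mul1r ?mul0r.
have mK : measurable_fun [set: R] K.
  apply/measurable_EFinP; apply: measurable_funM; first exact: measurable_indic.
  apply: measurable_funM.
    apply: measurableT_comp => //; apply: continuous_measurable_fun; exact: continuous_cos.
  apply: measurable_funX; apply: continuous_measurable_fun; exact: continuous_sin.
have K0 t : (0 <= K t)%E.
  rewrite /K lee_fin indicE; case: (boolP (t \in _)) => [|_]; last by rewrite mul0r.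
  rewrite inE /= in_itv/= mul1r => /andP[t0 tpi].
  by rewrite mulr_ge0// exprn_ge0// sin_ge0_pi// !ltW.
have N1 : -1 != 0 :> R by rewrite oppr_eq0 oner_eq0.
have /= := ge0_integral_affine (pi / 2) N1 mK K0.
rewrite normrN1 invr1 mul1e => <-.
apply: eq_integral => t _; rewrite /K /H mulN1r [- t + _]addrC; congr (_ * _)%:E.
  rewrite !indicE; congr ((nat_of_bool _)%:R); apply/idP/idP; rewrite !inE /= !in_itv/=; lra.
by rewrite -opprB cosN sinN cosBpihalf sinBpihalf opprK.
Qed.

(** The radial factor in polar coordinates, which is shared by all zonal
    functions [G]. *)
Definition zonal_const m (w : R -> R) : \bar R :=
  ((m.+1%:R * ball_volume m.+1)%:E *
   \int[mu]_(x in `]0%R, +oo[) (x ^+ m.+1 * w (x ^+ 2))%R%:E)%E.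

(** With [x = thead t] and [y] the norm of the other coordinates, the integral is
    one over the half plane [y > 0] with weight [y^m], by the radial formula in
    dimension [m + 1]. Polar coordinates of this half plane are introduced in two
    affine steps, [x = y v] at fixed [y] and then [s = q v * y] at fixed [v],
    where [q v = sqrt (1 + v^2)] and [s] is the norm of [(x, y)]. *)
Lemma integral_zonal m (G w : R -> R) :
  measurable_fun setT G -> (forall x, 0 <= G x) ->
  measurable_fun setT w -> (forall x, 0 <= w x) ->
  (\int[leb m.+2]_t (G (thead t / Num.sqrt (tdot t t)) * w (tdot t t))%R%:E =
   zonal_const m w * \int[mu]_(t in `]0%R, pi[) (G (cos t) * sin t ^+ m)%R%:E)%E.
Proof.
move=> mG G0 mw w0.
have q0 v : 0 < 1 + v ^+ 2 :> R by rewrite ltr_wpDr ?sqr_ge0.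
have s0 v : 0 < Num.sqrt (1 + v ^+ 2 : R) by rewrite sqrtr_gt0.
have mGw d (T : measurableType d) (f g : T -> R) :
    measurable_fun setT f -> measurable_fun setT g ->
    measurable_fun setT (fun t => G (f t / Num.sqrt (g t)) * w (g t)).
  move=> mf mg; apply: measurable_funM; last exact: measurableT_comp.
  apply: (measurableT_comp mG); apply: measurable_funM => //.
  exact: (measurableT_comp measurable_inv (measurableT_comp measurable_sqrt mg)).
rewrite ge0_integral_lebesgue_tuple; last 2 first.
- by apply/measurable_EFinP/mGw; [exact: measurable_thead|exact: measurable_tdot].
- by move=> t; rewrite lee_fin mulr_ge0.
pose A : \bar R := (m.+1%:R * ball_volume m.+1)%:E.
have A0 : (0 <= A)%E by rewrite lee_fin mulr_ge0// ltW// ball_volume_gt0.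
pose f x y := i0 y * y ^+ m * (G (x / Num.sqrt (x ^+ 2 + y ^+ 2)) * w (x ^+ 2 + y ^+ 2)).
have f0 x y : 0 <= f x y.
  rewrite /f i0E; case: ltP => y0; rewrite ?mul0r// mul1r mulr_ge0//.
    by rewrite exprn_ge0// ltW.
  exact: mulr_ge0.
have mf : measurable_fun setT (fun p : RR * RR => f p.1 p.2).
  apply: measurable_funM.
    apply: measurable_funM; last by apply: measurable_funX.
    exact: (measurableT_comp mi0 measurable_snd).
  by apply: mGw => //; apply: measurable_funD; apply: measurable_funX.
transitivity (A * \int[mu]_x \int[mu]_y (f x y)%:E)%E.
  rewrite -ge0_integralZl//; last 2 first.
  - apply: (@measurable_fun_fubini_tonelli_F _ _ _ _ _ mu (fun p : RR * RR => (f p.1 p.2)%:E)) => //.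
      exact/measurable_EFinP.
    by move=> p; rewrite lee_fin.
  - by move=> x _; apply: integral_ge0 => y _; rewrite lee_fin.
  apply: eq_integral => x _.
  pose g y := (G (x / Num.sqrt (x ^+ 2 + y ^+ 2)) * w (x ^+ 2 + y ^+ 2))%:E.
  transitivity (\int[leb m.+1]_t g (Num.sqrt (tdot t t)))%E.
    by apply: eq_integral => t _; rewrite /g tdot_cons theadE sqr_sqrtr ?tdot_ge0.
  rewrite ge0_integral_radial; last 2 first.
  - apply/measurable_EFinP/mGw; first exact: measurable_cst.
    by apply: measurable_funD => //; exact: measurable_funX.
  - by move=> y; rewrite lee_fin mulr_ge0.
  rewrite -/A; congr (A * _)%E.
  transitivity (\int[mu]_(y in `]0%R, +oo[) (fine (g y) * y ^+ m)%R%:E)%E => //.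
  rewrite integral_gt0_indic; apply: eq_integral => y _.
  by rewrite /f /g /= -mulrA [X in i0 y * X]mulrC.
rewrite /zonal_const -/A -muleA; congr (A * _)%E.
rewrite -integral_tan_half_circle//.
rewrite (@fubini_tonelli _ _ _ _ _ mu mu (fun p : RR * RR => (f p.1 p.2)%:E)) /=; last 2 first.
- exact/measurable_EFinP.
- by move=> p; rewrite lee_fin.
pose q v : R := Num.sqrt (1 + v ^+ 2).
have qE v : q v ^+ 2 = 1 + v ^+ 2 by rewrite sqr_sqrtr// ltW.
have mq : measurable_fun setT q.
  by apply: (measurableT_comp measurable_sqrt); apply: measurable_funD => //; exact: measurable_funX.
have mqV : measurable_fun setT (fun v => (q v)^-1).
  exact: (measurableT_comp measurable_inv mq).
(* [k v y] is the integrand after [x = y v], as a product of a function of [v]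
   and a function of [s = q v * y]. *)
pose h s := i0 s * (s ^+ m.+1 * w (s ^+ 2)).
have h0 s : 0 <= h s.
  rewrite /h i0E; case: ltP => y0; rewrite ?mul0r// mul1r mulr_ge0//.
  by rewrite exprn_ge0// ltW.
have mh : measurable_fun setT h.
  apply: measurable_funM => //; apply: measurable_funM; first exact: measurable_funX.
  by apply: measurableT_comp => //; exact: measurable_funX.
pose a v := G (v / q v) * (q v)^-1 ^+ m.+1.
have a0 v : 0 <= a v by rewrite mulr_ge0// exprn_ge0// invr_ge0 sqrtr_ge0.
have ma : measurable_fun setT a.
  apply: measurable_funM; last exact: measurable_funX.
  by apply: measurableT_comp => //; exact: measurable_funM.
pose k v y := a v * h (q v * y).
have k0 v y : 0 <= k v y by exact: mulr_ge0.
have mk : measurable_fun setT (fun p : RR * RR => k p.1 p.2).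
  apply: measurable_funM; first exact: (measurableT_comp ma measurable_fst).
  apply: (measurableT_comp mh); apply: measurable_funM => //.
  exact: (measurableT_comp mq measurable_fst).
transitivity (\int[mu]_y \int[mu]_v (k v y)%:E)%E.
  apply: eq_integral => y _.
  have [y0|y0] := ltP 0 y; last first.
    transitivity (\int[mu]_(v in (setT : set R)) (cst 0%E v) : \bar R)%E.
      by apply: eq_integral => x _; rewrite /f i0E ltNge y0 !mul0r.
    apply: eq_integral => x _.
    by rewrite /k /h (i0_sqrt y (s0 x)) i0E ltNge y0 !mul0r mulr0.
  have mfy0 : measurable_fun [set: R] (fun x => f x y).
    exact: (measurableT_comp mf (measurable_fun_pair (@measurable_id _ _ _) (measurable_cst y))).
  have mfy : measurable_fun [set: R] (fun x => (f x y)%:E) by exact/measurable_EFinP.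
  have fy0 x : (0 <= (f x y)%:E)%E by rewrite lee_fin.
  have yn0 : y != 0 by rewrite gt_eqF.
  have /= H := ge0_integral_affine 0 yn0 mfy fy0.
  transitivity (y%:E * (\int[mu]_x (f (y * x + 0) y)%R%:E))%E.
    by rewrite H gtr0_norm// muleA -EFinM divff// mul1e.
  have mfyy : measurable_fun [set: R] (fun v => f (y * v + 0) y).
    have my : measurable_fun [set: R] (fun v : R => y * v + 0).
      by apply: measurable_funD => //; exact: measurable_funM.
    exact: (measurableT_comp mfy0 my).
  rewrite -(ge0_integralMl mu measurableT mfyy) ?ltW//.
  apply: eq_integral => v _; congr EFin.
  rewrite /f /k /a /h (i0_sqrt y (s0 v)) addr0.
  have -> : (y * v) ^+ 2 + y ^+ 2 = (q v * y) ^+ 2 by rewrite !exprMn qE; ring.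
  rewrite sqrtr_sqr ger0_norm ?mulr_ge0 ?sqrtr_ge0 ?ltW//.
  have -> : y * v / (q v * y) = v / q v by field; rewrite yn0 gt_eqF ?s0.
  rewrite [(q v * y) ^+ m.+1]exprMn exprVn [y ^+ m.+1]exprS.
  by field; rewrite expf_neq0// gt_eqF ?s0.
rewrite -(@fubini_tonelli _ _ _ _ _ mu mu (fun p : RR * RR => (k p.1 p.2)%:E)) /=; last 2 first.
- exact/measurable_EFinP.
- by move=> p; rewrite lee_fin.
have mb : measurable_fun [set: R] (fun v : R => G (v / q v) * q v ^- m.+2).
  rewrite (_ : (fun v => _) = fun v => G (v / q v) * (q v)^-1 ^+ m.+2); last first.
    by apply/funext => v; rewrite exprVn.
  apply: measurable_funM; last exact: measurable_funX.
  by apply: measurableT_comp => //; exact: measurable_funM.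
have b0 v : 0 <= G (v / q v) * q v ^- m.+2.
  by rewrite mulr_ge0// invr_ge0 exprn_ge0// sqrtr_ge0.
rewrite -ge0_integralZl//; last 3 first.
- exact/measurable_EFinP.
- by move=> v _; rewrite lee_fin.
- by apply: integral_ge0 => x; rewrite /= in_itv/= andbT => x0; rewrite lee_fin mulr_ge0// exprn_ge0// ltW.
apply: eq_integral => v _.
have -> : (\int[mu]_(x in `]0%R, +oo[) (x ^+ m.+1 * w (x ^+ 2))%R%:E = \int[mu]_x (h x)%:E)%E.
  exact: integral_gt0_indic.
have mhv : measurable_fun [set: R] (fun y => h (q v * y)).
  by apply: measurableT_comp => //; exact: measurable_funM.
rewrite (ge0_integralMl mu measurableT mhv)//.
have mhE : measurable_fun [set: R] (fun s => (h s)%:E) by exact/measurable_EFinP.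
have hE0 s : (0 <= (h s)%:E)%E by rewrite lee_fin.
have qn0 : q v != 0 by rewrite gt_eqF ?s0.
have /= H := ge0_integral_affine 0 qn0 mhE hE0.
transitivity ((a v)%:E * (\int[mu]_x (h (q v * x + 0)%R)%:E))%E.
  by congr (_ * _)%E; apply: eq_integral => y _; rewrite addr0.
rewrite H muleA -EFinM muleC; congr (_ * _%:E)%E.
rewrite gtr0_norm ?s0// /a -mulrA; congr (_ * _).
by rewrite exprVn -invfM -exprSr.
Qed.

(** The integral of a radial function, computed by [|t| = tan s] since then
    [sin (2 s) = 2 |t| / (1 + |t|^2)]. *)
Lemma integral_conformal_factor m (r : R) : 0 < r ->
  (\int[leb m.+1]_t ((2 * r / (tdot t t + 1)) ^+ m.+1)%R%:E =
   (m.+1%:R * ball_volume m.+1 * r ^+ m.+1)%:E *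
     \int[mu]_(t in `]0%R, pi[) (sin t ^+ m)%R%:E)%E.
Proof.
move=> r0.
have q0 v : 0 < 1 + v ^+ 2 :> R by rewrite ltr_wpDr ?sqr_ge0.
pose g (y : R) := (2 * r / (y ^+ 2 + 1)) ^+ m.+1.
have g0 y : 0 <= g y.
  by rewrite exprn_ge0// divr_ge0 ?mulr_ge0 ?ltW// addrC.
have mg : measurable_fun setT g.
  apply: measurable_funX; apply: measurable_funM => //.
  apply: (measurableT_comp measurable_inv); apply: measurable_funD => //; exact: measurable_funX.
transitivity (\int[leb m.+1]_t (g (Num.sqrt (tdot t t)))%:E)%E.
  by apply: eq_integral => t _; rewrite /g sqr_sqrtr ?tdot_ge0.
rewrite (@ge0_integral_radial R m (fun y => (g y)%:E)); last 2 first.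
- exact/measurable_EFinP.
- by move=> y; rewrite lee_fin.
have B0 : 0 <= m.+1%:R * @ball_volume R m.+1 by rewrite mulr_ge0// ltW// ball_volume_gt0.
rewrite [in RHS]EFinM -muleA; congr (_ * _)%E.
transitivity (\int[mu]_(y in `]0%R, +oo[) (g y * y ^+ m)%R%:E)%E => //.
rewrite integral_gt0_indic.
pose F (v : R) := i0 v * (r ^+ m.+1 * (2 * (2 * v / (1 + v ^+ 2)) ^+ m)).
have mF : measurable_fun setT F.
  apply: measurable_funM => //; apply: measurable_funM => //; apply: measurable_funM => //.
  apply: measurable_funX; apply: measurable_funM; first exact: measurable_funM.
  apply: (measurableT_comp measurable_inv); apply: measurable_funD => //; exact: measurable_funX.
have F0 v : 0 <= F v.
  rewrite /F i0E; case: ltP => v0; rewrite ?mul0r// mul1r.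
  rewrite mulr_ge0 ?exprn_ge0 ?(ltW r0)// mulr_ge0// exprn_ge0// divr_ge0 ?mulr_ge0 ?(ltW v0)//.
  exact: ltW.
transitivity (\int[mu]_v ((F v)%:E * ((1 + v ^+ 2)^-1)%R%:E))%E.
  apply: eq_integral => v _; rewrite -EFinM /F /g; congr EFin.
  rewrite [v ^+ 2 + 1]addrC !expr_div_n !exprMn !(exprS _ m).
  by field; rewrite ?expf_neq0 ?gt_eqF.
rewrite -(@ge0_integral_tan _ (fun v => (F v)%:E)); last 2 first.
- exact/measurable_EFinP.
- by move=> v; rewrite lee_fin.
pose K (t : R) := \1_(`]0, pi[%classic : set R) t * sin t ^+ m.
have K0 t : 0 <= K t.
  rewrite /K indicE; case: (boolP (t \in _)) => [|_]; last by rewrite mul0r.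
  by rewrite inE /= in_itv/= mul1r => /andP[t0 tpi]; rewrite exprn_ge0// sin_ge0_pi// !ltW.
have mK : measurable_fun [set: R] K.
  apply: measurable_funM; first exact: measurable_indic.
  by apply: measurable_funX; apply: continuous_measurable_fun; exact: continuous_sin.
have -> : (\int[mu]_(t in `]0%R, pi[) (sin t ^+ m)%R%:E = \int[mu]_t (K t)%:E)%E.
  rewrite integral_mkcond; apply: eq_integral => t _.
  by rewrite patchE /K indicE; case: (t \in _); rewrite ?mul1r ?mul0r.
have n2 : 2 != 0 :> R by [].
have mKE : measurable_fun [set: R] (fun t => (K t)%:E) by exact/measurable_EFinP.
have KE0 t : (0 <= (K t)%:E)%E by rewrite lee_fin.
have /= H := ge0_integral_affine 0 n2 mKE KE0.
have -> : (\int[mu]_t (K t)%:E = 2%:E * \int[mu]_t (K (2 * t + 0)%R)%:E)%E.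
  by rewrite H muleA -EFinM gtr0_norm// divff// mul1e.
have mK2 : measurable_fun [set: R] (fun t : R => K (2 * t + 0)).
  have m2 : measurable_fun [set: R] (fun t : R => 2 * t + 0).
    by apply: measurable_funD => //; exact: measurable_funM.
  exact: (measurableT_comp mK m2).
rewrite muleA -EFinM -(ge0_integralMl mu measurableT mK2)//; last first.
  by rewrite mulr_ge0// exprn_ge0// ltW.
rewrite [LHS]integral_mkcond; apply: eq_integral => t _; rewrite patchE addr0.
case: (boolP (t \in _)) => [|tn].
  rewrite inE /= in_itv/= => tpi.
  have c0 : 0 < cos t by exact: cos_gt0_pihalf.
  rewrite /F /K i0E indicE mem_setE in_itv/=.
  have pi0 := pi_gt0 R.
  have [t0|t0] := ltP 0 t; last first.
    have -> : 0 < 2 * t = false by apply/negbTE; rewrite -leNgt; lra.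
    have -> : 0 < tan t = false.
      apply/negbTE; rewrite -leNgt -tan0 leNgt ltr_tan ?in_itv/= -?leNgt//.
      by apply/andP; split; lra.
    by rewrite !mul0r mulr0.
  have -> : 0 < tan t.
    rewrite -tan0 ltr_tan ?in_itv/=//.
    by apply/andP; split; lra.
  have -> : 0 < 2 * t < pi by apply/andP; split; lra.
  rewrite !mul1r mulrA; congr (_ * _ ^+ _)%:E.
  rewrite -cos2_tan2 ?gt_eqF// (_ : 2 * t = t + t) ?sinD /tan; last by ring.
  by field; rewrite gt_eqF.
have tpi : ~ (- (pi / 2) < t < pi / 2) by move: tn; rewrite notin_setE /= in_itv.
rewrite /K indicE memNset ?mul0r ?mulr0//= in_itv/=; apply: contra_not tpi.
by move=> /andP[t0 tpi]; apply/andP; split; have := pi_gt0 R; lra.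
Qed.

End polar.

(** * Taylor bounds and gamma integrals *)

Section calculus_bounds.
Context {R : realType}.
Local Notation mu := (@lebesgue_measure R).
Implicit Types (f F : R -> R) (x a : R).

(** The Taylor bounds below are obtained from one another by this lemma, each
    being the derivative of the next. *)
Lemma ge0_of_derive_ge0 f F : (forall x : R, is_derive x (1 : R) F (f x)) ->
  F 0 = 0 -> (forall x, 0 <= x -> 0 <= f x) -> forall x, 0 <= x -> 0 <= F x.
Proof.
move=> dF F0 f0 x x0; rewrite -F0.
have cF : continuous F.
  move=> y; apply/differentiable_continuous/derivable1_diffP.
  exact: (@ex_derive _ _ _ _ _ _ _ (dF y)).
apply: (@ger0_derive1_le_cc _ F 0 x) => //.
- move=> y; rewrite in_itv/= => /andP[y0 _].
  by rewrite derive1E (@derive_val _ _ _ _ _ _ _ (dF y)) f0// ltW.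
- exact: continuous_subspaceT.
- by rewrite in_itv /= lexx.
- by rewrite in_itv /= lexx andbT.
Qed.

Lemma sin_le_id x : 0 <= x -> sin x <= x.
Proof.
move=> x0; rewrite -subr_ge0.
apply: (@ge0_of_derive_ge0 (fun x => 1 - cos x) (fun x => x - sin x)) => //.
- by rewrite /= sin0 subrr.
Qed.

Lemma is_deriveZX (c : R) n x :
  is_derive x (1 : R) (fun y => c * y ^+ n) (c * (n%:R * x ^+ n.-1)).
Proof.
have H : is_derive x (1 : R) (fun y => c * y ^+ n) _ :=
  is_deriveM (is_derive_cst c x (1 : R)) (is_derive_exprn n x).
by apply: (is_derive_eq H); rewrite scaler0 addr0.
Qed.

Lemma cos_ge_quadratic x : 0 <= x -> 1 - x ^+ 2 / 2 <= cos x.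
Proof.
move=> x0; rewrite -subr_ge0.
have -> : cos x - (1 - x ^+ 2 / 2) = cos x - (1 - 2^-1 * x ^+ 2) by rewrite [_ / 2]mulrC.
apply: (@ge0_of_derive_ge0 (fun x => x - sin x) (fun x => cos x - (1 - 2^-1 * x ^+ 2))) => //.
- move=> y.
  have H : is_derive y (1 : R) (fun x => cos x - (1 - 2^-1 * x ^+ 2)) _ :=
    is_deriveB (is_derive_cos y) (is_deriveB (is_derive_cst (1 : R) y (1 : R)) (is_deriveZX 2^-1 2 y)).
  by apply: (is_derive_eq H); rewrite /= expr1; field.
- by rewrite /= cos0 expr0n /= mulr0 subr0 subrr.
- by move=> y y0; rewrite subr_ge0 sin_le_id.
Qed.

Lemma sin_ge_cubic x : 0 <= x -> x - x ^+ 3 / 6 <= sin x.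
Proof.
move=> x0; rewrite -subr_ge0 [_ / 6]mulrC.
apply: (@ge0_of_derive_ge0 (fun x => cos x - (1 - x ^+ 2 / 2)) (fun x => sin x - (x - 6^-1 * x ^+ 3))) => //.
- move=> y.
  have H : is_derive y (1 : R) (fun x => sin x - (x - 6^-1 * x ^+ 3)) _ :=
    is_deriveB (is_derive_sin y) (is_deriveB (is_derive_id y (1 : R)) (is_deriveZX 6^-1 3 y)).
  by apply: (is_derive_eq H); rewrite /=; field.
- by rewrite /= sin0 expr0n /= mulr0 !subr0.
- by move=> y y0; rewrite subr_ge0 cos_ge_quadratic.
Qed.

Lemma cos_le_quartic x : 0 <= x -> cos x <= 1 - x ^+ 2 / 2 + x ^+ 4 / 24.
Proof.
move=> x0; rewrite -subr_ge0 ![_ / _]mulrC.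
apply: (@ge0_of_derive_ge0 (fun x => sin x - (x - x ^+ 3 / 6))
  (fun x => 1 - 2^-1 * x ^+ 2 + 24^-1 * x ^+ 4 - cos x)) => //.
- move=> y.
  have H : is_derive y (1 : R) (fun x => 1 - 2^-1 * x ^+ 2 + 24^-1 * x ^+ 4 - cos x) _ :=
    is_deriveB (is_deriveD (is_deriveB (is_derive_cst (1 : R) y (1 : R)) (is_deriveZX 2^-1 2 y))
      (is_deriveZX 24^-1 4 y)) (is_derive_cos y).
  by apply: (is_derive_eq H); rewrite /=; field.
- by rewrite /= cos0 !expr0n /= !mulr0 subr0 addr0 subrr.
- by move=> y y0; rewrite subr_ge0 sin_ge_cubic.
Qed.

Lemma sin_le_quintic x : 0 <= x -> sin x <= x - x ^+ 3 / 6 + x ^+ 5 / 120.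
Proof.
move=> x0; rewrite -subr_ge0 ![_ / _]mulrC.
apply: (@ge0_of_derive_ge0 (fun x => 1 - x ^+ 2 / 2 + x ^+ 4 / 24 - cos x)
  (fun x => x - 6^-1 * x ^+ 3 + 120^-1 * x ^+ 5 - sin x)) => //.
- move=> y.
  have H : is_derive y (1 : R) (fun x => x - 6^-1 * x ^+ 3 + 120^-1 * x ^+ 5 - sin x) _ :=
    is_deriveB (is_deriveD (is_deriveB (is_derive_id y (1 : R)) (is_deriveZX 6^-1 3 y))
      (is_deriveZX 120^-1 5 y)) (is_derive_sin y).
  by apply: (is_derive_eq H); rewrite /=; field.
- by rewrite /= sin0 !expr0n /= !mulr0 !subr0 addr0.
- by move=> y y0; rewrite subr_ge0 cos_le_quartic.
Qed.

Lemma expR_taylor1 (u : R) : 0 <= u -> `|expR u - 1 - u| <= u ^+ 2 * expR u.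
Proof.
move=> u0; have h := expR_ge1Dx u; have h' := expR_ge1Dx (- u).
rewrite ger0_norm; last lra.
have e1 : (1 - u) * expR u <= 1.
  by rewrite -[leRHS](expRxMexpNx_1 u) [leRHS]mulrC ler_wpM2r// expR_ge0.
have e2 : u * (expR u - 1) <= u * (u * expR u) by apply: ler_wpM2l => //; lra.
by rewrite expr2 -mulrA; lra.
Qed.

(** [- expR (- (a * x)) * gamma_poly a k x] is a primitive of
    [x ^+ k * expR (- (a * x))]; the recursion is integration by parts. *)
Fixpoint gamma_poly (a : R) (k : nat) (x : R) : R :=
  if k is k'.+1 then (x ^+ k + k%:R * gamma_poly a k' x) / a else a^-1.

Lemma is_derive_gamma_poly a k x : a != 0 ->
  is_derive x (1 : R) (gamma_poly a k) (a * gamma_poly a k x - x ^+ k).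
Proof.
move=> a0; elim: k => [|k IH].
  have H : is_derive x (1 : R) (gamma_poly a 0) _ := is_derive_cst a^-1 x (1 : R).
  by apply: (is_derive_eq H); rewrite /= divff// subrr.
have H : is_derive x (1 : R) (gamma_poly a k.+1) _ :=
  is_deriveM (is_deriveD (is_derive_exprn k.+1 x)
   (is_deriveM (is_derive_cst (k.+1%:R : R) x (1 : R)) IH)) (is_derive_cst a^-1 x (1 : R)).
apply: (is_derive_eq H); rewrite /= !scaler0 addr0 add0r.
transitivity (a^-1 * (k.+1%:R * x ^+ k + k.+1%:R * (a * gamma_poly a k x - x ^+ k))) => //.
by field.
Qed.

Lemma gamma_poly0 a k : a != 0 -> gamma_poly a k 0 = k`!%:R / a ^+ k.+1.
Proof.
move=> a0; elim: k => [|k IH] /=; first by rewrite fact0 expr1 div1r.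
by rewrite IH expr0n /= add0r factS natrM [a ^+ k.+2]exprSr invfM !mulrA.
Qed.

Lemma gamma_poly_ub a k : 0 < a -> exists2 C, 0 <= C &
  forall x, 1 <= x -> 0 <= gamma_poly a k x <= C * x ^+ k.
Proof.
move=> a0; elim: k => [|k [C C0 IH]].
  by exists a^-1 => [|y y1] /=; rewrite ?expr0 ?mulr1 ?lexx ?andbT invr_ge0 ltW.
exists ((1 + k.+1%:R * C) / a) => [|y y1].
  by rewrite divr_ge0 ?addr_ge0 ?mulr_ge0// ltW.
have /andP[g0 g1] := IH _ y1; have y0 : 0 <= y by lra.
apply/andP; split => /=.
  by rewrite divr_ge0 ?(ltW a0)// addr_ge0 ?exprn_ge0// mulr_ge0.
rewrite mulrAC ler_pM2r ?invr_gt0// mulrDl mul1r lerD2l -mulrA ler_wpM2l//.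
by rewrite (le_trans g1)// ler_wpM2l// exprS ler_peMl// exprn_ge0.
Qed.

Lemma cvg_gamma_poly a k : 0 < a ->
  (expR (- (a * x)) * gamma_poly a k x) @[x --> +oo] --> (0 : R).
Proof.
move=> a0; have [C C0 gC] := gamma_poly_ub k a0.
pose D := C * (k.+1`!%:R / a ^+ k.+1).
have D0 : 0 <= D by rewrite mulr_ge0// divr_ge0// exprn_ge0// ltW.
apply: (@squeeze_cvgr _ _ _ _ (cst 0) (fun x => D * x^-1)).
- near=> x.
  have x1 : 1 <= x by near: x; exact: nbhs_pinfty_ge.
  have x0 : 0 < x by lra.
  have /andP[g0 g1] := gC _ x1.
  rewrite mulr_ge0 ?expR_ge0//=.
  rewrite expRN mulrC ler_pdivrMr ?expR_gt0// (le_trans g1)//.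
  have := expR_ge1Dxn k (ltW (mulr_gt0 a0 x0)) => ex.
  apply: (@le_trans _ _ (D * x^-1 * ((a * x) ^+ k.+1 / k.+1`!%:R))); last first.
    have Dx : 0 <= D * x^-1 by apply: mulr_ge0 => //; rewrite invr_ge0 ltW.
    apply: ler_wpM2l => //.
    by apply: le_trans ex; rewrite lerDr.
  rewrite /D exprMn [x ^+ k.+1]exprS le_eqVlt; apply/orP; left; apply/eqP.
  field; rewrite ?expf_neq0 ?gt_eqF//= ?pnatr_eq0 -?lt0n ?fact_gt0//.
- exact: cvg_cst.
- rewrite -[X in _ --> X](mulr0 D); apply: cvgM; first exact: cvg_cst.
  by apply/gtr0_cvgV0; [exact: nbhs_pinfty_gt | exact: cvg_id].
Unshelve. all: by end_near. Qed.

Lemma integral_gamma a k : 0 < a ->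
  (\int[mu]_(x in `]0%R, +oo[) (x ^+ k * expR (- (a * x)))%R%:E =
   (k`!%:R / a ^+ k.+1)%:E)%E.
Proof.
move=> a0; have an0 : a != 0 by rewrite gt_eqF.
pose F x := - (expR (- (a * x)) * gamma_poly a k x).
have dF (x : R) : is_derive x (1 : R) F (x ^+ k * expR (- (a * x))).
  have de : is_derive x (1 : R) (fun x => expR (- (a * x))) (- a * expR (- (a * x))).
    have H1 : is_derive x (1 : R) (fun x => - (a * x)) _ :=
      is_deriveN (is_deriveM (is_derive_cst a x (1 : R)) (is_derive_id x (1 : R))).
    have H : is_derive x (1 : R) (expR \o (fun x => - (a * x))) _ :=
      @is_derive1_comp R expR (fun x => - (a * x)) x _ _ (is_derive_expR (- (a * x))) H1.
    apply: (is_derive_eq H); rewrite scaler0 addr0 /=.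
    by rewrite -[(cst a x)%:A]/(a * 1) mulr1 mulrC.
  have H : is_derive x (1 : R) F _ :=
    is_deriveN (is_deriveM de (is_derive_gamma_poly k x an0)).
  apply: (is_derive_eq H).
  transitivity (- (expR (- (a * x)) * (a * gamma_poly a k x - x ^+ k)
    + gamma_poly a k x * (- a * expR (- (a * x))))) => //.
  by ring.
have cF : continuous F.
  move=> y; apply/differentiable_continuous/derivable1_diffP.
  exact: (@ex_derive _ _ _ _ _ _ _ (dF y)).
have cf : continuous (fun x => x ^+ k * expR (- (a * x))).
  move=> y; apply: cvgM; first exact: exprn_continuous.
  apply: (@continuous_comp _ _ _ (fun x => - (a * x)) expR); last exact: continuous_expR.
  by apply: cvgN; apply: cvgM; [exact: cvg_cst|exact: cvg_id].
rewrite integral_itv_obnd_cbnd; last first.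
  by apply/measurable_EFinP/measurable_funTS; exact: continuous_measurable_fun.
rewrite (@ge0_continuous_FTC2y _ _ F 0 0).
- by rewrite /F mulr0 oppr0 expR0 mul1r gamma_poly0// -EFinB sub0r opprK.
- by move=> x x0; rewrite mulr_ge0 ?expR_ge0// exprn_ge0.
- exact: continuous_subspaceT.
- rewrite -oppr0; apply: cvgN; exact: cvg_gamma_poly.
- by move=> x _; exact: (@ex_derive _ _ _ _ _ _ _ (dF x)).
- exact/cvg_at_right_filter/cF.
- by move=> x _; rewrite derive1E; exact: (@derive_val _ _ _ _ _ _ _ (dF x)).
Qed.

Lemma sin_pow_poly_ub m x : 0 <= x -> x <= 4 ->
  `|x ^+ m - m%:R / 6 * x ^+ m.+2| <= x ^+ m * (1 + 3 * m%:R).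
Proof.
move=> x0 x4.
have -> : x ^+ m - m%:R / 6 * x ^+ m.+2 = x ^+ m * (1 - m%:R / 6 * x ^+ 2).
  by rewrite -(addn2 m) exprD; ring.
rewrite normrM ger0_norm ?exprn_ge0// ler_wpM2l ?exprn_ge0//.
have x2 : x ^+ 2 <= 16 by rewrite (_ : 16 = 4 ^+ 2); [rewrite ler_sqr ?nnegrE//|ring].
have m0 : 0 <= m%:R :> R by [].
have := sqr_ge0 x => x20.
have h1 : 0 <= m%:R / 6 * x ^+ 2 by rewrite !mulr_ge0.
have h2 : m%:R / 6 * x ^+ 2 <= m%:R / 6 * 16 by rewrite ler_wpM2l// divr_ge0.
by rewrite ler_norml; apply/andP; split; lra.
Qed.

Lemma sin_pow_approx m : exists2 C, 0 <= C & forall x, 0 <= x -> x <= 4 ->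
  `|sin x ^+ m - (x ^+ m - m%:R / 6 * x ^+ m.+2)| <= C * x ^+ (m + 4).
Proof.
elim: m => [|m [C C0 IH]].
  by exists 0 => // x x0 x4; rewrite !expr0 !mul0r subr0 subrr normr0.
exists (C + 1 + 3 * m%:R + m%:R / 36) => [|x x0 x4].
  by rewrite !addr_ge0// ?mulr_ge0// ?divr_ge0.
set s := sin x.
have s_ub : `|s| <= x.
  rewrite ler_norml sin_le_id// andbT.
  have [x1|x1] := leP 1 x; first by rewrite (le_trans _ (sin_geN1 x))// lerN2.
  have := sin_ge_cubic x0; have : x ^+ 3 <= 1 * x.
    by rewrite exprSr ler_wpM2r// expr_le1// ltW.
  rewrite /s; lra.
pose p := x ^+ m - m%:R / 6 * x ^+ m.+2.
have p_ub : `|p| <= x ^+ m * (1 + 3 * m%:R) by exact: sin_pow_poly_ub.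
have -> : s ^+ m.+1 - (x ^+ m.+1 - m.+1%:R / 6 * x ^+ m.+3) =
    s * (s ^+ m - p) + (s - (x - x ^+ 3 / 6)) * p + m%:R / 36 * x ^+ (m.+1 + 4).
  by rewrite /p -(addn3 m) -(addn2 m) -(addn1 m) natrD !exprD; field.
have q_ub : `|s - (x - x ^+ 3 / 6)| <= x ^+ 5.
  have := sin_ge_cubic x0; have := sin_le_quintic x0; have := exprn_ge0 5 x0.
  rewrite -/s => h1 h2 h3; rewrite ler_norml; apply/andP; split; lra.
have x5 : 0 <= x ^+ (m.+1 + 4) by rewrite exprn_ge0.
rewrite (le_trans (ler_normD _ _))//.
have -> : (C + 1 + 3 * m%:R + m%:R / 36) * x ^+ (m.+1 + 4) =
  (x * (C * x ^+ (m + 4)) + x ^+ 5 * (x ^+ m * (1 + 3 * m%:R))) + m%:R / 36 * x ^+ (m.+1 + 4).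
  by rewrite -(addn1 m) !exprD; ring.
apply: lerD; last by rewrite ger0_norm// mulr_ge0// divr_ge0.
rewrite (le_trans (ler_normD _ _))// lerD// normrM ler_pM//.
exact: IH.
Qed.

End calculus_bounds.

(** * Asymptotics of a Laplace integral *)

Section laplace.
Context {R : realType}.
Local Notation mu := (@lebesgue_measure R).
Implicit Types (r k C x t : R) (delta : R -> R).

(** The lower bound [t / 3] provides an exponential decay of the integrand below
    on the whole interval, the last bound is the expansion of [delta] at [0]. *)
Definition near_identity delta k C :=
  forall t, 0 < t -> t < pi ->
    [/\ t / 3 <= delta t, delta t <= t & `|t - delta t - k * t ^+ 3| <= C * t ^+ 5].

(** With the integrand extended by [0] beyond [pi] the bound holds on the whole
    half line, so that it can be compared with gamma integrals without splitting
    the domain. In the error term each excess factor [t] yields a factor [r^-1]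
    upon integration, and all three terms are of order [r^-4] relative to
    [t ^+ m]. *)
Lemma laplace_integrand delta k C m : 0 <= k -> 0 <= C -> near_identity delta k C ->
  exists2 C1, 0 <= C1 & forall r t, 0 < r -> 0 < t ->
  `|(if t < pi then expR (- (r * delta t)) * sin t ^+ m else 0) -
     (t ^+ m - m%:R / 6 * t ^+ m.+2 + k * r * t ^+ (m + 3)) * expR (- (r * t))| <=
  C1 * ((t ^+ (m + 4) + r * t ^+ (m + 5) + r ^+ 2 * t ^+ (m + 6)) * expR (- (r / 3 * t))).
Proof.
move=> k0 C0 dP; have [C2 C20 sP] := @sin_pow_approx R m.
(* [t - delta t <= K t^3], because [t^2 <= 16] for [t < pi]. *)
pose K := k + 16 * C.
have K0 : 0 <= K by rewrite addr_ge0// mulr_ge0.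
have m0 : 0 <= m%:R :> R by [].
(* The first four terms are the constants of the errors [b1], [b2], [b3], [b4]
   below, the last three are for [t >= pi]. *)
exists (C2 + K ^+ 2 * (1 + 3 * m%:R) + C + K * m%:R + 1 + m%:R + k) => [|r t r0 t0].
  by rewrite !addr_ge0 ?mulr_ge0 ?exprn_ge0 ?addr_ge0 ?mulr_ge0.
set E := expR (- (r * t)); set B := expR (- (r / 3 * t)).
have E0 : 0 <= E by exact: expR_ge0.
have B0 : 0 <= B by exact: expR_ge0.
have EB : E <= B.
  by rewrite ler_expR lerN2 mulrAC ler_pdivrMr// ler_peMr ?mulr_ge0 ?(ltW r0) ?(ltW t0)//; lra.
set p := t ^+ m - m%:R / 6 * t ^+ m.+2.
have tn j : 0 <= t ^+ j by rewrite exprn_ge0 ?(ltW r0) ?(ltW t0).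
have rt j : 0 <= r * t ^+ j by rewrite mulr_ge0 ?(ltW r0) ?(ltW t0).
have rrt j : 0 <= r ^+ 2 * t ^+ j by rewrite mulr_ge0 ?exprn_ge0 ?(ltW r0) ?(ltW t0).
have [tpi|pit] := ltP t pi; last first.
  have t1 : 1 <= t by have := pi_ge2 R; lra.
  have hm i j : (i <= j)%N -> t ^+ i <= t ^+ j by move=> ij; rewrite ler_weXn2l.
  rewrite sub0r normrN normrM (ger0_norm E0) mulrA.
  apply: ler_pM => //.
  rewrite (le_trans (ler_normD _ _))//.
  have h1 : `|p| <= t ^+ (m + 4) + m%:R * t ^+ (m + 4).
    have m6 : 0 <= m%:R / 6 * t ^+ m.+2 by apply: mulr_ge0; [exact: divr_ge0|exact: tn].
    apply: le_trans (ler_normB _ _) _; rewrite (ger0_norm (tn m)) (ger0_norm m6).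
    apply: lerD; first by rewrite hm// leq_addr.
    have := hm m.+2 (m + 4)%N; rewrite -addn2 leq_add2l => /(_ isT) h2.
    apply: ler_pM => //.
    by rewrite ler_pdivrMr// ler_peMr//; lra.
  have h2 : `|k * r * t ^+ (m + 3)| <= k * (r * t ^+ (m + 5)).
    rewrite -mulrA ger0_norm; last by apply: mulr_ge0 => //; exact: rt.
    by apply: ler_wpM2l => //; apply: ler_wpM2l; rewrite ?(ltW r0)// hm// leq_add2l.
  set a := t ^+ (m + 4) in h1 *; set b := r * t ^+ (m + 5) in h2 *.
  set c := r ^+ 2 * _; have a0 : 0 <= a := tn _.
  have b0 : 0 <= b := rt _; have c0 : 0 <= c := rrt _.
  apply: le_trans (lerD h1 h2) _.
  set M := (X in _ <= X * _).
  apply: (@le_trans _ _ ((1 + m%:R + k) * (a + b + c))).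
    have e1 : 0 <= m%:R * b by exact: mulr_ge0.
    have e2 : 0 <= k * a by exact: mulr_ge0.
    have e3 : 0 <= (1 + m%:R + k) * c by apply: mulr_ge0 => //; rewrite !addr_ge0.
    lra.
  apply: ler_wpM2r; first by rewrite !addr_ge0.
  rewrite /M; have : 0 <= C2 + K ^+ 2 * (1 + 3 * m%:R) + C + K * m%:R; last lra.
  by rewrite !addr_ge0 ?mulr_ge0 ?exprn_ge0 ?addr_ge0 ?mulr_ge0.
have t4 : t <= 4 by have := pihalf_lt2 R; lra.
have [d1 d2 d3] := dP _ t0 tpi.
set D := expR (- (r * delta t)); have D0 : 0 <= D by exact: expR_ge0.
have DB : D <= B.
  by rewrite ler_expR lerN2 -mulrA ler_wpM2l ?(ltW r0) ?(ltW t0)// mulrC.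
pose u := r * (t - delta t).
have u0 : 0 <= u by rewrite mulr_ge0 ?(ltW r0) ?(ltW t0)// subr_ge0.
have DE : D = E * expR u by rewrite -expRD /u; congr expR; ring.
have uK : u <= K * (r * t ^+ 3).
  rewrite /u mulrCA ler_wpM2l ?(ltW r0) ?(ltW t0)//.
  have t5 : C * t ^+ 5 <= C * (16 * t ^+ 3).
    apply: ler_wpM2l => //; rewrite (exprD t 2 3) ler_wpM2r//.
    by rewrite (_ : 16 = 4 ^+ 2); [rewrite ler_sqr ?nnegrE// ltW|ring].
  move: d3; rewrite ler_norml => /andP[_ d3]; rewrite /K; lra.
(* The errors come from [sin t ^+ m], from [expR u] at second order, from [delta]
   and from the product of [u] with the second term of [p]. *)
have -> : D * sin t ^+ m - (p + k * r * t ^+ (m + 3)) * E =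
  D * (sin t ^+ m - p) + (D - E * (1 + u)) * p +
  (E * (r * (t - delta t - k * t ^+ 3) * t ^+ m) - E * (u * (m%:R / 6 * t ^+ m.+2))).
  by rewrite /u /p exprD; ring.
have b1 : `|D * (sin t ^+ m - p)| <= C2 * (t ^+ (m + 4) * B).
  rewrite normrM (ger0_norm D0) mulrA [leRHS]mulrC ler_pM//.
  exact: sP (ltW t0) t4.
have b2 : `|(D - E * (1 + u)) * p| <= K ^+ 2 * (1 + 3 * m%:R) * (r ^+ 2 * t ^+ (m + 6) * B).
  have -> : D - E * (1 + u) = E * (expR u - 1 - u) by rewrite DE; ring.
  rewrite !normrM (ger0_norm E0).
  have h1 : E * `|expR u - 1 - u| <= (K * (r * t ^+ 3)) ^+ 2 * B.
    apply: (@le_trans _ _ (u ^+ 2 * D)).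
      by rewrite DE mulrCA ler_wpM2l// expR_taylor1.
    by apply: ler_pM => //; rewrite ?exprn_ge0// lerXn2r ?nnegrE// (le_trans u0).
  have h2 := sin_pow_poly_ub m (ltW t0) t4.
  apply: le_trans (ler_pM _ _ h1 h2) _ => //; first by rewrite mulr_ge0.
  by rewrite le_eqVlt; apply/orP; left; apply/eqP; rewrite !exprD !exprMn; ring.
have b3 : `|E * (r * (t - delta t - k * t ^+ 3) * t ^+ m)| <= C * (r * t ^+ (m + 5) * B).
  rewrite normrM (ger0_norm E0) !normrM (ger0_norm (ltW r0)) (ger0_norm (tn m)).
  apply: (@le_trans _ _ (B * (r * (C * t ^+ 5) * t ^+ m))).
    apply: ler_pM => //.
      by apply: mulr_ge0 => //; apply: mulr_ge0; [exact: ltW|exact: normr_ge0].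
    by apply: ler_wpM2r => //; apply: ler_wpM2l => //; exact: ltW.
  by rewrite le_eqVlt; apply/orP; left; apply/eqP; rewrite !exprD; ring.
have b4 : `|E * (u * (m%:R / 6 * t ^+ m.+2))| <= K * m%:R * (r * t ^+ (m + 5) * B).
  have m6 : 0 <= m%:R / 6 * t ^+ m.+2 by apply: mulr_ge0; [exact: divr_ge0|exact: tn].
  rewrite ger0_norm; last by apply: mulr_ge0 => //; exact: mulr_ge0.
  apply: (@le_trans _ _ (B * (K * (r * t ^+ 3) * (m%:R * t ^+ m.+2)))).
    apply: ler_pM => //; first exact: mulr_ge0.
    apply: ler_pM => //; apply: ler_wpM2r; first exact: tn.
    by rewrite ler_pdivrMr// ler_peMr//; lra.
  by rewrite le_eqVlt; apply/orP; left; apply/eqP; rewrite -(addn2 m) !exprD; ring.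
apply: le_trans (ler_normD _ _) _.
apply: le_trans (lerD (ler_normD _ _) (ler_normB _ _)) _.
apply: le_trans (lerD (lerD b1 b2) (lerD b3 b4)) _.
set a := t ^+ (m + 4); set b := r * t ^+ (m + 5).
set c := r ^+ 2 * t ^+ (m + 6).
have a0 : 0 <= a * B by rewrite mulr_ge0//; exact: tn.
have b0 : 0 <= b * B by rewrite mulr_ge0//; exact: rt.
have c0 : 0 <= c * B by rewrite mulr_ge0//; exact: rrt.
have q0 : 0 <= K ^+ 2 * (1 + 3 * m%:R) by rewrite mulr_ge0 ?exprn_ge0 ?addr_ge0 ?mulr_ge0.
set Q := K ^+ 2 * _ in q0 *.
have Km0 : 0 <= K * m%:R by rewrite mulr_ge0.
set Km := K * _ in Km0 *.
have -> : (a + b + c) * B = a * B + b * B + c * B by ring.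
set aB := a * B in a0 *; set bB := b * B in b0 *; set cB := c * B in c0 *.
rewrite -subr_ge0.
have -> : (C2 + Q + C + Km + 1 + m%:R + k) * (aB + bB + cB) -
   (C2 * aB + Q * cB + (C * bB + Km * bB)) =
   (Q + C + Km + 1 + m%:R + k) * aB + (C2 + Q + 1 + m%:R + k) * bB +
   (C2 + C + Km + 1 + m%:R + k) * cB by ring.
by rewrite !addr_ge0// mulr_ge0// !addr_ge0.
Qed.

Definition laplace_integral delta m r : \bar R :=
  (\int[mu]_(t in `]0%R, pi[) (expR (- (r * delta t)) * sin t ^+ m)%R%:E)%E.

(** The integrand is bounded below by a positive constant for [1 < t < 2], where
    [sin t >= t - t^3/6 >= t/3]. *)
Lemma laplace_integral_gt0 delta m r : 0 <= r -> measurable_fun setT delta ->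
  (forall t, 0 < t -> t < pi -> delta t <= t) -> (0 < laplace_integral delta m r)%E.
Proof.
move=> r0 md dle; have pi2 := pi_ge2 R.
have s0 t : 0 < t -> t < pi -> 0 <= sin t by move=> *; rewrite sin_ge0_pi// !ltW.
have mf D : measurable_fun D (fun t => expR (- (r * delta t)) * sin t ^+ m).
  apply: measurable_funTS; apply: measurable_funM.
    apply: (measurableT_comp (@measurable_expR R)); apply: measurable_funN.
    exact: measurable_funM.
  by apply: measurable_funX; apply: continuous_measurable_fun; exact: continuous_sin.
apply: (@lt_le_trans _ _ (\int[mu]_(t in `]1%R, 2%R[) (cst (expR (- (r * 2)) * 3^-1 ^+ m)%R%:E t))%E).
  rewrite integral_cst//= lebesgue_measure_itv /= lte_fin ltr1n.
  rewrite -EFinB -EFinM lte_fin !mulr_gt0 ?expR_gt0 ?exprn_gt0//; lra.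
apply: (@le_trans _ _ (\int[mu]_(t in `]1%R, 2%R[) (expR (- (r * delta t)) * sin t ^+ m)%R%:E)%E).
  apply: ge0_le_integral => //.
  - by move=> t _; rewrite lee_fin mulr_ge0 ?expR_ge0 ?exprn_ge0.
  - by apply/measurable_EFinP; exact: mf.
  - move=> t /=; rewrite in_itv/= => /andP[t1 t2]; rewrite lee_fin.
    have t0 : 0 < t by lra.
    have tp : t < pi by lra.
    apply: ler_pM; rewrite ?expR_ge0 ?exprn_ge0//.
      by rewrite ler_expR lerN2 ler_wpM2l// (le_trans (dle _ t0 tp))// ltW.
    rewrite lerXn2r ?nnegrE ?s0//.
    apply: le_trans (sin_ge_cubic (ltW t0)).
    have : t ^+ 3 <= 4 * t.
      by rewrite exprSr ler_wpM2r ?(ltW t0)// (_ : 4 = 2 ^+ 2); [rewrite ler_sqr ?nnegrE ?(ltW t0)//; lra|ring].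
    lra.
rewrite /laplace_integral; apply: ge0_subset_integral => //.
- by apply/measurable_EFinP; exact: mf.
- move=> t /=; rewrite in_itv/= => /andP[t0 tp].
  by rewrite lee_fin mulr_ge0 ?expR_ge0// exprn_ge0// s0.
- move=> t /=; rewrite !in_itv/= => /andP[t1 t2]; apply/andP; split; lra.
Qed.

(** The three explicit terms of [laplace_integrand] are gamma integrals and give
    the coefficient; so is the error term, with [r / 3] for [r]. *)
Lemma laplace_integral_asymptotics delta k C m :
  0 <= k -> 0 <= C -> near_identity delta k C -> measurable_fun setT delta ->
  exists2 C2, 0 <= C2 & forall r, 0 < r ->
    exists2 J, laplace_integral delta m r = J%:E &
      `|r ^+ m.+1 * J / m`!%:R -
        (1 - m.+1%:R * m.+2%:R * (m%:R / 6 - k * m.+3%:R) * r ^- 2)| <= C2 * r ^- 4.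
Proof.
move=> k0 C0 dP md.
have [C1 C10 bound] := laplace_integrand m k0 C0 dP.
have m0 : 0 <= m%:R :> R by [].
(* The gamma integrals of the error term, for decay rate [r / 3]. *)
pose D0 : R := (m + 4)`!%:R * 3 ^+ (m + 5) + (m + 5)`!%:R * 3 ^+ (m + 6) +
  (m + 6)`!%:R * 3 ^+ (m + 7).
have D00 : 0 <= D0 by rewrite !addr_ge0 ?mulr_ge0 ?exprn_ge0.
exists (C1 * D0 / m`!%:R) => [|r r0]; first by rewrite divr_ge0 ?mulr_ge0.
pose f t := if t < pi then expR (- (r * delta t)) * sin t ^+ m else 0.
pose e j a t : R := t ^+ j * expR (- (a * t)).
have e0 j a t : 0 < t -> 0 <= e j a t.
  by move=> t0; rewrite mulr_ge0 ?expR_ge0// exprn_ge0// ltW.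
have me j a D : measurable_fun D (e j a).
  apply: measurable_funTS; apply: measurable_funM; first exact: measurable_funX.
  apply: (measurableT_comp (@measurable_expR R)); apply: measurable_funN.
  exact: measurable_funM.
have Ie j a : 0 < a -> (\int[mu]_(t in `]0%R, +oo[) (e j a t)%:E =
   (j`!%:R / a ^+ j.+1)%:E)%E by exact: integral_gamma.
have f0 t : 0 < t -> 0 <= f t.
  rewrite /f => t0; case: ltP => // tp; rewrite mulr_ge0 ?expR_ge0// exprn_ge0//.
  by rewrite sin_ge0_pi// !ltW.
have mf : measurable_fun setT f.
  apply: measurable_fun_ifT.
  - by apply: measurable_fun_ltr.
  - apply: measurable_funM.
      apply: (measurableT_comp (@measurable_expR R)); apply: measurable_funN.
      exact: measurable_funM.
    by apply: measurable_funX; apply: continuous_measurable_fun; exact: continuous_sin.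
  - exact: measurable_cst.
set I := laplace_integral delta m r.
have IE : I = (\int[mu]_(t in `]0%R, +oo[) (f t)%:E)%E.
  rewrite /I /laplace_integral integral_mkcond [RHS]integral_mkcond.
  apply: eq_integral => t _; rewrite !patchE !mem_setE !in_itv/= andbT /f.
  by case: (0 < t) => //=; case: (t < pi).
pose P := [set` `]0%R : R, +oo[].
have mP : measurable P by exact: measurable_itv.
have ID (u v : R -> R) : (forall t, P t -> 0 <= u t) -> (forall t, P t -> 0 <= v t) ->
   measurable_fun P u -> measurable_fun P v ->
   (\int[mu]_(t in P) (u t + v t)%R%:E = \int[mu]_(t in P) (u t)%:E + \int[mu]_(t in P) (v t)%:E)%E.
  move=> u0 v0 mu' mv'; under eq_integral do rewrite EFinD.
  by rewrite ge0_integralD//; try exact/measurable_EFinP.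
have P0 t : P t -> 0 < t by rewrite /P /= in_itv/= andbT.
(* The main term is [g1 - g2] and the error is at most [h]. Keeping [g1] and
   [g2] apart, only integrals of nonnegative functions are compared. *)
pose g1 t := e m r t + k * r * e (m + 3) r t.
pose g2 t := m%:R / 6 * e m.+2 r t.
pose h t := C1 * (e (m + 4) (r / 3) t + (r * e (m + 5) (r / 3) t + r ^+ 2 * e (m + 6) (r / 3) t)).
have kr0 : 0 <= k * r by rewrite mulr_ge0// ltW.
have m60 : 0 <= m%:R / 6 :> R by rewrite divr_ge0.
have r20 : 0 <= r ^+ 2 by rewrite exprn_ge0// ltW.
pose G1 := m`!%:R / r ^+ m.+1 + k * r * ((m + 3)`!%:R / r ^+ (m + 3).+1).
pose G2 := m%:R / 6 * (m.+2`!%:R / r ^+ m.+3).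
pose a := r / 3. have a0 : 0 < a by rewrite divr_gt0.
pose H := C1 * ((m + 4)`!%:R / a ^+ (m + 4).+1 + (r * ((m + 5)`!%:R / a ^+ (m + 5).+1) +
  r ^+ 2 * ((m + 6)`!%:R / a ^+ (m + 6).+1))).
have eP j b t : P t -> 0 <= e j b t by move=> /P0; exact: e0.
have ceP c j b t : 0 <= c -> P t -> 0 <= c * e j b t by move=> c0 Pt; rewrite mulr_ge0// eP.
have mce c j b D : measurable_fun D (fun t => c * e j b t).
  by apply: measurable_funM => //; exact: me.
have Ice c j b : 0 <= c -> 0 < b ->
    (\int[mu]_(t in P) (c * e j b t)%R%:E = (c * (j`!%:R / b ^+ j.+1))%:E)%E.
  by move=> c0 b0; rewrite (ge0_integralMl mu mP (me _ _ _) (eP _ _) c0) Ie.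
have r00 : 0 <= r := ltW r0.
have IG1 : (\int[mu]_(t in P) (g1 t)%:E = G1%:E)%E.
  rewrite (ID (e m r) (fun t => k * r * e (m + 3) r t) (eP _ _)
    (fun t => ceP _ _ _ t kr0) (me _ _ _) (mce _ _ _ _)).
  by rewrite Ie// Ice.
have IG2 : (\int[mu]_(t in P) (g2 t)%:E = G2%:E)%E by exact: Ice.
pose h1 t := r * e (m + 5) a t + r ^+ 2 * e (m + 6) a t.
have h1P t : P t -> 0 <= h1 t by move=> Pt; rewrite addr_ge0// ceP.
have mh1 : measurable_fun P h1 by exact: measurable_funD.
pose h2 t := e (m + 4) a t + h1 t.
have h2P t : P t -> 0 <= h2 t by move=> Pt; rewrite addr_ge0 ?eP ?h1P.
have mh2 : measurable_fun P h2 by apply: measurable_funD => //; exact: me.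
have IH : (\int[mu]_(t in P) (h t)%:E = H%:E)%E.
  rewrite (ge0_integralMl mu mP mh2)//.
  rewrite (ID (e (m + 4) a) h1 (eP _ _) h1P (me _ _ _) mh1).
  rewrite (ID (fun t => r * e (m + 5) a t) (fun t => r ^+ 2 * e (m + 6) a t)
    (fun t => ceP _ _ _ t r00) (fun t => ceP _ _ _ t r20) (mce _ _ _ _) (mce _ _ _ _)).
  by rewrite Ie// !Ice.
have mfP : measurable_fun P f by exact: measurable_funTS.
have g10 t : P t -> 0 <= g1 t by move=> Pt; rewrite addr_ge0 ?eP ?ceP.
have g20 t : P t -> 0 <= g2 t by move=> Pt; exact: ceP.
have h00 t : P t -> 0 <= h t by move=> Pt; rewrite mulr_ge0// h2P.
have mg1 : measurable_fun P g1 by apply: measurable_funD => //; exact: me.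
have mg2 : measurable_fun P g2 by exact: mce.
have mh : measurable_fun P h by exact: measurable_funM.
have fP t : P t -> 0 <= f t by move=> /P0; exact: f0.
have key t : P t -> `|f t - (g1 t - g2 t)| <= h t.
  move=> /P0 t0; have := bound r t r0 t0.
  rewrite -/(f t) /h /e -/a; congr (`|f t - _| <= _); last by ring.
  by rewrite /g1 /g2 /e; ring.
have up : (I + G2%:E <= G1%:E + H%:E)%E.
  rewrite IE -IG1 -IG2 -IH -!ID//; apply: ge0_le_integral => //.
  - by move=> t Pt; rewrite lee_fin addr_ge0 ?fP ?g20.
  - by apply/measurable_EFinP; exact: measurable_funD.
  - by apply/measurable_EFinP; exact: measurable_funD.
  - move=> t Pt; rewrite lee_fin; have := key t Pt; rewrite ler_norml => /andP[_]; lra.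
have lo : (G1%:E <= I + G2%:E + H%:E)%E.
  have f20 t : P t -> 0 <= f t + g2 t by move=> Pt; rewrite addr_ge0 ?fP ?g20.
  have mf2 : measurable_fun P (fun t => f t + g2 t) by exact: measurable_funD.
  rewrite IE -IG1 -IG2 -IH -!ID//; apply: ge0_le_integral => //.
  - by apply/measurable_EFinP.
  - by apply/measurable_EFinP; exact: measurable_funD.
  - move=> t Pt; rewrite lee_fin; have := key t Pt; rewrite ler_norml => /andP[+ _]; lra.
have I0 : (0 <= I)%E by rewrite IE; apply: integral_ge0 => t Pt; rewrite lee_fin fP.
have Ifin : I \is a fin_num.
  rewrite ge0_fin_numE// (le_lt_trans _ (ltry (G1 + H)))// EFinD (le_trans _ up)//.
  rewrite leeDl// lee_fin mulr_ge0// divr_ge0// exprn_ge0//.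
exists (fine I); first by rewrite fineK.
move: up lo; rewrite -{1 2}(fineK Ifin) -!EFinD !lee_fin.
move: (fine I) => J up lo.
have rm j : r ^+ j != 0 by rewrite expf_neq0 ?gt_eqF.
have mf0 : 0 < m`!%:R :> R by rewrite ltr0n fact_gt0.
have -> : r ^+ m.+1 * J / m`!%:R -
    (1 - m.+1%:R * m.+2%:R * (m%:R / 6 - k * m.+3%:R) * r ^- 2) =
  r ^+ m.+1 / m`!%:R * (J + G2 - G1).
  have N1 : m.+1%:R = m%:R + 1 :> R by rewrite -addn1 natrD.
  have N2 : m.+2%:R = m%:R + 2 :> R by rewrite -addn2 natrD.
  have N3 : m.+3%:R = m%:R + 3 :> R by rewrite -addn3 natrD.
  have F2 : m.+2`!%:R = (m%:R + 2) * (m%:R + 1) * m`!%:R :> R.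
    by rewrite !factS !natrM N1 N2 mulrA.
  have F3 : (m + 3)`!%:R = (m%:R + 3) * (m%:R + 2) * (m%:R + 1) * m`!%:R :> R.
    by rewrite addn3 factS natrM F2 N3 !mulrA.
  rewrite /G1 /G2 F2 F3 N1 N2 N3 -addnS !exprD.
  have -> : r ^+ m.+3 = r ^+ 3 * r ^+ m by rewrite -exprD addnC addn3.
  rewrite [r ^+ m.+1]exprS.
  by field; rewrite ?rm ?gt_eqF.
have HE : H = C1 * D0 / r ^+ (m + 5).
  rewrite /H /D0 /a !expr_div_n -!addnS !exprD.
  by field; rewrite ?rm ?gt_eqF ?expf_neq0.
rewrite normrM ger0_norm; last by rewrite divr_ge0// exprn_ge0.
have JH : `|J + G2 - G1| <= H by rewrite ler_norml; apply/andP; split; lra.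
apply: le_trans (ler_wpM2l _ JH) _; first by rewrite divr_ge0// exprn_ge0.
rewrite HE le_eqVlt; apply/orP; left; apply/eqP.
rewrite -(addn1 m) !exprD.
by field; rewrite ?rm ?gt_eqF.
Qed.

End laplace.

(** * Angles on the sphere and the intrinsic distance *)

Local Notation edist := Defs.edist.

Section dot.
Context {R : realType} {n : nat}.
Implicit Types x y z : 'rV[R]_n.

Definition dot x y : R := \sum_(i < n) x ord0 i * y ord0 i.

Lemma sqnormE x : sqnorm x = dot x x.
Proof. by apply: eq_bigr => i _; rewrite expr2. Qed.

Lemma dotC x y : dot x y = dot y x.
Proof. by apply: eq_bigr => i _; rewrite mulrC. Qed.

Lemma dotDl x y z : dot (x + y) z = dot x z + dot y z.
Proof. by rewrite /dot -big_split; apply: eq_bigr => i _; rewrite mxE mulrDl. Qed.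

Lemma dotZl (a : R) x y : dot (a *: x) y = a * dot x y.
Proof. by rewrite /dot mulr_sumr; apply: eq_bigr => i _; rewrite mxE mulrA. Qed.

Lemma dotNl x y : dot (- x) y = - dot x y.
Proof. by rewrite -scaleN1r dotZl mulN1r. Qed.

Lemma dotDr x y z : dot z (x + y) = dot z x + dot z y.
Proof. by rewrite dotC dotDl !(dotC z). Qed.

Lemma dotZr (a : R) x y : dot x (a *: y) = a * dot x y.
Proof. by rewrite dotC dotZl dotC. Qed.

Lemma dotNr x y : dot x (- y) = - dot x y.
Proof. by rewrite dotC dotNl dotC. Qed.

Definition dotE := (dotDl, dotDr, dotZl, dotZr, dotNl, dotNr).

Lemma sqnorm_ge0 x : 0 <= sqnorm x.
Proof. by apply: sumr_ge0 => i _; exact: sqr_ge0. Qed.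

Lemma sqnorm_eq0 x : (sqnorm x == 0) = (x == 0).
Proof.
apply/idP/eqP => [|->]; last first.
  by rewrite /sqnorm big1// => i _; rewrite mxE expr0n.
rewrite psumr_eq0; last by move=> i _; exact: sqr_ge0.
move=> /allP x0; apply/rowP => i; rewrite mxE.
by have := x0 i (mem_index_enum _); rewrite sqrf_eq0 => /eqP.
Qed.

Lemma sqnormB x y : sqnorm (x - y) = sqnorm x - 2 * dot x y + sqnorm y.
Proof. by rewrite !sqnormE !dotE (dotC y x); ring. Qed.

Lemma cauchy_schwarz x y : dot x y ^+ 2 <= sqnorm x * sqnorm y.
Proof.
have [->|y0] := eqVneq y 0.
  by rewrite -[0](scale0r 0) dotZr mul0r expr0n /= mulr_ge0// sqnorm_ge0.
have Y0 : 0 < sqnorm y by rewrite lt_neqAle sqnorm_ge0 eq_sym sqnorm_eq0 y0.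
have := sqnorm_ge0 (sqnorm y *: x - dot x y *: y).
have -> : sqnorm (sqnorm y *: x - dot x y *: y) =
    sqnorm y * (sqnorm x * sqnorm y - dot x y ^+ 2).
  by rewrite !sqnormE !dotE (dotC y x); ring.
by rewrite pmulr_rge0// subr_ge0.
Qed.

End dot.

Section angle.
Context {R : realType} {n : nat} (r : R).
Hypothesis r0 : 0 < r.
Implicit Types x y z : 'rV[R]_n.

Definition angle x y : R := acos (dot x y / r ^+ 2).

Let r20 : 0 < r ^+ 2. Proof. by rewrite exprn_gt0. Qed.

Lemma dot_sphere_itv x y : sqnorm x = r ^+ 2 -> sqnorm y = r ^+ 2 ->
  -1 <= dot x y / r ^+ 2 <= 1.
Proof.
move=> sx sy; rewrite ler_pdivlMr// ler_pdivrMr//.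
have := sqnorm_ge0 (x - y); have := sqnorm_ge0 (x - (- y)).
rewrite !sqnormB dotNr [sqnorm (- y)]sqnormE dotNl dotNr opprK -sqnormE sx sy => h1 h2.
by apply/andP; split; lra.
Qed.

Lemma cos_angle x y : sqnorm x = r ^+ 2 -> sqnorm y = r ^+ 2 ->
  cos (angle x y) = dot x y / r ^+ 2.
Proof. by move=> sx sy; rewrite acosK// in_itv/= dot_sphere_itv. Qed.

Lemma angle_itv x y : sqnorm x = r ^+ 2 -> sqnorm y = r ^+ 2 ->
  0 <= angle x y <= pi.
Proof.
by move=> sx sy; have h := dot_sphere_itv sx sy; rewrite acos_ge0// acos_lepi.
Qed.

Lemma sqr_sin_half (a : R) : 1 - cos a = 2 * sin (a / 2) ^+ 2.
Proof.
have {1}-> : a = a / 2 + a / 2 by field.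
rewrite cosD -!expr2; have := cos2Dsin2 (a / 2); lra.
Qed.

Lemma edist_angle x y : sqnorm x = r ^+ 2 -> sqnorm y = r ^+ 2 ->
  edist x y = 2 * r * sin (angle x y / 2).
Proof.
move=> sx sy; have /andP[a0 api] := angle_itv sx sy.
rewrite /edist sqnormB sx sy.
have -> : r ^+ 2 - 2 * dot x y + r ^+ 2 = (2 * r * sin (angle x y / 2)) ^+ 2.
  rewrite exprMn [(2 * r) ^+ 2]exprMn.
  have := sqr_sin_half (angle x y); rewrite cos_angle// => h.
  have -> : 2 ^+ 2 * r ^+ 2 * sin (angle x y / 2) ^+ 2 =
    2 * r ^+ 2 * (2 * sin (angle x y / 2) ^+ 2) by ring.
  by rewrite -h; field; rewrite gt_eqF.
rewrite sqrtr_sqr ger0_norm//; apply: mulr_ge0; first by rewrite mulr_ge0// ltW.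
by apply: sin_ge0_pi; apply/andP; split; have := pi_gt0 R; lra.
Qed.

(** In terms of cosines this is the Cauchy-Schwarz inequality for the components
    of [x] and [z] that are orthogonal to [y]. *)
Lemma angle_triangle x y z :
  sqnorm x = r ^+ 2 -> sqnorm y = r ^+ 2 -> sqnorm z = r ^+ 2 ->
  angle x z <= angle x y + angle y z.
Proof.
move=> sx sy sz.
have /andP[a0 api] := angle_itv sx sy; have /andP[b0 bpi] := angle_itv sy sz.
have /andP[c0 cpi] := angle_itv sx sz.
have [h|h] := leP pi (angle x y + angle y z); first exact: le_trans h.
rewrite leNgt -ltr_cos ?in_itv/= ?c0 ?cpi ?addr_ge0 ?(ltW h)// -leNgt.
rewrite cosD !cos_angle//.
set X := dot x y / _; set Y := dot y z / _; set Z := dot x z / _.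
have sinE u v : sqnorm u = r ^+ 2 -> sqnorm v = r ^+ 2 ->
    sin (angle u v) = Num.sqrt (1 - (dot u v / r ^+ 2) ^+ 2).
  by move=> su sv; rewrite sin_acos// dot_sphere_itv.
rewrite !sinE// -/X -/Y.
have hX : 0 <= 1 - X ^+ 2.
  have := dot_sphere_itv sx sy; rewrite -/X => /andP[? ?]; nra.
have hY : 0 <= 1 - Y ^+ 2.
  have := dot_sphere_itv sy sz; rewrite -/Y => /andP[? ?]; nra.
rewrite -sqrtrM// lerBlDr -lerBlDl.
apply: le_trans (ler_norm _) _.
rewrite -sqrtr_sqr ler_sqrt; last by rewrite mulr_ge0.
have := cauchy_schwarz (x - X *: y) (z - Y *: y).
have rn : r != 0 by rewrite gt_eqF.
have xX : dot x y = X * r ^+ 2 by rewrite /X; field.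
have yY : dot y z = Y * r ^+ 2 by rewrite /Y; field.
have zZ : dot x z = Z * r ^+ 2 by rewrite /Z; field.
rewrite !sqnormE !dotE -!sqnormE (dotC y x) (dotC z y) sx sy sz xX yY zZ => cs.
have r40 : 0 < (r ^+ 2) ^+ 2 by rewrite exprn_gt0.
rewrite -(ler_pM2r r40); apply: le_trans (le_trans cs _).
  by rewrite le_eqVlt; apply/orP; left; apply/eqP; ring.
by rewrite le_eqVlt; apply/orP; left; apply/eqP; ring.
Qed.

(** The relative defect of a chord is quadratic in the angle, by
    [sin b >= b - b^3/6], and the angle is at most [3 e]. *)
Lemma chord_ge_arc x y e : sqnorm x = r ^+ 2 -> sqnorm y = r ^+ 2 ->
  0 < e -> e <= 1 -> edist x y <= e * r ->
  (1 - e) * (r * angle x y) <= edist x y.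
Proof.
move=> sx sy e0 e1; have /andP[a0 api] := angle_itv sx sy.
rewrite edist_angle//; set a := angle x y in a0 api *; set s := sin (a / 2) => h.
have pi4 := pihalf_lt2 R.
have s1 := @sin_ge_cubic R (a / 2).
have {s1} : a / 2 - (a / 2) ^+ 3 / 6 <= s by apply: s1; lra.
have -> : (a / 2) ^+ 3 = a / 2 * (a / 2) ^+ 2 by ring.
move=> s1.
have a4 : (a / 2) ^+ 2 <= 4 by nra.
have s2 : a <= 3 * e.
  have : a / 2 * (a / 2) ^+ 2 <= a / 2 * 4 by rewrite ler_wpM2l//; lra.
  have : 2 * s <= e by rewrite -(ler_pM2r r0); lra.
  lra.
have : (1 - e) * a <= 2 * s; last by move=> hh; have := ler_wpM2r (ltW r0) hh; lra.
have a2 : (a / 2) ^+ 2 <= 6 * e.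
  have : a * a <= 3 * e * 4 by rewrite ler_pM//; lra.
  rewrite expr_div_n; lra.
have : a / 2 * (a / 2) ^+ 2 <= a / 2 * (6 * e) by rewrite ler_wpM2l//; lra.
lra.
Qed.

End angle.

Section uniform_continuity.
Context {R : realType} {V : normedModType R}.

(** Heine's theorem; compactness is used in the form of a near-covering. *)
Lemma segment_unif_continuous (g : R -> V) (e : R) :
  {within `[0, 1], continuous g} -> 0 < e ->
  exists2 d : R, 0 < d & forall s t, 0 <= s <= 1 -> 0 <= t <= 1 ->
    `|s - t| < d -> `|g s - g t| < e.
Proof.
move=> /subspace_continuousP cg e0.
have := @segment_compact R 0 1; rewrite compact_near_coveringP => cov.
pose P (d s : R) := 0 <= s <= 1 -> forall t, 0 <= t <= 1 -> `|s - t| < d -> `|g s - g t| < e.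
have e20 : 0 < e / 2 by rewrite divr_gt0.
have /(cov R (0 : R)^'+ P) : forall x : R, `[0, 1]%classic x ->
    \forall x' \near x & d \near (0 : R)^'+, P d x'.
  move=> x x01.
  have := cg x x01 => /cvgrPdist_lt /(_ _ e20); rewrite near_withinE => -[/= rho rho0 H].
  have r2 : 0 < rho / 2 by rewrite divr_gt0.
  exists (ball x (rho / 2), [set d | 0 < d < rho / 2]) => /=.
    split; first exact: nbhsx_ballx.
    near=> d; apply/andP; split; near: d; first exact: nbhs_right_gt.
    exact: nbhs_right_lt.
  move=> [s d] /= [xs /andP[d0 dr]] s01 t t01 st.
  have gs : `|g x - g s| < e / 2.
    apply: H; last by rewrite /= in_itv.
    by apply: lt_le_trans xs _; lra.
  have gt : `|g x - g t| < e / 2.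
    apply: H; last by rewrite /= in_itv.
    rewrite /ball /= (_ : x - t = (x - s) + (s - t)); last by rewrite addrA subrK.
    apply: le_lt_trans (ler_normD _ _) _.
    by move: xs; rewrite /ball/= => xs; lra.
  have -> : g s - g t = (g x - g t) - (g x - g s) by rewrite opprB [RHS]addrC subrKA.
  by apply: le_lt_trans (ler_normB _ _) _; lra.
move=> H.
have : \forall d \near (0 : R)^'+, 0 < d /\ `[0, 1]%classic `<=` P d.
  by near=> d; split; near: d => //; exact: nbhs_right_gt.
move=> /filter_ex [d [d0 dP]].
exists d => // s t s01 t01; apply: dP => //; by rewrite /= in_itv.
Unshelve. all: by end_near. Qed.

End uniform_continuity.

Section intrinsic.
Context {R : realType} {n : nat} (r : R).
Hypothesis r0 : 0 < r.
Implicit Types x y z : 'rV[R]_n.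

Lemma edist_le_norm x y : edist x y <= Num.sqrt n%:R * `|x - y|.
Proof.
rewrite -[`|x - y|]ger0_norm// -sqrtr_sqr -sqrtrM// ler_sqrt; last by rewrite mulr_ge0// sqr_ge0.
have -> : n%:R * `|x - y| ^+ 2 = \sum_(i < n) `|x - y| ^+ 2.
  by rewrite sumr_const card_ord mulr_natl.
apply: ler_sum => i _.
rewrite -[leLHS]real_normK ?num_real// lerXn2r ?nnegrE//.
have /mapP[j Hj ->] : `|(x - y) ord0 i| \in [seq `|(x - y) p.1 p.2| | p : 'I_1 * 'I_n].
  by apply/mapP; exists (ord0, i) => //=; rewrite mem_enum.
by rewrite [leRHS]/Num.Def.normr /= mx_normrE; apply/bigmax_geP; right => /=; exists j.
Qed.

(** By uniform continuity all chords of a fine regular subdivision are short,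
    hence at least [1 - e] times their arcs, whose angles sum up to at least the
    angle between the ends. *)
Lemma path_length_ge_arc (g : R -> 'rV[R]_n) :
  {within `[0, 1], continuous g} ->
  (forall t : R, 0 <= t <= 1 -> sqnorm (g t) = r ^+ 2) ->
  ((r * angle r (g 0) (g 1))%:E <= path_length 0 1 g)%E.
Proof.
move=> cg gs.
have step (e : R) : 0 < e -> e <= 1 ->
    (((1 - e) * (r * angle r (g 0) (g 1)))%:E <= path_length 0 1 g)%E.
  move=> e0 e1.
  have c0 : 0 < e * r / (Num.sqrt n%:R + 1).
    by rewrite divr_gt0 ?mulr_gt0// ltr_wpDl// sqrtr_ge0.
  have [d d0 gd] := segment_unif_continuous cg c0.
  pose N := (Num.bound d^-1).+1.
  have Nd : N%:R^-1 < d.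
    rewrite -[d]invrK ltf_pV2 ?posrE ?invr_gt0//.
    have := archi_boundP (ltW (eqbRL (invr_gt0 d) d0)) => /lt_trans; apply.
    by rewrite ltr_nat.
  have N0 : 0 < N%:R :> R by [].
  pose s := [seq k%:R / N%:R | k <- iota 1 N] : seq R.
  have szs : size s = N by rewrite size_map size_iota.
  have nths k : (k <= N)%N -> nth 1 (0 :: s) k = k%:R / N%:R.
    case: k => [|k] kN /=; first by rewrite mul0r.
    by rewrite (nth_map 0%N) ?size_iota// nth_iota// add1n.
  have k01 k : (k <= N)%N -> 0 <= (k%:R / N%:R : R) <= 1.
    move=> kN; apply/andP; split; first exact: divr_ge0.
    by rewrite ler_pdivrMr// mul1r ler_nat.
  have ps : itv_partition 0 1 s.
    split.
      apply/(pathP 1) => k; rewrite szs => kN.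
      rewrite -[nth 1 s k]/(nth 1 (0 :: s) k.+1) !nths ?(ltnW kN)//.
      by rewrite ltr_pM2r ?invr_gt0// ltr_nat.
    by rewrite (last_nth 1) szs nths// divff// gt_eqF.
  apply: (@le_trans _ _ (polygonal_length 0 1 g s)%:E); last first.
    by apply: ereal_sup_ubound; exists s.
  rewrite lee_fin /polygonal_length szs.
  have tri m : (m <= N)%N ->
      angle r (g 0) (g (m%:R / N%:R)) <=
      \sum_(0 <= k < m) angle r (g (k%:R / N%:R)) (g (k.+1%:R / N%:R)).
    elim: m => [|m IH] mN.
      rewrite mul0r big_geq// /angle -sqnormE gs; last by lra.
      by rewrite divff ?acos1// expf_neq0// gt_eqF.
    rewrite big_nat_recr//=; apply: le_trans (lerD (IH (ltnW mN)) (lexx _)).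
    by apply: angle_triangle => //; apply: gs; [lra|exact/k01/ltnW|exact: k01].
  have := tri N (leqnn N); rewrite divff ?gt_eqF// => triN.
  apply: (@le_trans _ _ (\sum_(0 <= k < N) (1 - e) * (r * angle r (g (k%:R / N%:R)) (g (k.+1%:R / N%:R))))).
    rewrite -!mulr_sumr ler_wpM2l ?subr_ge0// ler_wpM2l// ltW//.
  rewrite big_nat_cond [leRHS]big_nat_cond; apply: ler_sum => k /andP[/andP[_ kN] _].
  rewrite [X in _ <= X](_ : _ = edist (g (k%:R / N%:R)) (g (k.+1%:R / N%:R))); last first.
    by rewrite /comp !nths// ltnW.
  have h1 := k01 k (ltnW kN); have h2 := k01 k.+1 kN.
  apply: chord_ge_arc => //; try exact: gs.
  apply: le_trans (edist_le_norm _ _) _.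
  have : `|g (k%:R / N%:R) - g (k.+1%:R / N%:R)| < e * r / (Num.sqrt n%:R + 1).
    apply: gd => //.
    have -> : k%:R / N%:R - k.+1%:R / N%:R = - N%:R^-1 :> R by rewrite -(natr1 k); ring.
    by rewrite normrN gtr0_norm// invr_gt0.
  rewrite ltr_pdivlMr ?ltr_wpDl ?sqrtr_ge0// mulrC => /ltW; apply: le_trans.
  by rewrite ler_wpM2r// lerDl.
apply/lee_addgt0Pr => e e0.
pose L := r * angle r (g 0) (g 1).
have L0 : 0 <= L.
  have /andP[a0 _] : 0 <= angle r (g 0) (g 1) <= pi by apply: angle_itv => //; apply: gs; lra.
  by rewrite mulr_ge0// ltW.
pose e' := Num.min 1 (e / (L + 1)).
have e'0 : 0 < e' by rewrite lt_min ltr01 divr_gt0// ltr_wpDl.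
have e'1 : e' <= 1 by rewrite ge_min lexx.
apply: (@le_trans _ _ (((1 - e') * L)%:E + e%:E)%E); last by rewrite leeD2r// step.
rewrite -EFinD lee_fin -/L.
have : e' * L <= e; last lra.
apply: (@le_trans _ _ (e / (L + 1) * L)); first by rewrite ler_wpM2r// ge_min lexx orbT.
by rewrite mulrAC ler_pdivrMr ?ltr_wpDl// ler_wpM2l ?ltW// ltrDl.
Qed.

(** For [v] orthogonal to [x] and of the same norm, this is the great circle from
    [x] in the direction of [v], run at angular speed [a]. *)
Definition great_circle (a : R) x v (t : R) : 'rV[R]_n := cos (a * t) *: x + sin (a * t) *: v.

Section great_circle.
Variables (a : R) (x v : 'rV[R]_n).
Hypotheses (a0 : 0 <= a) (sx : sqnorm x = r ^+ 2) (sv : sqnorm v = r ^+ 2).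
Hypothesis xv : dot x v = 0.

Let r20 : r ^+ 2 != 0. Proof. by rewrite expf_neq0// gt_eqF. Qed.

Lemma dot_great_circle s t :
  dot (great_circle a x v s) (great_circle a x v t) = r ^+ 2 * cos (a * t - a * s).
Proof.
rewrite /great_circle !dotE (dotC v x) xv -!sqnormE sx sv cosB; ring.
Qed.

Lemma sqnorm_great_circle t : sqnorm (great_circle a x v t) = r ^+ 2.
Proof. by rewrite sqnormE dot_great_circle subrr cos0 mulr1. Qed.

Lemma edist_great_circle s t : s <= t ->
  edist (great_circle a x v s) (great_circle a x v t) <= r * a * (t - s).
Proof.
move=> st; rewrite /edist sqnormB !sqnorm_great_circle dot_great_circle.
set b := a * t - a * s.
have b0 : 0 <= b by rewrite /b -mulrBr mulr_ge0// subr_ge0.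
have -> : r ^+ 2 - 2 * (r ^+ 2 * cos b) + r ^+ 2 = (2 * r * sin (b / 2)) ^+ 2.
  rewrite (_ : _ + _ = 2 * r ^+ 2 * (1 - cos b)); last by ring.
  by rewrite sqr_sin_half; ring.
have -> : r * a * (t - s) = r * b by rewrite /b; ring.
rewrite sqrtr_sqr normrM [`|2 * r|]gtr0_norm ?mulr_gt0//.
have : `|sin (b / 2)| <= b / 2; last first.
  by move=> h; have := ler_wpM2l (ltW (mulr_gt0 (ltr0n _ 2) r0)) h; lra.
have b20 : 0 <= b / 2 by rewrite divr_ge0.
rewrite ler_norml sin_le_id// andbT.
have := @sin_le_id R (b / 2) b20; have [b1|b1] := leP 1 (b / 2).
  by move=> _; rewrite (le_trans _ (sin_geN1 _))// lerN2.
move=> _; have := sin_ge_cubic b20.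
have : (b / 2) ^+ 3 <= 1 * (b / 2) by rewrite exprSr ler_wpM2r// expr_le1// ltW.
lra.
Qed.

Lemma continuous_great_circle : continuous (great_circle a x v).
Proof.
have cl (t : R) : (a * t') @[t' --> t] --> a * t by apply: cvgM; [exact: cvg_cst|exact: cvg_id].
move=> t; apply: cvgD; apply: cvgZr_tmp.
  exact: (continuous_comp (cl t) (@continuous_cos R _)).
exact: (continuous_comp (cl t) (@continuous_sin R _)).
Qed.

Lemma path_length_great_circle : (path_length 0 1 (great_circle a x v) <= (r * a)%:E)%E.
Proof.
apply: ge_ereal_sup => _ [s [ps /eqP ls] <-]; rewrite lee_fin /polygonal_length.
apply: (@le_trans _ _ (\sum_(0 <= k < size s) r * a * (nth 1 (0 :: s) k.+1 - nth 1 (0 :: s) k))).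
  rewrite big_nat_cond [leRHS]big_nat_cond; apply: ler_sum => k /andP[/andP[_ kN] _].
  apply: edist_great_circle.
  by move/(pathP 1) : ps => /(_ k kN) => /ltW.
rewrite -mulr_sumr telescope_sumr//.
by rewrite -(last_nth 1) ls /= subr0 mulr1.
Qed.

End great_circle.

End intrinsic.

Section intrinsic_dist.
Context {R : realType} {n : nat} (r : R).
Hypotheses (r0 : 0 < r) (n0 : (0 < n)%N).
Implicit Types x y z : 'rV[R]_n.+1.

(** The component orthogonal to [x] of a basis vector not parallel to [x]. *)
Lemma orthogonal_on_sphere x : sqnorm x = r ^+ 2 ->
  exists2 v : 'rV[R]_n.+1, sqnorm v = r ^+ 2 & dot x v = 0.
Proof.
move=> sx.
(* There are at least two coordinates, so that one of them is not extremal. *)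
have [i xi] : exists i : 'I_n.+1, x ord0 i ^+ 2 < r ^+ 2.
  apply/not_existsP => h.
  have h' i : r ^+ 2 <= x ord0 i ^+ 2 by rewrite leNgt; apply/negP; exact: h.
  have : \sum_(i < n.+1) r ^+ 2 <= sqnorm x by apply: ler_sum => i _; exact: h'.
  rewrite sx sumr_const card_ord -mulr_natl leNgt => /negP; apply.
  by rewrite ltr_pMl ?exprn_gt0// ltr1n.
pose w := r ^+ 2 *: delta_mx ord0 i - x ord0 i *: x.
have de z : dot z (delta_mx ord0 i) = z ord0 i.
  rewrite /dot (bigD1 i)//= mxE !eqxx mulr1 big1 ?addr0// => j ji.
  by rewrite mxE eqxx /= (negbTE ji) mulr0.
have xw : dot x w = 0 by rewrite /w !dotE de -sqnormE sx; ring.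
have sw : sqnorm w = r ^+ 2 * (r ^+ 2 - x ord0 i ^+ 2).
  rewrite /w sqnormE !dotE -(sqnormE x) sx (dotC _ x) !de mxE !eqxx /=; ring.
have w0 : 0 < r ^+ 2 - x ord0 i ^+ 2 by rewrite subr_gt0.
move: w xw sw => w xw sw.
exists ((Num.sqrt (r ^+ 2 - x ord0 i ^+ 2))^-1 *: w).
  rewrite sqnormE !dotE -sqnormE sw mulrA -invfM -expr2 sqr_sqrtr ?(ltW w0)//.
  by field; rewrite gt_eqF.
by rewrite dotZr xw mulr0.
Qed.

(** The direction is the normalized component of [y] orthogonal to [x]; when [y]
    is [x] or its antipode, every direction leads to [y]. *)
Lemma great_circle_through x y : sqnorm x = r ^+ 2 -> sqnorm y = r ^+ 2 ->
  exists v : 'rV[R]_n.+1, [/\ sqnorm v = r ^+ 2, dot x v = 0 &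
    y = cos (angle r x y) *: x + sin (angle r x y) *: v].
Proof.
move=> sx sy; set a := angle r x y.
have rn : r != 0 by rewrite gt_eqF.
have ca : dot x y = cos a * r ^+ 2 by rewrite cos_angle//; field.
have [sa|sa] := eqVneq (sin a) 0.
  have [v sv xv] := orthogonal_on_sphere sx; exists v; split=> //.
  rewrite sa scale0r addr0; apply/eqP; rewrite -subr_eq0 -sqnorm_eq0.
  have c2 : cos a ^+ 2 = 1 by have := cos2Dsin2 a; rewrite sa expr0n addr0.
  rewrite sqnormE !dotE -!sqnormE sx sy (dotC y x) ca.
  rewrite (_ : _ + _ = r ^+ 2 * (1 - cos a ^+ 2)); last by ring.
  by rewrite c2 subrr mulr0.
exists ((sin a)^-1 *: (y - cos a *: x)); split.
- rewrite sqnormE !dotE -!sqnormE sx sy (dotC y x) ca.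
  have s2 : sin a ^+ 2 = 1 - cos a ^+ 2 by rewrite -(cos2Dsin2 a); ring.
  rewrite (_ : _ * _ = r ^+ 2 * ((1 - cos a ^+ 2) / sin a ^+ 2)); last by field.
  by rewrite -s2 divff ?mulr1// expf_neq0.
- by rewrite !dotE -!sqnormE sx ca; ring.
- by rewrite scalerA divff// scale1r addrC subrK.
Qed.

(** The infimum is attained by an arc of great circle. *)
Lemma intrinsic_distE (x y : sphere n r) :
  intrinsic_dist x y = r * acos (dot (sval x) (sval y) / r ^+ 2).
Proof.
have sx : sqnorm (sval x) = r ^+ 2 by apply/eqP; exact: (svalP x).
have sy : sqnorm (sval y) = r ^+ 2 by apply/eqP; exact: (svalP y).
have [v [sv xv yE]] := great_circle_through sx sy.
set a := angle r (sval x) (sval y) in yE *.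
have /andP[a0 _] : 0 <= a <= pi by exact: angle_itv.
rewrite /intrinsic_dist -/(angle r _ _) -/a.
suff -> : ereal_inf [set path_length 0 1 g | g in sphere_paths x y] = (r * a)%:E by [].
apply/eqP; rewrite eq_le; apply/andP; split.
  apply: le_trans (path_length_great_circle r0 a0 sx sv xv).
  apply: ereal_inf_lbound; exists (great_circle a (sval x) v) => //; split.
  - exact/continuous_subspaceT/continuous_great_circle.
  - by move=> t _; rewrite /on_sphere (sqnorm_great_circle a sx sv xv).
  - by rewrite /great_circle mulr0 cos0 sin0 scale1r scale0r addr0.
  - by rewrite /great_circle mulr1 -yE.
apply: le_ereal_inf_tmp => _ [g [cg gs g0 g1] <-].
rewrite /a -g0 -g1; apply: path_length_ge_arc => // t t01.
by apply/eqP/gs; rewrite in_itv.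
Qed.

Lemma subspace_distE (x y : sphere n r) :
  subspace_dist x y = r * Num.sqrt (2 - 2 * (dot (sval x) (sval y) / r ^+ 2)).
Proof.
have sx : sqnorm (sval x) = r ^+ 2 by apply/eqP; exact: (svalP x).
have sy : sqnorm (sval y) = r ^+ 2 by apply/eqP; exact: (svalP y).
rewrite /subspace_dist; move: (sval x) (sval y) sx sy => u v su sv.
rewrite /Defs.edist sqnormB su sv.
have -> : r ^+ 2 - 2 * dot u v + r ^+ 2 = r ^+ 2 * (2 - 2 * (dot u v / r ^+ 2)).
  by field; rewrite gt_eqF.
by rewrite sqrtrM ?sqr_ge0// sqrtr_sqr gtr0_norm.
Qed.

(** Together with [intrinsic_le_subspace]: the two metrics have the same open
    sets, hence the same Borel sets. *)
Lemma subspace_le_intrinsic (x y : sphere n r) : subspace_dist x y <= intrinsic_dist x y.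
Proof.
have sx : sqnorm (sval x) = r ^+ 2 by apply/eqP; exact: (svalP x).
have sy : sqnorm (sval y) = r ^+ 2 by apply/eqP; exact: (svalP y).
rewrite intrinsic_distE /subspace_dist (edist_angle r0 sx sy) -/(angle r _ _).
have /andP[a0 _] := angle_itv r0 sx sy.
have h : sin (angle r (sval x) (sval y) / 2) <= angle r (sval x) (sval y) / 2.
  by apply: sin_le_id; rewrite divr_ge0.
by have := ler_wpM2l (ltW (mulr_gt0 (ltr0n _ 2) r0)) h; lra.
Qed.

Lemma intrinsic_le_subspace (x y : sphere n r) : intrinsic_dist x y <= 3 * subspace_dist x y.
Proof.
have sx : sqnorm (sval x) = r ^+ 2 by apply/eqP; exact: (svalP x).
have sy : sqnorm (sval y) = r ^+ 2 by apply/eqP; exact: (svalP y).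
rewrite intrinsic_distE /subspace_dist (edist_angle r0 sx sy) -/(angle r _ _).
have /andP[a0 api] := angle_itv r0 sx sy.
set a := angle _ _ _ in a0 api *; have p4 := pihalf_lt2 R.
have h := @sin_ge_cubic R (a / 2).
have {h} : a / 2 - (a / 2) ^+ 3 / 6 <= sin (a / 2) by apply: h; lra.
have h3 : (a / 2) ^+ 3 <= 4 * (a / 2).
  rewrite exprSr ler_wpM2r//; first by lra.
  by rewrite (_ : 4 = 2 ^+ 2); [rewrite ler_sqr ?nnegrE; lra|ring].
move=> h; have {h h3} h : a <= 6 * sin (a / 2) by lra.
by have := ler_wpM2l (ltW r0) h; lra.
Qed.

End intrinsic_dist.

(** * The volume of the sphere *)

Section stereographic_jacobian.
Context {R : realType} {n : nat}.
Implicit Types u v w : 'rV[R]_n.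

Lemma differentiable_rV m (M : 'rV[R]_n -> 'rV[R]_m) u :
  (forall j, differentiable (fun w => M w ord0 j) u) -> differentiable M u.
Proof.
move=> dM.
have -> : M = \sum_(j < m) (fun w => M w ord0 j *: delta_mx ord0 j : 'rV[R]_m).
  apply/funext => w; rewrite fct_sumE; exact: row_sum_delta.
by apply: differentiable_sum => j; apply: differentiableZl.
Qed.

Lemma diff_rV m (M : 'rV[R]_n -> 'rV[R]_m) u v j : differentiable M u ->
  ('d M u v : 'rV[R]_m) ord0 j = 'D_v (fun w => M w ord0 j) u.
Proof.
move=> dM; rewrite -deriveE// derive_mx; first by rewrite mxE.
exact: diff_derivable.
Qed.

Lemma is_derive_coord u v j : is_derive u v (fun w : 'rV[R]_n => w ord0 j) (v ord0 j).
Proof.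
have dc : differentiable (fun w : 'rV[R]_n => w ord0 j) u by exact: differentiable_coord.
apply: DeriveDef; first exact: diff_derivable.
rewrite deriveE//.
have f_lin : linear (fun w : 'rV[R]_n => w ord0 j) by move=> k x y; rewrite !mxE.
pose f : {linear 'rV[R]_n -> R} := HB.pack (fun w : 'rV[R]_n => w ord0 j) (GRing.isLinear.Build _ _ _ _ _ f_lin).
rewrite (_ : (fun _ => _) = f)// diff_lin//.
exact: coord_continuous.
Qed.

Lemma differentiable_sqnorm u : differentiable (@sqnorm R n) u.
Proof.
have -> : @sqnorm R n = \sum_(i < n) (fun w : 'rV[R]_n => w ord0 i * w ord0 i).
  by apply/funext => w; rewrite fct_sumE /sqnorm; apply: eq_bigr => i _; rewrite expr2.
by apply: differentiable_sum => i; apply: differentiableM; exact: differentiable_coord.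
Qed.

Lemma is_derive_sqnorm u v : is_derive u v (@sqnorm R n) (2 * dot u v).
Proof.
have -> : @sqnorm R n = \sum_(i < n) (fun w : 'rV[R]_n => w ord0 i * w ord0 i).
  by apply/funext => w; rewrite fct_sumE /sqnorm; apply: eq_bigr => i _; rewrite expr2.
have H : is_derive u v (\sum_(i < n) (fun w : 'rV[R]_n => w ord0 i * w ord0 i)) _ :=
  is_derive_sum (fun i => is_deriveM (is_derive_coord u v i) (is_derive_coord u v i)).
apply: (is_derive_eq H).
rewrite /dot mulr_sumr; apply: eq_bigr => i _.
by rewrite -mulr2n -[in LHS]mulr_natl.
Qed.

Variable r : R.

Let q u : R := (sqnorm u + 1)^-1.

Let s1 u : sqnorm u + 1 != 0 :> R.
Proof. by rewrite gt_eqF// ltr_wpDl ?sqnorm_ge0. Qed.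

Let dq u : differentiable q u.
Proof.
apply: differentiableV => //; apply: differentiableD; first exact: differentiable_sqnorm.
exact: differentiable_cst.
Qed.

Let is_derive_q u v : is_derive u v q (- (2 * dot u v) * q u ^+ 2).
Proof.
apply: DeriveDef; first exact/diff_derivable/dq.
have H : is_derive u v (fun w : 'rV[R]_n => sqnorm w + 1) _ :=
  is_deriveD (is_derive_sqnorm u v) (is_derive_cst (1 : R) u v).
have V := @deriveV R _ (fun w : 'rV[R]_n => sqnorm w + 1) u v (s1 u)
  (@ex_derive _ _ _ _ _ _ _ H).
apply: (etrans V); rewrite (@derive_val _ _ _ _ _ _ _ H) addr0 /q exprVn.
by rewrite [LHS]mulNr mulNr mulrC.
Qed.

Let stereo0 u : stereographic r u ord0 (@lshift 1 n ord0 : 'I_n.+1) = r - 2 * r * q u.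
Proof. by rewrite /stereographic mxE row_mxEl mxE eqxx mulr1n /q; field. Qed.

Let stereoS u j : stereographic r u ord0 (@rshift 1 n j : 'I_n.+1) = 2 * r * (q u * u ord0 j).
Proof. by rewrite /stereographic mxE row_mxEr mxE /q; field. Qed.

Let is_derive_stereo0 u v :
  is_derive u v (fun w => stereographic r w ord0 (@lshift 1 n ord0 : 'I_n.+1))
    (4 * r * dot u v * q u ^+ 2).
Proof.
rewrite (_ : (fun w => _) = (fun w => r - 2 * r * q w)); last exact/funext/stereo0.
have H : is_derive u v (fun w => r - 2 * r * q w) _ :=
  is_deriveB (is_derive_cst r u v) (is_deriveM (is_derive_cst (2 * r : R) u v) (is_derive_q u v)).
apply: (is_derive_eq H); rewrite scaler0 addr0 sub0r.
transitivity (- (2 * r * (- (2 * dot u v) * q u ^+ 2))) => //; ring.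
Qed.

Let is_derive_stereoS u v j :
  is_derive u v (fun w => stereographic r w ord0 (@rshift 1 n j : 'I_n.+1))
    (2 * r * (q u * v ord0 j - 2 * dot u v * q u ^+ 2 * u ord0 j)).
Proof.
rewrite (_ : (fun w => _) = (fun w => 2 * r * (q w * w ord0 j))); last by apply/funext => z; exact: stereoS.
have H : is_derive u v (fun w => 2 * r * (q w * w ord0 j)) _ :=
  is_deriveM (is_derive_cst (2 * r : R) u v) (is_deriveM (is_derive_q u v) (is_derive_coord u v j)).
apply: (is_derive_eq H); rewrite scaler0 addr0.
transitivity (2 * r * (q u * v ord0 j + u ord0 j * (- (2 * dot u v) * q u ^+ 2))) => //; ring.
Qed.

Lemma differentiable_stereographic u : differentiable (@stereographic R n r) u.
Proof.
apply: differentiable_rV => j.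
case: (@splitP 1 n j) => k jk.
  have -> : j = (@lshift 1 n ord0 : 'I_n.+1) by apply: val_inj; rewrite /= jk ord1.
  have -> : (fun w : 'rV[R]_n => stereographic r w ord0 (@lshift 1 n ord0 : 'I_n.+1)) =
    (fun w => r - 2 * r * q w) by apply/funext => z; exact: stereo0.
  apply: differentiableB; first exact: differentiable_cst.
  by apply: differentiableM; [exact: differentiable_cst|exact: dq].
have -> : j = (@rshift 1 n k : 'I_n.+1) by exact: val_inj.
have -> : (fun w : 'rV[R]_n => stereographic r w ord0 (@rshift 1 n k : 'I_n.+1)) =
  (fun w => 2 * r * (q w * w ord0 k)) by apply/funext => z; exact: stereoS.
apply: differentiableM; first exact: differentiable_cst.
by apply: differentiableM; [exact: dq|exact: differentiable_coord].
Qed.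

(** Stereographic projection is conformal. With [q = (|u|^2 + 1)^-1] its
    components are [r - 2 r q] and [2 r q u_j], and the terms of the product that
    are not multiples of [dot v w] cancel because [|u|^2 = q^-1 - 1]. *)
Lemma dot_diff_stereographic u v w :
  dot ('d (@stereographic R n r) u v : 'rV[R]_(1 + n)) ('d (@stereographic R n r) u w) =
  (2 * r / (sqnorm u + 1)) ^+ 2 * dot v w.
Proof.
have ds := differentiable_stereographic u.
rewrite /dot big_split_ord/= big_ord1 !diff_rV//.
rewrite !(@derive_val _ _ _ _ _ _ _ (is_derive_stereo0 u _)).
under eq_bigr do rewrite !diff_rV// !(@derive_val _ _ _ _ _ _ _ (is_derive_stereoS u _ _)).
rewrite -/(q u).
have -> : \sum_(i < n) 2 * r * (q u * v ord0 i - 2 * dot u v * q u ^+ 2 * u ord0 i) *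
    (2 * r * (q u * w ord0 i - 2 * dot u w * q u ^+ 2 * u ord0 i)) =
  dot ((2 * r) *: (q u *: v - (2 * dot u v * q u ^+ 2) *: u))
      ((2 * r) *: (q u *: w - (2 * dot u w * q u ^+ 2) *: u)).
  by apply: eq_bigr => i _; rewrite !mxE.
rewrite !dotE (dotC v u) -!sqnormE.
have -> : sqnorm u = (q u)^-1 - 1 by rewrite /q invrK addrK.
rewrite -/(dot v w); field.
by rewrite /q invr_eq0.
Qed.

Lemma gram_stereographic u :
  'J (@stereographic R n r) u *m ('J (@stereographic R n r) u)^T =
  ((2 * r / (sqnorm u + 1)) ^+ 2)%:M.
Proof.
apply/matrixP => i j; rewrite mxE.
transitivity (dot ('d (@stereographic R n r) u (delta_mx ord0 i) : 'rV[R]_(1 + n))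
  ('d (@stereographic R n r) u (delta_mx ord0 j))).
  by apply: eq_bigr => k _; rewrite !mxE.
rewrite dot_diff_stereographic /dot (bigD1 i)//= !mxE !eqxx mul1r big1 ?addr0.
  by rewrite andTb mulr_natr.
by move=> k ki; rewrite !mxE eqxx /= (negbTE ki) mul0r.
Qed.

End stereographic_jacobian.

(** By conformality the Jacobian is a power of the conformal factor, which is a
    radial function. *)
Lemma sphere_volumeE (R : realType) n (r : R) : 0 < r ->
  param_volume (@stereographic R n.+1 r) =
  ((n.+1%:R * unit_ball_volume R n.+1 * r ^+ n.+1)%:E *
    \int[@lebesgue_measure R]_(t in `]0%R, pi[) (sin t ^+ n)%R%:E)%E.
Proof.
move=> r0; rewrite unit_ball_volumeE -integral_conformal_factor//.
apply: eq_integral => t _; congr EFin.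
rewrite gram_stereographic det_scalar sqnorm_row_of_tuple -exprM mulnC exprM.
rewrite sqrtr_sqr ger0_norm//; apply: exprn_ge0; apply: divr_ge0.
  by apply: mulr_ge0 => //; exact: ltW.
by apply: addr_ge0 => //; exact: tdot_ge0.
Qed.

(** * Radial projection onto the sphere *)

Section tuple_topology.
Context {R : realType}.

(** An open set is the union of the boxes with rational centre, and with the
    inverse of an integer as radius, that it contains; there are countably many
    of these. *)
Lemma measurable_tuple_open n (W : set (Rtuple n R)) :
  (forall t, W t -> exists2 e : R, 0 < e &
     forall s : Rtuple n R, (forall i, `|tnth t i - tnth s i| < e) -> W s) ->
  measurable W.
Proof.
move=> Wop.
pose box (p : n.-tuple rat * nat) : set (Rtuple n R) :=
  [set s | forall i, `|ratr (tnth p.1 i) - tnth s i| < p.2.+1%:R^-1].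
have mbox p : measurable (box p).
  have -> : box p = \bigcap_(i in [set: 'I_n])
      (fun s : Rtuple n R => tnth s i) @^-1`
        (ball (ratr (tnth p.1 i) : R) p.2.+1%:R^-1).
    by apply/seteqP; split => [s ps i _|s ps i]; [exact: ps|exact: (ps i I)].
  apply: fin_bigcap_measurable => // i _; rewrite -[X in measurable X]setTI.
  have h := @measurable_tnth _ (measurableTypeR R) n i.
  apply: h => //; exact: measurable_ball.
pose F k : set (Rtuple n R) := if unpickle k is Some p then
  (if `[< box p `<=` W >] then box p else set0) else set0.
have -> : W = \bigcup_k F k.
  apply/seteqP; split => [t Wt|t [k _]]; last first.
    by rewrite /F; case: unpickle => // p; case: asboolP => // pW /pW.
  have [e e0 eW] := Wop t Wt.
  pose k := Num.bound (2 / e).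
  have ke : k.+1%:R^-1 < e / 2.
    rewrite -[e / 2]invf_div ltf_pV2 ?posrE ?divr_gt0//.
    rewrite (lt_trans (archi_boundP _)) ?divr_ge0 ?(ltW e0)//.
    by rewrite ltr_nat.
  have k0 : 0 < k.+1%:R^-1 :> R by rewrite invr_gt0.
  have qP i : exists q : rat, `|ratr q - tnth t i| < k.+1%:R^-1.
    have [q] : exists q : rat, ratr q \in
        `]tnth t i - k.+1%:R^-1, tnth t i + k.+1%:R^-1[.
      by apply: rat_in_itvoo; rewrite ltrBlDr -addrA ltrDl addr_gt0.
    by rewrite in_itv/= => h; exists q; rewrite distrC ltr_distlC.
  pose q := [tuple projT1 (cid (qP i)) | i < n].
  have qt i : `|ratr (tnth q i) - tnth t i| < k.+1%:R^-1.
    by rewrite tnth_mktuple; exact: projT2 (cid (qP i)).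
  exists (pickle (q, k)) => //; rewrite /F pickleK.
  case: asboolP => [_|nW]; first exact: qt.
  exfalso; apply: nW => s qs; apply: eW => i.
  apply: le_lt_trans (ler_distD (ratr (tnth q i)) _ _) _.
  rewrite distrC (splitr e) ltrD//; first exact: lt_trans (qt i) ke.
  exact: lt_trans (qs i) ke.
apply: bigcupT_measurable => k; rewrite /F.
by case: unpickle => // p; case: ifP.
Qed.

End tuple_topology.

Section radial_projection.
Context {R : realType} {n : nat} (r : R).
Hypothesis r0 : 0 < r.

Lemma tdotE (s t : Rtuple n.+1 R) : tdot s t = dot (row_of_tuple s) (row_of_tuple t).
Proof. by apply: eq_bigr => i _; rewrite !mxE. Qed.

Lemma on_sphere_normalized (t : Rtuple n.+1 R) : tdot t t != 0 ->
  on_sphere r ((r / Num.sqrt (tdot t t)) *: row_of_tuple t).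
Proof.
move=> t0; rewrite /on_sphere sqnormE !dotE -tdotE; apply/eqP.
by rewrite mulrA -expr2 expr_div_n sqr_sqrtr ?tdot_ge0//; field.
Qed.

Definition radial_projection (t : Rtuple n.+1 R) : sphere n r :=
  if pselect (tdot t t != 0) is left t0
  then exist (on_sphere r) _ (on_sphere_normalized t0) else point.

Lemma radial_projectionE t : tdot t t != 0 ->
  sval (radial_projection t) = (r / Num.sqrt (tdot t t)) *: row_of_tuple t.
Proof. by rewrite /radial_projection; case: pselect. Qed.

(** This is [2 |s| |t| <= |s|^2 + |t|^2] up to rearrangement. *)
Lemma subspace_dist_radial_projection s t : tdot s s != 0 -> tdot t t != 0 ->
  subspace_dist (radial_projection s) (radial_projection t) <=
  r * Num.sqrt (sqnorm (row_of_tuple s - row_of_tuple t) /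
                (Num.sqrt (tdot s s) * Num.sqrt (tdot t t))).
Proof.
move=> s0 t0; rewrite (subspace_distE r0) !radial_projectionE// !dotE.
rewrite ler_pM2l// ler_wsqrtr// sqnormB !sqnormE -!tdotE.
have pos (u : Rtuple n.+1 R) : tdot u u != 0 -> 0 < Num.sqrt (tdot u u).
  by move=> u0; rewrite sqrtr_gt0 lt_neqAle eq_sym u0 tdot_ge0.
have a0 := pos _ s0; have b0 := pos _ t0.
rewrite -[X in _ <= (X - _ + _) / _](sqr_sqrtr (tdot_ge0 s)).
rewrite -[X in _ <= (_ + X) / _](sqr_sqrtr (tdot_ge0 t)).
set a := Num.sqrt (tdot s s) in a0 *; set b := Num.sqrt (tdot t t) in b0 *.
rewrite ler_pdivlMr ?mulr_gt0//.
set D := tdot s t.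
have ne (u : R) : 0 < u -> u != 0 by move=> u0; rewrite gt_eqF.
rewrite [leLHS](_ : _ = 2 * (a * b) - 2 * D); last first.
  by field; rewrite !ne.
by have := sqr_ge0 (a - b); rewrite sqrrB; lra.
Qed.

Variables (d : sphere n r -> sphere n r -> R) (C : R).
Hypotheses (C0 : 0 < C) (dC : forall x y, d x y <= C * subspace_dist x y).

(** The projection is continuous away from the origin, which is a measurable
    point. *)
Lemma measurable_radial_projection :
  measurable_fun setT
    (radial_projection : _ -> g_sigma_algebraType (metric_open d)).
Proof.
apply: (@measurability _ _ _ (g_sigma_algebraType (metric_open d)) setT _ (metric_open d)) => //.
move=> _ [U Uop <-]; rewrite setTI.
pose V := [set t : Rtuple n.+1 R | tdot t t != 0].
have -> : radial_projection @^-1` U =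
    (V `&` radial_projection @^-1` U) `|` (~` V `&` radial_projection @^-1` U).
  by rewrite -setIUl setUv setTI.
have mV : measurable (~` V).
  have -> : ~` V = tball 0.
    apply/seteqP; split => t; rewrite /V/= /tball /=.
      by move=> /negP; rewrite negbK => /eqP ->.
    by move=> t0; apply/negP; rewrite negbK eq_le t0 tdot_ge0.
  exact: measurable_tball.
apply: measurableU; last first.
  have [Up|Up] := pselect (U point).
    rewrite (_ : _ `&` _ = ~` V)//; apply/seteqP; split => [t []//|t Vt].
    by split => //=; rewrite /radial_projection; case: pselect.
  rewrite (_ : _ `&` _ = set0)//; apply/seteqP; split => // t [Vt] /=.
  by rewrite /radial_projection; case: pselect.
apply: measurable_tuple_open => t [/= t0 Ut].
have [e e0 eU] := Uop _ Ut.
have T0 : 0 < tdot t t by rewrite lt_neqAle eq_sym t0 tdot_ge0.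
(* If [|t - s|^2 < c], the first bound ensures [|s| >= |t| / 2] and then the
   second one ensures that the projections are at distance less than [e]. *)
pose c := Num.min (tdot t t / 4) ((e / (C * r)) ^+ 2 * tdot t t / 4).
have c0 : 0 < c.
  have eC : 0 < (e / (C * r)) ^+ 2 by rewrite exprn_gt0// divr_gt0// mulr_gt0.
  by rewrite lt_min !divr_gt0//; exact: mulr_gt0.
exists (Num.sqrt (c / n.+1%:R)) => [|s ts].
  by rewrite sqrtr_gt0 divr_gt0.
have sts : sqnorm (row_of_tuple t - row_of_tuple s) < c.
  have -> : c = \sum_(i < n.+1) c / n.+1%:R.
    by rewrite sumr_const card_ord -[RHS]mulr_natr divfK// pnatr_eq0.
  apply: ltr_sum => [|i _]; first by apply/hasP; exists ord0.
  rewrite !mxE -real_normK ?num_real// -[ltRHS]sqr_sqrtr ?divr_ge0 ?(ltW c0)//.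
  by rewrite ltrXn2r ?nnegrE ?sqrtr_ge0// ts.
have c1 : c <= tdot t t / 4 by rewrite ge_min lexx.
have c2 : c <= (e / (C * r)) ^+ 2 * tdot t t / 4 by rewrite ge_min lexx orbT.
have S0 : tdot t t / 4 <= tdot s s.
  have : 0 <= sqnorm (2 *: row_of_tuple s - row_of_tuple t) by exact: sqnorm_ge0.
  rewrite sqnormB in sts; rewrite sqnormB !sqnormE !dotE -!tdotE in sts *.
  rewrite [tdot t s]/tdot in sts; rewrite [tdot s t]/tdot.
  rewrite (eq_bigr (fun i => tnth t i * tnth s i)) => [|i _]; last exact: mulrC.
  lra.
have s0 : tdot s s != 0 by apply: lt0r_neq0; lra.
split => //=; apply: eU; apply: le_lt_trans (dC _ _) _.
apply: le_lt_trans (ler_wpM2l (ltW C0) (subspace_dist_radial_projection t0 s0)) _.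
have eC : 0 < e / (C * r) by rewrite divr_gt0// mulr_gt0.
rewrite mulrA -ltr_pdivlMl ?mulr_gt0// [ltRHS]mulrC.
rewrite -[ltRHS]gtr0_norm// -[ltRHS]sqrtr_sqr ltr_sqrt ?exprn_gt0//.
have ha : 0 < Num.sqrt (tdot t t) by rewrite sqrtr_gt0.
have hs : Num.sqrt (tdot t t) / 2 <= Num.sqrt (tdot s s).
  rewrite -[_ / 2]ger0_norm; last by rewrite divr_ge0// ltW.
  by rewrite -sqrtr_sqr expr_div_n sqr_sqrtr ?tdot_ge0// ler_wsqrtr// -natrX.
have hb : 0 < Num.sqrt (tdot s s) by apply: lt_le_trans hs; rewrite divr_gt0.
rewrite ltr_pdivrMr ?mulr_gt0//; apply: lt_le_trans sts _.
apply: le_trans c2 _; rewrite -mulrA ler_wpM2l ?sqr_ge0//.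
rewrite -[X in X / _](sqr_sqrtr (tdot_ge0 t)).
set a := Num.sqrt (tdot t t) in ha hs *; set b := Num.sqrt (tdot s s) in hs hb *.
nra.
Qed.

End radial_projection.

(** * Weight measures and the magnitude of a metric space *)

Lemma jordan_decompE d (T : measurableType d) (R : realType)
    (nu : {charge set T -> \bar R}) P N (H : hahn_decomposition nu P N) A :
  measurable A -> nu A = (jordan_pos H A - jordan_neg H A)%E.
Proof.
move=> mA; rewrite (jordan_decomp H mA) -[in RHS]mulN1e; reflexivity.
Qed.

Section charge_integral.
Context d (T : measurableType d) {R : realType}.
Variables (mu : {finite_measure set T -> \bar R}) (c : R) (f : T -> R).
Hypotheses (c0 : 0 <= c) (mf : measurable_fun setT f) (f0 : forall x, 0 <= f x).
Local Open Scope ereal_scope.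

(** Whatever the Hahn decomposition, the negative part of a nonnegative charge
    vanishes. *)
Lemma charge_integral_cscale :
  charge_integral (cscale c (charge_of_finite_measure mu)) (EFin \o f) =
  c%:E * \int[mu]_x (f x)%:E.
Proof.
pose nu : {charge set T -> \bar R} := cscale c (charge_of_finite_measure mu).
have nu0 A : 0 <= nu A.
  by rewrite /nu /= /cscale /charge_of_finite_measure mule_ge0.
have neg0 P N (H : hahn_decomposition nu P N) A : measurable A -> jordan_neg H A = 0.
  have [_ [mN negN] _ _] := H; move=> mA; rewrite jordan_negE cjordan_negE /crestr0 mem_set// /crestr.
  have mAN := measurableI _ _ mA mN.
  by apply/eqP; rewrite oppe_eq0 eq_le nu0 negN.
have posE P N (H : hahn_decomposition nu P N) A :
    measurable A -> jordan_pos H A = mscale (NngNum c0) mu A.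
  move=> mA; transitivity (nu A) => //.
  transitivity (jordan_pos H A - jordan_neg H A); first by rewrite neg0// oppe0 adde0.
  by rewrite (jordan_decompE H).
rewrite -/nu /charge_integral.
rewrite [X in _ - X](eq_measure_integral mzero) => [|A mA _]; last exact: neg0.
rewrite integral_measure_zero sube0.
rewrite (eq_measure_integral (mscale (NngNum c0) mu)) => [|A mA _]; last exact: posE.
rewrite ge0_integral_mscale//; first exact/measurable_EFinP.
by move=> x _; rewrite lee_fin.
Qed.

End charge_integral.

Section magnitude.
Context {R : realType} (T : pointedType) (d : T -> T -> R).
Local Notation TB := (g_sigma_algebraType (metric_open d)).
Variables (mu : {finite_measure set TB -> \bar R}) (c M : R).
Hypotheses (c0 : 0 < c) (muT : mu setT = M%:E).
Hypothesis dC : forall x y, d x y = d y x.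
Hypothesis mk : measurable_fun setT (fun p : TB * TB => expR (- d p.1 p.2)).
Hypothesis muc : forall y : TB, (\int[mu]_x (expR (- d x y))%:E = c%:E)%E.

Let k (x y : TB) : R := expR (- d x y).

Let mk1 y : measurable_fun setT (fun x => k x y).
Proof.
have mi : measurable_fun setT (fun x : TB => x) by exact: measurable_id.
have my : measurable_fun setT (fun _ : TB => (y : TB)) by exact: measurable_cst.
exact: (measurableT_comp mk (measurable_fun_pair mi my)).
Qed.

Let k0 x y : 0 <= k x y. Proof. exact: expR_ge0. Qed.

Lemma weight_measure_cscale :
  is_weight_measure (cscale c^-1 (charge_of_finite_measure mu) : borel_charge R d).
Proof.
move=> y; rewrite (@charge_integral_cscale _ _ _ mu _ (fun x => k x y))//; last first.
  by rewrite invr_ge0 ltW.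
by rewrite muc -EFinM mulVf// gt_eqF.
Qed.

(** The symmetry of [d] exchanges the roles of the two measures. *)
Lemma fubini_kernel (nu : {finite_measure set TB -> \bar R}) :
  (\int[mu]_y \int[nu]_x (k x y)%:E = c%:E * nu setT)%E.
Proof.
rewrite -(@fubini_tonelli _ _ _ _ _ nu mu (fun p => (k p.1 p.2)%:E))//=; last 2 first.
- exact/measurable_EFinP.
- by move=> p; rewrite lee_fin.
rewrite (eq_integral (cst c%:E)); last first.
  move=> x _ /=; rewrite -(muc x); apply: eq_integral => y _.
  by rewrite /k dC.
by rewrite integral_cst.
Qed.

(** Integrating the kernel against [nu] and [mu] gives [M] if [nu] comes first,
    since [nu] is a weight measure, and [c] times the mass of [nu] if [mu] does.
    Tonelli applies to the Jordan parts [p] and [q] of [nu], for which the weight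
    equation reads [int p = 1 + int q]. *)
Lemma weight_measure_mass (nu : borel_charge R d) :
  is_weight_measure nu -> nu setT = (M / c)%:E.
Proof.
move=> wnu.
pose H := projT2 (cid (projT2 (cid (Hahn_decomposition nu)))).
pose p : {finite_measure set TB -> \bar R} := jordan_pos H.
pose q : {finite_measure set TB -> \bar R} := jordan_neg H.
have mI (m : {finite_measure set TB -> \bar R}) :
    measurable_fun setT (fun y => \int[m]_x (k x y)%:E)%E.
  apply: (@measurable_fun_fubini_tonelli_G _ _ _ _ _ m (fun p => (k p.1 p.2)%:E)) => //.
  - exact/measurable_EFinP.
  - by move=> z; rewrite lee_fin.
have pq y : (\int[p]_x (k x y)%:E = 1 + \int[q]_x (k x y)%:E)%E.
  have := wnu y; rewrite /charge_integral -/H -/p -/q => wy.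
  have : (\int[q]_x (k x y)%:E \is a fin_num)%E.
    move: wy; rewrite fin_numE; case: (\int[q]_x _)%E => //.
      by case: (\int[p]_x _)%E.
    have : (0 <= \int[p]_x (k x y)%:E)%E by apply: integral_ge0 => x _; rewrite lee_fin.
    by case: (\int[p]_x _)%E.
  by move=> fq; rewrite -wy subeK.
have : (c%:E * p setT = M%:E + c%:E * q setT)%E.
  rewrite -!fubini_kernel -muT -[mu setT]mul1e -integral_cst//.
  rewrite -ge0_integralD//; first by apply: eq_integral => y _; exact: pq.
  by move=> y _; apply: integral_ge0 => x _; rewrite lee_fin.
have -> : (nu setT = p setT - q setT)%E.
  exact: (jordan_decompE H measurableT).
have : p setT \is a fin_num by exact: fin_num_measure.
have : q setT \is a fin_num by exact: fin_num_measure.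
case: (p setT) (q setT) => [a| |] [b| |]//= _ _ [e].
have cn0 : c != 0 by rewrite gt_eqF.
congr (_%:E); apply: (mulfI cn0); rewrite mulrBr e addrK.
by field.
Qed.

Lemma magnitudeE : magnitude d = M / c.
Proof.
rewrite /magnitude; apply: xget_unique.
  by eexists; [exact: weight_measure_cscale|exact/weight_measure_mass/weight_measure_cscale].
by move=> m [nu wnu]; rewrite (weight_measure_mass wnu) => -[].
Qed.

End magnitude.

(** * The magnitude of a sphere with a metric given by angles *)

Section sphere_borel.
Context {R : realType} {n : nat} (r : R) (d : sphere n r -> sphere n r -> R).
Local Notation RR := (measurableTypeR R).
Local Notation SB := (g_sigma_algebraType (metric_open d)).
Hypothesis dS : forall x y, subspace_dist x y <= d x y.

Lemma coord_le_subspace_dist (x y : sphere n r) i :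
  `|sval x ord0 i - sval y ord0 i| <= subspace_dist x y.
Proof.
rewrite /subspace_dist /Defs.edist -sqrtr_sqr ler_wsqrtr//.
rewrite /sqnorm (bigD1 i)//= !mxE lerDl.
by apply: sumr_ge0 => j _; exact: sqr_ge0.
Qed.

(** Coordinates are 1-Lipschitz, and the preimage of a ray is thus open. *)
Lemma measurable_sphere_coord i :
  measurable_fun setT (fun x : SB => (sval x ord0 i : RR)).
Proof.
apply: (measurability _ (RGenOInfty.measurableE R)) => // _ [_ [a ->] <-].
rewrite setTI; apply: sub_sigma_algebra => x /=; rewrite in_itv/= andbT => ax.
exists (sval x ord0 i - a); first by rewrite subr_gt0.
move=> y xy; rewrite /= in_itv/= andbT.
have := le_lt_trans (le_trans (coord_le_subspace_dist x y i) (dS x y)) xy.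
by rewrite ltr_norml => /andP[_]; lra.
Qed.

Lemma measurable_sphere_dot :
  measurable_fun setT (fun p : SB * SB => (dot (sval p.1) (sval p.2) : RR)).
Proof.
apply: measurable_sum => i; apply: measurable_funM.
  exact: (measurableT_comp (measurable_sphere_coord i) measurable_fst).
exact: (measurableT_comp (measurable_sphere_coord i) measurable_snd).
Qed.

End sphere_borel.

Section sphere_measure.
Context {R : realType} {n : nat} (r : R) (d : sphere n r -> sphere n r -> R).
Local Notation RR := (measurableTypeR R).
Local Notation SB := (g_sigma_algebraType (metric_open d)).
Local Notation leb := (lebesgue_tuple R n.+1).

Definition punctured_ball : set (Rtuple n.+1 R) := [set t | 0 < tdot t t <= 1].

Lemma punctured_ballE : punctured_ball = tball 1 `\` tball 0.
Proof.
apply/seteqP; split => t; rewrite /punctured_ball/tball/=.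
  by move=> /andP[t0 t1]; split => //; apply/negP; rewrite -ltNge.
by move=> [t1 /negP]; rewrite -ltNge => t0; apply/andP.
Qed.

Lemma measurable_punctured_ball : measurable punctured_ball.
Proof.
by rewrite punctured_ballE; apply: measurableD; exact: measurable_tball.
Qed.

Lemma punctured_ball_volume : leb punctured_ball = (ball_volume n.+1)%:E.
Proof.
rewrite punctured_ballE.
have t0 : leb (tball 0) = 0%E.
  have := @tball_sqr R n.+1 0 isT (lexx 0); by rewrite !expr0n mul0r.
have m0 := @measurable_tball R n.+1 0; have m1 := @measurable_tball R n.+1 1.
have i0 : leb (tball 1 `&` tball 0) = 0%E.
  by apply: (subset_measure0 _ m0 _ t0) => //; exact: measurableI.
transitivity (leb (tball 1) - leb (tball 1 `&` tball 0))%E; last first.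
  by rewrite i0 sube0 ball_volumeE.
by apply: measureD => //; exact: tball_fin.
Qed.

(** A rotation-invariant measure on the sphere, which is constructed without
    reference to a chart. The origin is removed from the ball as it has no radial
    projection. The measurability of the projection is an argument for the same
    reason as for densities. *)
Definition sphere_measure
    & measurable_fun setT (@radial_projection R n r : _ -> SB) :=
  fun A : set SB => leb (@radial_projection R n r @^-1` A `&` punctured_ball).

Variable mproj : measurable_fun setT (@radial_projection R n r : _ -> SB).
Local Notation sm := (sphere_measure mproj).

Let restr := mrestr leb measurable_punctured_ball.

Let sm0 : sm set0 = 0%E.
Proof. by rewrite /sphere_measure preimage_set0 set0I measure0. Qed.

Let sm_ge0 A : (0 <= sm A)%E.
Proof. exact: measure_ge0. Qed.

Let mpre (A : set SB) : measurable A -> measurable (@radial_projection R n r @^-1` A).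
Proof. by move=> mA; rewrite -[X in measurable X]setTI; exact: mproj. Qed.

Let sm_semi_sigma_additive : semi_sigma_additive sm.
Proof.
move=> F mF tF mUF; rewrite /sphere_measure preimage_bigcup.
apply: (@measure_semi_sigma_additive _ _ _ restr) => [i| |].
- exact: mpre.
- apply/trivIsetP => /= i j _ _ ij; rewrite -preimage_setI.
  by move/trivIsetP : tF => /(_ _ _ _ _ ij) ->//; rewrite preimage_set0.
- by rewrite -preimage_bigcup; exact: mpre.
Qed.

HB.instance Definition _ := isMeasure.Build _ _ _ sm sm0 sm_ge0 sm_semi_sigma_additive.

Lemma sphere_measureT : sm setT = (ball_volume n.+1)%:E.
Proof. by rewrite /sphere_measure preimage_setT setTI punctured_ball_volume. Qed.

Let sm_fin : fin_num_fun sm.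
Proof.
move=> A mA; rewrite ge0_fin_numE//.
apply: (@le_lt_trans _ _ (sm setT)); last by rewrite sphere_measureT ltry.
by apply: le_measure; rewrite ?inE.
Qed.

HB.instance Definition _ := Measure_isFinite.Build _ _ _ sm sm_fin.

Lemma ge0_integral_sphere_measure (f : SB -> \bar R) :
  measurable_fun setT f -> (forall x, (0 <= f x)%E) ->
  (\int[sm]_x f x = \int[leb]_(t in punctured_ball) f (@radial_projection R n r t))%E.
Proof.
move=> mf f0.
have mfphi : measurable_fun setT (fun t => f (@radial_projection R n r t)).
  exact: (measurableT_comp mf mproj).
transitivity (\int[restr]_t f (@radial_projection R n r t))%E.
  by rewrite -(@ge0_integral_pushforward _ _ _ _ _ _ mproj restr setT f).
rewrite (@ge0_negligible_integral _ _ _ restr setT (~` punctured_ball))//=.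
- rewrite setTD setCK; apply: eq_measure_integral => A mA AD.
  by rewrite /= /restr /mrestr setIidl.
- exact: (measurableC measurable_punctured_ball).
- by rewrite /= /restr /mrestr setICl measure0.
Qed.

End sphere_measure.

Section sphere_magnitude.
Context {R : realType} {m : nat} (r : R).
Hypothesis r0 : 0 < r.
Variables (d : sphere m.+1 r -> sphere m.+1 r -> R) (G : R -> R) (C S L : R).
Local Notation mu := (@lebesgue_measure R).
Local Notation RR := (measurableTypeR R).
Local Notation SB := (g_sigma_algebraType (metric_open d)).
Local Notation leb n := (lebesgue_tuple R n).
Hypotheses (mG : measurable_fun setT G) (G0 : forall x, 0 <= G x).
Hypothesis dG : forall x y,
  expR (- d x y) = G (dot (sval x) (sval y) / r ^+ 2).
Hypotheses (C0 : 0 < C) (dC : forall x y, d x y <= C * subspace_dist x y).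
Hypothesis dS : forall x y, subspace_dist x y <= d x y.
Hypotheses (S0 : 0 < S) (L0 : 0 < L).
Hypothesis SE : (\int[mu]_(t in `]0%R, pi[) (sin t ^+ m)%:E = S%:E)%E.
Hypothesis LE :
  (\int[mu]_(t in `]0%R, pi[) (G (cos t) * sin t ^+ m)%:E = L%:E)%E.

Let mproj := measurable_radial_projection r0 C0 dC.
Let sm : {finite_measure set SB -> \bar R} := sphere_measure mproj.
Let w : R -> R := \1_(`]0, 1]).

Let mw : measurable_fun setT w.
Proof. exact: measurable_indic. Qed.

Let w0 x : 0 <= w x. Proof. by rewrite /w indicE. Qed.

Let integral_punctured_ball (f : Rtuple m.+2 R -> R) :
  (\int[leb m.+2]_(t in punctured_ball) (f t)%:E =
   \int[leb m.+2]_t (f t * w (tdot t t))%:E)%E.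
Proof.
rewrite integral_mkcond; apply: eq_integral => t _; rewrite patchE /w indicE.
have -> : (tdot t t \in `]0, 1]%classic) = (t \in punctured_ball).
  by apply/idP/idP; rewrite !inE.
by case: ifPn => _; rewrite ?mulr1 ?mulr0.
Qed.

(** On the ball the kernel is a function of [<y / r, t>] and [|t|], where [y / r]
    is a unit vector. Rotation invariance puts the latter on the first axis, and
    the value is independent of [y]. *)
Lemma integral_sphere_kernel (y : sphere m.+1 r) :
  (\int[sm]_x (expR (- d x y))%:E = zonal_const m w * L%:E)%E.
Proof.
have mE : measurable_fun setT (fun x : SB => (expR (- d x y))%:E).
  apply/measurable_EFinP.
  have -> : (fun x : SB => expR (- d x y)) =
      (fun x : SB => G ((dot (sval x) (sval y)) / r ^+ 2)).
    by apply/funext => x; exact: dG.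
  apply: (measurableT_comp mG); apply: measurable_funM => //.
  have mi : measurable_fun setT (fun x : SB => x) by exact: measurable_id.
  have my : measurable_fun setT (fun _ : SB => (y : SB)) by exact: measurable_cst.
  exact: (measurableT_comp (measurable_sphere_dot dS) (measurable_fun_pair mi my)).
rewrite ge0_integral_sphere_measure//.
rewrite integral_punctured_ball.
pose y' : Rtuple m.+2 R := [tuple sval y ord0 i / r | i < m.+2].
have y'1 : tdot y' y' = 1.
  rewrite /tdot (eq_bigr (fun i => (sval y ord0 i) ^+ 2 / r ^+ 2)); last first.
    by move=> i _; rewrite !tnth_mktuple -expr2 expr_div_n.
  have := svalP y; rewrite /on_sphere -mulr_suml => /eqP.
  by rewrite /sqnorm => ->; rewrite divff// expf_neq0// gt_eqF.
pose H (a b : R) : \bar R := (G (a / Num.sqrt b) * w b)%:E.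
transitivity (\int[leb m.+2]_t H (tdot y' t) (tdot t t))%E.
  apply: eq_integral => t _; rewrite /H dG; congr EFin.
  have [t0|t0] := eqVneq (tdot t t) 0.
    by rewrite /w indicE t0 memNset ?mulr0//= in_itv/= ltxx.
  congr (G _ * _); rewrite radial_projectionE// dotZl.
  have -> : tdot y' t = dot (row_of_tuple t) (sval y) / r.
    rewrite /tdot /dot mulr_suml; apply: eq_bigr => i _.
    by rewrite tnth_mktuple mxE; ring.
  have s0 : Num.sqrt (tdot t t) != 0.
    by rewrite gt_eqF// sqrtr_gt0 lt_neqAle eq_sym t0 tdot_ge0.
  by field; rewrite s0 gt_eqF.
rewrite integral_tdot_rotation; last 2 first.
- apply/measurable_EFinP; apply: measurable_funM; last first.
    exact: (measurableT_comp mw measurable_snd).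
  apply: (measurableT_comp mG); apply: measurable_funM; first exact: measurable_fst.
  exact: (measurableT_comp measurable_inv (measurableT_comp measurable_sqrt measurable_snd)).
- by move=> a b; rewrite lee_fin mulr_ge0.
rewrite y'1 sqrtr1 -LE -integral_zonal//.
by apply: eq_integral => t _; rewrite mul1r.
Qed.

Let zonal_const_mass : (zonal_const m w * S%:E = (ball_volume m.+2)%:E)%E.
Proof.
rewrite -punctured_ball_volume -SE.
transitivity (zonal_const m w *
    \int[mu]_(t in `]0%R, pi[) (cst 1 (cos t) * sin t ^+ m)%R%:E)%E.
  by congr (_ * _)%E; apply: eq_integral => t _; rewrite mul1r.
rewrite -integral_zonal//.
rewrite -[leb _ _]mul1e -integral_cst; last exact: measurable_punctured_ball.
by rewrite (integral_punctured_ball (cst 1)).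
Qed.

(** The mass of [sm] and the integral of the kernel are [S] and [L] times the same
    zonal constant, since the mass is the integral of the constant kernel. *)
Lemma sphere_magnitudeE :
  (exists nu : borel_charge R d, is_weight_measure nu) /\ magnitude d = S / L.
Proof.
have [K K0 KE] : exists2 K : R, 0 < K & zonal_const m w = K%:E.
  have : (0 <= zonal_const m w)%E.
    rewrite /zonal_const mule_ge0//.
      by rewrite lee_fin mulr_ge0// ltW// ball_volume_gt0.
    apply: integral_ge0 => x; rewrite /= in_itv/= andbT => x0.
    by rewrite lee_fin; apply: mulr_ge0; [exact/exprn_ge0/ltW|exact: w0].
  have := zonal_const_mass; case: (zonal_const m w) => [K| |]//.
    move=> [e] _; exists K => //.
    by rewrite -(pmulr_lgt0 _ S0) e ball_volume_gt0.
  by rewrite gt0_mulye// lte_fin.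
have smT : sm setT = (K * S)%:E.
  by rewrite EFinM -KE zonal_const_mass -(sphere_measureT mproj).
have KL0 : 0 < K * L by rewrite mulr_gt0.
have dsym x y : d x y = d y x.
  apply: oppr_inj; apply: expR_inj; rewrite !dG; congr (G (_ / _)).
  exact: dotC.
have mk : measurable_fun setT (fun p : SB * SB => expR (- d p.1 p.2)).
  have -> : (fun p : SB * SB => expR (- d p.1 p.2)) =
      (fun p : SB * SB => G ((dot (sval p.1) (sval p.2)) / r ^+ 2)).
    by apply/funext => x; exact: dG.
  apply: (measurableT_comp mG); apply: measurable_funM => //.
  exact: measurable_sphere_dot.
have kc (y : SB) : (\int[sm]_x (expR (- d x y))%:E = (K * L)%:E)%E.
  by rewrite integral_sphere_kernel KE.
split; first by eexists; exact: (weight_measure_cscale KL0 mk kc).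
rewrite (magnitudeE KL0 smT dsym mk kc).
by field; rewrite !gt_eqF.
Qed.

End sphere_magnitude.

(** * The asymptotic expansion of the magnitude *)

(** If [y = 1 - c u + e] then
    [y^-1 - 1 - c u = (c^2 u^2 - e - c u e) / y]. *)
Lemma inverse_expansion (R : realType) (c D u y : R) :
  0 <= D -> 0 <= u -> u <= 1 -> `|c| * u <= 1 / 4 -> D * u <= 1 / 4 ->
  `|y - (1 - c * u)| <= D * u ^+ 2 ->
  `|y^-1 - 1 - c * u| <= 2 * (D + c ^+ 2 + `|c| * D) * u ^+ 2.
Proof.
move=> D0 u0 u1 cu Du.
set e := y - (1 - c * u) => eD.
have yE : y = 1 - c * u + e by rewrite /e; ring.
have De : D * u ^+ 2 <= 1 / 4.
  by rewrite expr2 mulrA (le_trans _ Du)// ler_piMr// mulr_ge0.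
have cu' : `|c * u| <= 1 / 4 by rewrite normrM (ger0_norm u0).
have y2 : 1 / 2 <= y.
  rewrite yE; have := ler_norm (c * u); have := ler_norm (- e); rewrite normrN; lra.
have y0 : 0 < y by lra.
have -> : y^-1 - 1 - c * u = (- e + c ^+ 2 * u ^+ 2 - c * u * e) / y.
  have yn0 : y != 0 by rewrite gt_eqF.
  apply: (mulIf yn0); rewrite mulrBl mulrBl mulVf// mulfVK// mul1r.
  by rewrite {1 2}yE; ring.
rewrite normrM normfV (gtr0_norm y0) ler_pdivrMr//.
set K := D + c ^+ 2 + `|c| * D.
have K0 : 0 <= K by rewrite !addr_ge0// ?sqr_ge0// mulr_ge0.
apply: (@le_trans _ _ (K * u ^+ 2)); last first.
  have Ku : 0 <= K * u ^+ 2 by rewrite mulr_ge0// sqr_ge0.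
  rewrite (_ : _ * y = K * u ^+ 2 * (2 * y)); last by ring.
  by rewrite ler_peMr//; lra.
have h1 : `|c ^+ 2 * u ^+ 2| = c ^+ 2 * u ^+ 2 by rewrite ger0_norm// mulr_ge0// sqr_ge0.
have h2 : `|c * u * e| <= `|c| * D * u ^+ 2.
  rewrite normrM normrM (ger0_norm u0) -!mulrA ler_wpM2l//.
  apply: (@le_trans _ _ (1 * `|e|)); last by rewrite mul1r.
  by rewrite ler_wpM2r.
apply: le_trans (ler_normB _ _) _; apply: le_trans (lerD (ler_normD _ _) h2) _.
by rewrite normrN h1 /K !mulrDl; lra.
Qed.

Section asymptotics.
Context {R : realType} (m : nat).
Local Notation mu := (@lebesgue_measure R).
Implicit Types r : R.

Lemma integral_sin_pow :
  exists2 S : R, 0 < S & (\int[mu]_(t in `]0%R, pi[) (sin t ^+ m)%:E = S%:E)%E.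
Proof.
have /= := @laplace_integral_gt0 R id m 0 (lexx 0) (@measurable_id _ _ _).
rewrite /laplace_integral => /(_ (fun t _ _ => lexx t)).
under eq_integral do rewrite mul0r oppr0 expR0 mul1r.
have : (\int[mu]_(t in `]0%R, pi[) (sin t ^+ m)%:E <=
        \int[mu]_(t in `]0%R, pi[) (cst 1 t))%E.
  apply: ge0_le_integral => //.
  - move=> t /=; rewrite in_itv/= => /andP[t0 tp].
    by rewrite lee_fin exprn_ge0// sin_ge0_pi// !ltW.
  - apply/measurable_EFinP; apply: measurable_funTS; apply: measurable_funX.
    by apply: continuous_measurable_fun; exact: continuous_sin.
  - move=> t /=; rewrite in_itv/= => /andP[t0 tp].
    have s0 : 0 <= sin t by rewrite sin_ge0_pi// !ltW.
    by rewrite lee_fin exprn_ile1// sin_le1.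
rewrite integral_cst//= lebesgue_measure_itv /= lte_fin pi_gt0 mul1e -EFinB.
case: (\int[mu]_(t in _) _)%E => [S| |]// _; rewrite lte_fin => S0.
by exists S.
Qed.

Variables (delta : R -> R) (k C Cd : R) (g : R -> R).
Variable d : forall r, sphere m.+1 r -> sphere m.+1 r -> R.
Hypotheses (k0 : 0 <= k) (C0 : 0 <= C) (dP : near_identity delta k C).
Hypotheses (mdelta : measurable_fun setT delta) (mg : measurable_fun setT g).
Hypothesis gcos : forall t, 0 < t -> t < pi -> g (cos t) = delta t.
Hypothesis dE : forall r (x y : sphere m.+1 r), 0 < r ->
  d x y = r * g (dot (sval x) (sval y) / r ^+ 2).
Hypotheses (Cd0 : 0 < Cd) (dC : forall r (x y : sphere m.+1 r), 0 < r ->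
  d x y <= Cd * subspace_dist x y).
Hypothesis dS : forall r (x y : sphere m.+1 r), 0 < r -> subspace_dist x y <= d x y.

Lemma zonal_magnitudeE r S L : 0 < r -> 0 < S -> 0 < L ->
  (\int[mu]_(t in `]0%R, pi[) (sin t ^+ m)%:E = S%:E)%E ->
  laplace_integral delta m r = L%:E ->
  (exists nu : borel_charge R (@d r), is_weight_measure nu) /\
  magnitude (@d r) = S / L.
Proof.
move=> r0 S0 L0 SE LE.
apply: (sphere_magnitudeE r0 (G := fun c => expR (- (r * g c))) (C := Cd)) => //.
- apply: (measurableT_comp (@measurable_expR R)); apply: measurable_funN.
  exact: measurable_funM.

- by move=> x y; rewrite dE.
- by move=> x y; exact: dC.
- by move=> x y; exact: dS.
- rewrite -LE /laplace_integral; apply: eq_integral => t.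
  by rewrite inE /= in_itv/= => /andP[t0 tp]; rewrite gcos.
Qed.

(** The quotient of the magnitude by its leading term is the inverse of the
    normalized Laplace integral, as [S] cancels against the volume. *)
Lemma magnitude_asymptotics :
  (forall r, 0 < r -> exists nu : borel_charge R (@d r), is_weight_measure nu) /\
  exists2 E : R -> R, E =O_ (+oo_R) (fun r : R => r ^- 4) &
    forall r, 0 < r -> magnitude (@d r) =
      sphere_volume m.+1 r / (m.+1`!%:R * unit_ball_volume R m.+1) *
      (1 + m.+1%:R * m.+2%:R * (m%:R / 6 - k * m.+3%:R) * r ^- 2 + E r).
Proof.
have [S S0 SE] := integral_sin_pow.
have [D D0 asym] := laplace_integral_asymptotics m k0 C0 dP mdelta.
have Lpos r L : 0 < r -> laplace_integral delta m r = L%:E -> 0 < L.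
  move=> r0 LE; rewrite -lte_fin -LE; apply: laplace_integral_gt0 => //; first exact: ltW.
  by move=> t t0 tp; have [] := dP t0 tp.
split=> [r r0|].
  have [L LE _] := asym r r0.
  by have [] := zonal_magnitudeE r0 S0 (Lpos _ _ r0 LE) SE LE.
set c := _ * _ * (_ - _).
pose pref r := sphere_volume m.+1 r / (m.+1`!%:R * unit_ball_volume R m.+1).
have w0 : unit_ball_volume R m.+1 != 0 by rewrite unit_ball_volumeE gt_eqF// ball_volume_gt0.
have f0 : m`!%:R != 0 :> R by rewrite pnatr_eq0 -lt0n fact_gt0.
have prefE r : 0 < r -> pref r = r ^+ m.+1 * S / m`!%:R.
  move=> r0; rewrite /pref /sphere_volume sphere_volumeE// SE -EFinM /=.
  have m1 : m.+1%:R != 0 :> R by rewrite pnatr_eq0.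
  rewrite factS natrM; move: (unit_ball_volume _ _) (m.+1%:R) (m`!%:R) w0 m1 f0.
  by move=> a b e a0 b0 e0; field; rewrite a0 b0 e0.
have magE r : 0 < r -> exists2 y : R, 0 < y /\ `|y - (1 - c * r ^- 2)| <= D * r ^- 4 &
    magnitude (@d r) = pref r * y^-1.
  move=> r0; have [L LE yE] := asym r r0; have L0 := Lpos _ _ r0 LE.
  exists (r ^+ m.+1 * L / m`!%:R).
    split=> //; rewrite divr_gt0 ?ltr0n ?fact_gt0// mulr_gt0// exprn_gt0//.
  have [_ ->] := zonal_magnitudeE r0 S0 L0 SE LE.
  by rewrite prefE//; field; rewrite f0 !gt_eqF// exprn_gt0.
exists (fun r => magnitude (@d r) / pref r - 1 - c * r ^- 2); last first.
  move=> r r0; rewrite -/(pref r).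
  have p0 : pref r != 0.
    rewrite prefE// gt_eqF// divr_gt0 ?ltr0n ?fact_gt0// mulr_gt0// exprn_gt0//.
  by field; rewrite p0 gt_eqF.
apply/eqO_exP; exists (2 * (D + c ^+ 2 + `|c| * D) + 1).
  by rewrite ltr_wpDl// mulr_ge0// !addr_ge0// ?sqr_ge0// mulr_ge0.
(* From there on [u = r^-2] satisfies the smallness conditions of
   [inverse_expansion]. *)
exists (1 + 4 * (`|c| + D)); split; first exact: num_real.
move=> r rlt.
have c0 : 0 <= `|c| by [].
have r1 : 1 <= r by lra.
have r0 : 0 < r by lra.
have [y [y0 yP] ->] := magE r r0.
have p0 : pref r != 0.
  rewrite prefE// gt_eqF// divr_gt0 ?ltr0n ?fact_gt0// mulr_gt0// exprn_gt0//.
rewrite (mulrC (pref r)) mulfK//.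
have ri : r ^- 2 <= r^-1.
  by rewrite lef_pV2 ?posrE ?exprn_gt0// expr2 ler_peMr// ltW.
have rV : r ^- 2 * r <= 1 by rewrite -ler_pdivlMr// div1r.
have u0 : 0 <= r ^- 2 by rewrite invr_ge0 exprn_ge0// ltW.
have r4 : r ^- 4 = (r ^- 2) ^+ 2 by rewrite exprVn -exprM.
rewrite r4 in yP *.
apply: le_trans (inverse_expansion D0 u0 _ _ _ yP) _.
- by apply: le_trans ri _; rewrite invf_le1.
- nra.
- nra.
- rewrite (ger0_norm (sqr_ge0 _)) ler_wpM2r ?sqr_ge0//; lra.
Qed.

End asymptotics.

(** * Chords and arcs *)

Section chord_and_arc.
Context {R : realType}.

Lemma near_identity_id : near_identity (@id R) 0 0.
Proof.
move=> t t0 _; split => //; first by rewrite ler_pdivrMr// ler_peMr ?ler1n// ltW.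
by rewrite subrr mul0r subrr normr0 mul0r.
Qed.

(** With [x = t / 2] this is [x - x^3/6 <= sin x <= x - x^3/6 + x^5/120], and
    [x^2 <= 4] for the lower bound [t / 3]. *)
Lemma near_identity_chord : near_identity (fun t : R => 2 * sin (t / 2)) 24^-1 1.
Proof.
move=> t t0 tp; have p2 := pihalf_lt2 R.
have t20 : 0 <= t / 2 by rewrite divr_ge0// ltW.
have lo := sin_ge_cubic t20; have up := sin_le_quintic t20.
have le := sin_le_id t20.
have x2 : (t / 2) ^+ 2 <= 4.
  by rewrite (_ : 4 = 2 ^+ 2); [rewrite ler_sqr ?nnegrE; lra|ring].
have x3 : (t / 2) ^+ 3 <= 4 * (t / 2) by rewrite exprSr ler_wpM2r.
have x5 : 0 <= t ^+ 5 by rewrite exprn_ge0// ltW.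
have e3 : (t / 2) ^+ 3 = t ^+ 3 / 8 by field.
have e5 : (t / 2) ^+ 5 = t ^+ 5 / 32 by field.
rewrite e3 e5 in lo up x3.
split; [lra|lra|rewrite ler_norml; apply/andP; split; lra].
Qed.

Lemma sqrt_cos_chord (t : R) : 0 < t -> t < pi ->
  Num.sqrt (2 - 2 * cos t) = 2 * sin (t / 2).
Proof.
move=> t0 tp; have -> : 2 - 2 * cos t = (2 * sin (t / 2)) ^+ 2.
  by rewrite (_ : 2 - _ = 2 * (1 - cos t)); [rewrite sqr_sin_half|]; ring.
rewrite sqrtr_sqr ger0_norm// mulr_ge0// sin_ge0_pi//; apply/andP; split; lra.
Qed.

(** [acos] is unspecified outside of [-1, 1]. This function agrees with it on the
    segment and is measurable on the whole line. *)
Definition acos_ext (c : R) : R :=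
  (acos \_ `]-1, 1[) c + pi * \1_(`]-oo, -1]) c.

Lemma measurable_acos_ext : measurable_fun setT acos_ext.
Proof.
apply: measurable_funD; last by apply: measurable_funM => //; exact: measurable_indic.
apply/(measurable_restrictT _ _).1 => //.
apply: open_continuous_measurable_fun; first exact: interval_open.
by move=> c; rewrite inE /= in_itv/= => c1; exact: continuous_acos.
Qed.

Lemma acos_extE (c : R) : -1 <= c <= 1 -> acos_ext c = acos c.
Proof.
move=> /andP[c1 c2]; rewrite /acos_ext patchE indicE.
have [->|cN1] := eqVneq c (- 1).
  rewrite memNset ?mem_set//= ?in_itv/= ?lexx ?ltxx//.
  by rewrite mulr1 add0r acosN1.
rewrite [c \in `]-oo, _]%classic]memNset; last first.
  by rewrite /= in_itv/= => c3; move: cN1; rewrite eq_le c3 c1.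
rewrite mulr0 addr0; have [->|cn1] := eqVneq c 1.
  by rewrite memNset /= ?in_itv/= ?ltxx ?andbF// acos1.
by rewrite mem_set//= in_itv/= !lt_neqAle c1 c2 cn1 eq_sym cN1.
Qed.

End chord_and_arc.

Theorem theorem13 (R : realType) (n : nat) (n_ge1 : (1 <= n)%N) :
  ((forall r : R, 0 < r -> exists nu : borel_charge R (@subspace_dist R n r),
      is_weight_measure nu) /\
   exists2 E : R -> R, E =O_ (+oo_R) (fun r : R => r ^- 4) &
     forall r : R, 0 < r ->
       magnitude (@subspace_dist R n r) =
         sphere_volume n r / (n`!%:R * unit_ball_volume R n) *
         (1 + (n%:R + 1) * n%:R * (n%:R - 2) / 8 * r ^- 2 + E r))
  /\
  ((forall r : R, 0 < r -> exists nu : borel_charge R (@intrinsic_dist R n r),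
      is_weight_measure nu) /\
   exists2 E : R -> R, E =O_ (+oo_R) (fun r : R => r ^- 4) &
     forall r : R, 0 < r ->
       magnitude (@intrinsic_dist R n r) =
         sphere_volume n r / (n`!%:R * unit_ball_volume R n) *
         (1 + (n%:R + 1) * n%:R * (n%:R - 1) / 6 * r ^- 2 + E r)).
Proof.
case: n n_ge1 => // m _.
have mc : m.+1%:R = m%:R + 1 :> R by rewrite -natr1.
have mc2 : m.+2%:R = m%:R + 2 :> R by rewrite -addn2 natrD.
have mc3 : m.+3%:R = m%:R + 3 :> R by rewrite -addn3 natrD.
split.
  have g0 (r : R) (x y : sphere m.+1 r) : 0 < r ->
      subspace_dist x y = r * Num.sqrt (2 - 2 * (dot (sval x) (sval y) / r ^+ 2)).
    by move=> r0; exact: subspace_distE.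
  have mg : measurable_fun setT (fun c : R => Num.sqrt (2 - 2 * c)).
    by apply: (measurableT_comp measurable_sqrt); apply: measurable_funB => //; exact: measurable_funM.
  have md : measurable_fun setT (fun t : R => 2 * sin (t / 2)).
    apply: measurable_funM => //.
    apply: (measurableT_comp (continuous_measurable_fun (@continuous_sin R))).
    exact: measurable_funM.
  have k0 : 0 <= 24^-1 :> R by rewrite invr_ge0.
  have dC (r : R) (x y : sphere m.+1 r) : 0 < r -> subspace_dist x y <= 1 * subspace_dist x y.
    by move=> _; rewrite mul1r.
  have [W [E EO ME]] := magnitude_asymptotics k0 ler01 (@near_identity_chord R) md mg
    (@sqrt_cos_chord R) g0 ltr01 dC (fun r x y _ => lexx _).
  split; first exact: W.
  exists E => // r r0; rewrite ME// mc mc2 mc3; congr (_ * (1 + _ * _ + _)).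
  by field.
have g0 (r : R) (x y : sphere m.+1 r) : 0 < r ->
    intrinsic_dist x y = r * acos_ext (dot (sval x) (sval y) / r ^+ 2).
  move=> r0; rewrite intrinsic_distE// acos_extE//.
  by apply: dot_sphere_itv => //; apply/eqP; [exact: (svalP x)|exact: (svalP y)].
have gcos (t : R) : 0 < t -> t < pi -> acos_ext (cos t) = t.
  move=> t0 tp; rewrite acos_extE ?cos_geN1 ?cos_le1// cosK//.
  by rewrite in_itv/= !ltW.
have ltr03 : 0 < 3 :> R by [].
have [W [E EO ME]] := magnitude_asymptotics (lexx 0) (lexx 0) (@near_identity_id R)
  (@measurable_id _ _ _) (@measurable_acos_ext R) gcos g0 ltr03
  (fun r x y r0 => intrinsic_le_subspace r0 (ltn0Sn m) x y)
  (fun r x y r0 => subspace_le_intrinsic r0 (ltn0Sn m) x y).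
split; first exact: W.
exists E => // r r0; rewrite ME// mc mc2 mc3; congr (_ * (1 + _ * _ + _)).
by field.
Qed.
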